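(* Let $\alpha > -1$ and $0 < \sigma < \alpha +1$. Let $a,b \in \mathbb{R}$ and assume that $1\le p,q \le \infty$. (i) $L^p(x^{ap}d\mu_{\alpha}) \subset \mathrm{Dom}\, I^{\alpha,\sigma}$ if and only if $$2\sigma - \frac{2\alpha+2}{p} < a < \frac{2\alpha+2}{p'} \qquad \text{(both inequalities being $\le$ when $p=1$)}.$$ (ii) The estimate $$\big\|x^{-b}I^{\alpha,\sigma} f\big\|_{L^q(d\mu_\alpha)}\lesssim \big\|x^af\big\|_{L^p(d\mu_\alpha)}$$ holds uniformly in $f \in L^p(x^{ap}d\mu_{\alpha})$ if and only if the following conditions are satisfied: (a) $p \le q$, (b) $\frac{1}{q} = \frac{1}p + \frac{a+b-2\sigma}{2\alpha+2}$, (c) $a < \frac{2\alpha+2}{p'}$ ($\le$ when $p = q'= 1$), (d) $b < \frac{2\alpha+2}q$ ($\le$ when $p = q'=1$), (e) $\frac{1}q \ge \frac{1}p - 2\sigma$ ($>$ when $p=1$ or $q=\infty$).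
   Context: For $\alpha>-1$ let $d\mu_\alpha(x)=x^{2\alpha+1}dx$ on $\mathbb{R}_+=(0,\infty)$, let $I_\alpha(\cdot)$ (no second superscript) denote the modified Bessel function of the first kind of order $\alpha$, and for $t,x,y>0$ let $$W_t^{\alpha}(x,y)=\frac{1}{2t}\exp\Big(-\frac{x^2+y^2}{4t}\Big)(xy)^{-\alpha}I_\alpha\Big(\frac{xy}{2t}\Big).$$ For $\sigma>0$ define $$K^{\alpha,\sigma}(x,y)=\frac1{\Gamma(\sigma)}\int_0^\infty W_t^\alpha(x,y)\,t^{\sigma-1}\,dt,\qquad x,y>0,$$ and the potential operator $$I^{\alpha,\sigma}f(x)=\int_0^\infty K^{\alpha,\sigma}(x,y)f(y)\,d\mu_\alpha(y),\qquad x>0,$$ whose natural domain $\mathrm{Dom}\,I^{\alpha,\sigma}$ consists of those functions $f$ for which this integral converges for a.e. $x>0$. $L^p(x^{ap}d\mu_\alpha)$ denotes the space of measurable $f$ on $\mathbb{R}_+$ with $x^af\in L^p(d\mu_\alpha)$, also for $p=\infty$. $p'$ is the conjugate exponent, $1/p+1/p'=1$, and $1/\infty=0$. $X\lesssim Y$ means $X\le CY$ with a constant $C>0$ independent of $f$. *)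

(* Defs.v *)
From HB Require Import structures.
From mathcomp Require Import all_boot all_order all_algebra.
From mathcomp Require Import all_classical all_reals all_analysis.
From mathcomp Require Import measurable_realfun.

Set Implicit Arguments.
Unset Strict Implicit.
Unset Printing Implicit Defensive.
Import Order.TTheory GRing.Theory Num.Theory.
Import numFieldNormedType.Exports.

Local Open Scope classical_set_scope.
Local Open Scope ring_scope.

(* Functions on the half-line (0, +oo) are represented by functions on R of
   which only the values on `]0, +oo[ matter.  For x <= 0 the values of powR
   are junk, hence the restrictions to `]0, +oo[ below. *)

Definition mu_bessel {R : realType} (alpha : R) (A : set R) : \bar R :=
  (\int[lebesgue_measure]_(x in A `&` `]0%R, +oo[)
     (x `^ (2 * alpha + 1))%:E)%E.

Section mu_bessel_measure.
Context {R : realType} (alpha : R).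
Local Open Scope ereal_scope.

Let mu0 : mu_bessel alpha set0 = 0.
Proof. by rewrite /mu_bessel set0I integral_set0. Qed.

Let mu_ge0 A : 0 <= mu_bessel alpha A.
Proof. by apply: integral_ge0 => x _; rewrite lee_fin powR_ge0. Qed.

Let mu_sigma_additive : semi_sigma_additive (mu_bessel alpha).
Proof.
move=> /= F mF tF mUF; rewrite /mu_bessel; apply: cvg_toP.
  apply: ereal_nondecreasing_is_cvgn => m n mn.
  by apply: lee_sum_nneg_natr => // k _ _; exact: mu_ge0.
rewrite setI_bigcupl ge0_integral_bigcup//=.
- by move=> k; apply: measurableI; [exact: mF|exact: measurable_itv].
- apply/measurable_EFinP.
  apply: (@measurable_funTS _ _ (measurableTypeR R)).
  exact: measurable_powR.
- by move=> x _; rewrite lee_fin powR_ge0.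
- exact: trivIset_setIr.
Qed.

HB.instance Definition _ := isMeasure.Build _ _ _
  (mu_bessel alpha) mu0 mu_ge0 mu_sigma_additive.

End mu_bessel_measure.

Section potential.
Context {R : realType}.
Implicit Types (alpha sigma a t x y z s : R) (p : \bar R).

Definition Gamma_fun s : R :=
  \int[lebesgue_measure]_(t in `]0, +oo[) (t `^ (s - 1) * expR (- t)).

(* Modified Bessel function of the first kind, for z > 0 and alpha > -1: the
   arguments k + alpha + 1 of Gamma are then positive. *)
Definition besselI alpha z : R :=
  limn (series (fun k : nat => (z / 2) `^ (2 * k%:R + alpha) /
                               (k`!%:R * Gamma_fun (k%:R + alpha + 1)))).

Definition W_kernel alpha t x y : R :=
  (2 * t)^-1 * expR (- ((x ^+ 2 + y ^+ 2) / (4 * t))) *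
  (x * y) `^ (- alpha) * besselI alpha (x * y / (2 * t)).

Local Open Scope ereal_scope.

(* Extended-real valued: the integral diverges for x = y when sigma <= 1/2. *)
Definition K_kernel alpha sigma x y : \bar R :=
  ((Gamma_fun sigma)^-1)%:E *
  \int[lebesgue_measure]_(t in `]0%R, +oo[)
    (W_kernel alpha t x y * t `^ (sigma - 1))%:E.

Definition I_potential alpha sigma (f : R -> R) x : \bar R :=
  \int[mu_bessel alpha]_(y in `]0%R, +oo[)
    (K_kernel alpha sigma x y * (f y)%:E).

Definition Dom_potential alpha sigma : set (R -> R) :=
  [set f : R -> R | {ae lebesgue_measure, forall x : R, (0 < x)%R ->
     (mu_bessel alpha).-integrable `]0%R, +oo[
        (fun y => K_kernel alpha sigma x y * (f y)%:E)}].

Definition Lnorm_half alpha p (g : R -> \bar R) : \bar R :=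
  'N[mu_bessel alpha]_p[g \_ `]0%R, +oo[].

Definition wLp alpha p a : set (R -> R) :=
  [set f : R -> R | measurable_fun (`]0%R, +oo[ : set R) f /\
           Lnorm_half alpha p (fun x => (x `^ a * f x)%:E) < +oo].

(* The reciprocal 1 / p of an exponent p in [1, +oo], with 1 / +oo = 0. *)
Definition rexp p : R := fine p^-1.

End potential.

(* Main.v *)
From HB Require Import structures.
Require Import Defs.
From mathcomp Require Import all_boot all_order all_algebra.
From mathcomp Require Import all_classical all_reals all_analysis.
From mathcomp Require Import measurable_realfun ring lra.

Import Order.TTheory GRing.Theory Num.Theory.
Import numFieldNormedType.Exports.
Local Open Scope classical_set_scope.
Local Open Scope ring_scope.
Set Implicit Arguments.
Unset Strict Implicit.
Unset Printing Implicit Defensive.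

(** Put x = exp t and y = exp s.  The measure x^(2 alpha + 1) dx becomes
    exp (D t) dt with D = 2 alpha + 2, and the homogeneity of the kernel makes
    it, up to exponential factors, a function of t - s alone: integrating the
    Bessel series term by term in time gives
      K (exp t, exp s) = C0 exp (- be (t + s)) k (t - s),  be = alpha + 1 - sigma,
      k u = (2 cosh u)^(- be) sum_n d_n (cosh u)^(- 2 n),
    where d_n is comparable to (n + 1)^(- sigma - 1/2).  Hence k decays like
    exp (- be |u|), while near 0 it behaves like |u|^(2 sigma - 1) if
    sigma < 1/2, is unbounded if sigma = 1/2 and is bounded if sigma > 1/2.
    These facts form the record [kernel_profile]; [bessel_profile] proves them
    and [K_kernel_expR] identifies the kernel.

    With G s = exp ((a + D / p) s) |f (exp s)| the norm of x^a f is the L^p norm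
    of G on the line, and the norm of x^(- b) times the potential of |f| is, up
    to the factor C0, the L^q norm of
      exp (theta t) int exp (- Q (t - s)) k (t - s) G s ds,
      Q = D / p' - a - be,   theta = D (1/q - 1/p) - (a + b) + 2 sigma.
    So (b) says theta = 0, the bounds on a in (i), as well as (c) and (d)
    together, say |Q| < be (or <=), and the theorem is about convolution with
    the tilted kernel exp (- Q u) k u, which is of size
    exp (- (be - |Q|) |u|) at infinity in the less favourable direction.

    Sufficiency ([tilted_potential_bounded]).  If the inequality in (e) is
    strict the tilted kernel lies in L^r with 1/r = 1 + 1/q - 1/p, and Young's
    inequality applies.  In case of equality its singularity is exactly that of
    a Riesz potential and the Hardy-Littlewood-Sobolev inequality is needed; it
    is derived from the maximal function by Hedberg's argument.  The endpoint
    p = 1, q = oo only needs a bounded kernel, whence the equality |Q| = be is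
    allowed there.

    Necessity.  Translating the indicator of an interval forces theta = 0
    ([theta_eq0]), long intervals force p <= q ([rexp_le]), one fixed interval
    observed far away forces |Q| < be when q < oo ([tilt_lt]), and short
    intervals force (e) ([rexp_sub_le], with the equality cases excluded by
    [rexp_sub_lt_p1] and [rexp_sub_lt_qy]).  Functions with slowly decaying
    tails have infinite potential when |Q| is too large, which settles (i)
    ([tilt_lt_of_ae_finite]). *)

(** * The exponential change of variable *)

Section image_density.
Local Open Scope ereal_scope.
Context d1 d2 (X : measurableType d1) (Y : measurableType d2) (R : realType).
Variables (mu : {measure set X -> \bar R}) (nu : {measure set Y -> \bar R}).
Variables (phi : X -> Y) (w : X -> R).
Hypothesis mphi : measurable_fun setT phi.
Hypothesis mw : measurable_fun setT w.
Hypothesis w_ge0 : forall x, (0 <= w x)%R.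
Hypothesis nuE : forall A, measurable A ->
  nu A = \int[mu]_(x in phi @^-1` A) (w x)%:E.

Let mpre A : measurable A -> measurable (phi @^-1` A).
Proof. by move=> mA; rewrite -(setTI (_ @^-1` _)); exact: mphi. Qed.

Import HBNNSimple.

(** Both sides are limits along an increasing sequence of simple functions, for
    which the equality is the hypothesis on measurable sets. *)
Lemma ge0_integral_image_density (f : Y -> \bar R) :
  measurable_fun setT f -> (forall y, 0 <= f y) ->
  \int[nu]_y f y = \int[mu]_x (f (phi x) * (w x)%:E).
Proof.
move=> mf f0; pose f_ := nnsfun_approx measurableT mf.
have mg n : measurable_fun setT (fun x => (f_ n (phi x))%:E * (w x)%:E).
  apply: emeasurable_funM; last exact/measurable_EFinP.
  apply/measurable_EFinP; apply: measurableT_comp => //.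
have cvgf y : (f_ n y)%:E @[n --> \oo] --> f y.
  by apply: cvg_nnsfun_approx.
transitivity (limn (fun n => \int[nu]_x (f_ n x)%:E)).
  rewrite -monotone_convergence//.
  - by apply: eq_integral => y _; apply/esym/cvg_lim => //; exact: cvgf.
  - by move=> n; exact/measurable_EFinP.
  - by move=> n y _; rewrite lee_fin.
  - by move=> y _ m n mn; rewrite lee_fin; exact/lefP/nd_nnsfun_approx.
transitivity (limn (fun n => \int[mu]_x ((f_ n (phi x))%:E * (w x)%:E))); last first.
  rewrite -monotone_convergence//.
  - apply: eq_integral => x _; apply/cvg_lim => //.
    by apply: cvgeZr => //; exact: cvgf.
  - by move=> n x _; rewrite mule_ge0// lee_fin.
  - move=> x _ m n mn; apply: lee_wpmul2r; first by rewrite lee_fin.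
    by rewrite lee_fin; exact/lefP/nd_nnsfun_approx.
congr (limn _); apply/funext => n.
transitivity (\sum_(k \in range (f_ n)) k%:E * nu (f_ n @^-1` [set k])).
  under eq_integral do rewrite fimfunE -fsumEFin//.
  rewrite ge0_integral_fsum//; last 2 first.
  - by move=> y; exact/measurable_EFinP/measurable_funM.
  - by move=> y x _; rewrite nnfun_muleindic_ge0.
  apply: eq_fsbigr => r _; rewrite integralZl_indic_nnsfun// integral_indic//=.
  by rewrite setIT.
under [RHS]eq_integral => x _.
  rewrite fimfunE -fsumEFin// ge0_mule_fsuml; last first.
    by move=> r; rewrite nnfun_muleindic_ge0.
  over.
rewrite ge0_integral_fsum//; last 2 first.
- move=> r; apply: emeasurable_funM; last exact/measurable_EFinP.
  apply/measurable_EFinP/measurable_funM => //.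
  by apply: measurableT_comp => //; exact: measurable_indic.
- by move=> r x _; rewrite mule_ge0 ?nnfun_muleindic_ge0// lee_fin.
apply: eq_fsbigr => r; rewrite inE => -[y _ yr].
have r0 : (0 <= r)%R by rewrite -yr.
under eq_integral do rewrite EFinM -muleA.
rewrite ge0_integralZl//; last 2 first.
- apply: emeasurable_funM; last exact/measurable_EFinP.
  by apply/measurable_EFinP; apply: measurableT_comp => //; exact: measurable_indic.
- by move=> x _; rewrite mule_ge0// lee_fin.
congr (_ * _); rewrite nuE// integral_mkcond; apply: eq_integral => x _.
rewrite /patch indicE /=.
have [xr|xr] := pselect (f_ n (phi x) = r).
  by rewrite !mem_set// mul1e.
by rewrite !memNset// mul0e.
Qed.

End image_density.

Section exp_substitution.
Context {R : realType}.
Notation leb := (@lebesgue_measure R).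
Local Open Scope ereal_scope.
Implicit Types (f : R -> \bar R) (e L r : R).

Lemma ge0_integralN f : measurable_fun setT f -> (forall x, 0 <= f x) ->
  \int[leb]_x f (- x)%R = \int[leb]_x f x.
Proof.
move=> mf f0.
transitivity (\int[pushforward leb (-%R : R -> measurableTypeR R)]_x f x).
  by rewrite ge0_integral_pushforward.
by apply: eq_measure_integral => A mA _; exact: lebesgue_measureN.
Qed.

Lemma lebesgue_measure_shift r (A : set R) : measurable A ->
  leb ((fun x => (x + r)%R) @^-1` A) = leb A.
Proof.
move=> mA.
have mphi : measurable_fun setT ((fun x => (x + r)%R) : R -> measurableTypeR R).
  exact: measurable_funD.
rewrite [RHS](@lebesgue_measure_unique R (pushforward leb ((fun x => (x + r)%R) : R -> measurableTypeR R)))//.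
move=> _ [[a b]] _ <-; transitivity (leb `](a - r)%R, (b - r)%R]).
  rewrite !lebesgue_measure_itv/= !lte_fin ltrD2r; case: ifPn => // _.
  by rewrite -!EFinB; congr (_%:E); ring.
congr (leb _).
by apply/seteqP; split => x /=; rewrite !in_itv/= ltrBlDr lerBrDr.
Qed.

Lemma ge0_integralDr f r : measurable_fun setT f -> (forall x, 0 <= f x) ->
  \int[leb]_x f (x + r)%R = \int[leb]_x f x.
Proof.
move=> mf f0.
have mphi : measurable_fun setT ((fun x => (x + r)%R) : R -> measurableTypeR R).
  exact: measurable_funD.
transitivity (\int[pushforward leb ((fun x => (x + r)%R) : R -> measurableTypeR R)]_x f x).
  by rewrite ge0_integral_pushforward.
by apply: eq_measure_integral => A mA _; exact: lebesgue_measure_shift.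
Qed.

Lemma ge0_integralBl f r : measurable_fun setT f -> (forall x, 0 <= f x) ->
  \int[leb]_x f (r - x)%R = \int[leb]_x f x.
Proof.
move=> mf f0; rewrite -[RHS](ge0_integralDr r)//.
rewrite -[RHS]ge0_integralN//; first by apply: eq_integral => x _; rewrite addrC.
by apply: measurableT_comp => //; exact: measurable_funD.
Qed.

Lemma measurable_patch (D : set R) f : measurable D ->
  measurable_fun setT f -> measurable_fun setT (f \_ D).
Proof.
by move=> mD mf; apply/(measurable_restrictT _ mD); exact: measurable_funTS.
Qed.

Lemma measurable_patch_EFin (D : set R) (f : R -> R) : measurable D ->
  measurable_fun setT f -> measurable_fun setT ((EFin \o f) \_ D).
Proof.
move=> mD mf; apply/(measurable_restrictT _ mD).
by apply/measurable_EFinP; exact: measurable_funTS.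
Qed.

Lemma measurable_expRM e : measurable_fun setT (fun x : R => expR (e * x)).
Proof. by apply: measurableT_comp => //; exact: mulrl_measurable. Qed.

(** The integrand is a reflected and rescaled exponential density. *)
Lemma integral_expRM_leNy e L : (0 < e)%R ->
  \int[leb]_(x in `]-oo, L]) (expR (e * x))%:E = (expR (e * L) / e)%:E.
Proof.
move=> e0; rewrite integral_mkcond -(ge0_integralBl L)//; last 2 first.
- by apply: measurable_patch_EFin => //; exact: measurable_expRM.
- by move=> x; apply: erestrict_ge0 => y _; rewrite lee_fin expR_ge0.
transitivity (\int[leb]_x ((expR (e * L) / e)%:E * (exponential_pdf e x)%:E)).
  apply: eq_integral => x _; rewrite !patchE.
  have -> : ((L - x)%R \in `]-oo, L]%classic) = (x \in `[0%R, +oo[%classic).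
    by apply/idP/idP; rewrite !inE/= !in_itv/= ?andbT gerBl.
  rewrite /exponential_pdf patchE; case: ifPn => _; last by rewrite mule0.
  rewrite -EFinM mulrA divfK ?gt_eqF//.
  by rewrite -expRD; congr (expR _)%:E; ring.
rewrite ge0_integralZl//.
- by rewrite integral_exponential_pdf// mule1.
- by apply/measurable_EFinP; exact: measurable_exponential_pdf.
- by move=> x _; rewrite lee_fin exponential_pdf_ge0// ltW.
- by rewrite lee_fin divr_ge0// ?expR_ge0// ltW.
Qed.

Lemma integral_expRM_gey e L : (0 < e)%R ->
  \int[leb]_(x in `[L, +oo[) (expR (- (e * x)))%:E = (expR (- (e * L)) / e)%:E.
Proof.
move=> e0; have := integral_expRM_leNy (- L) e0; rewrite mulrN => <-.
rewrite integral_mkcond -ge0_integralN//; last 2 first.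
- apply: measurable_patch_EFin => //.
  under eq_fun do rewrite -mulNr; exact: measurable_expRM.
- by move=> x; apply: erestrict_ge0 => y _; rewrite lee_fin expR_ge0.
rewrite [RHS]integral_mkcond; apply: eq_integral => x _; rewrite !patchE.
have -> : ((- x)%R \in `[L, +oo[%classic) = (x \in `]-oo, (- L)%R]%classic).
  by apply/idP/idP; rewrite !inE/= !in_itv/= ?andbT lerNr.
by case: ifPn => // _; rewrite mulrN opprK.
Qed.

(** The image under the exponential of the measure with density [expR]. *)
Definition exp_image (A : set (measurableTypeR R)) : \bar R :=
  \int[leb]_(s in expR @^-1` A) (expR s)%:E.

Lemma measurable_exp_preimage (A : set R) :
  measurable A -> measurable (expR @^-1` A : set R).
Proof. by move=> mA; rewrite -(setTI (_ @^-1` _)); exact: measurable_expR. Qed.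

Let exp_image0 : exp_image set0 = 0.
Proof. by rewrite /exp_image preimage_set0 integral_set0. Qed.

Let exp_image_ge0 A : 0 <= exp_image A.
Proof. by apply: integral_ge0 => x _; rewrite lee_fin expR_ge0. Qed.

Let exp_image_sigma_additive : semi_sigma_additive exp_image.
Proof.
move=> /= F mF tF mUF; rewrite /exp_image; apply: cvg_toP.
  apply: ereal_nondecreasing_is_cvgn => m n mn.
  by apply: lee_sum_nneg_natr => // k _ _; exact: exp_image_ge0.
rewrite preimage_bigcup ge0_integral_bigcup//=.
- by move=> k; exact: (measurable_exp_preimage (mF k)).
- by apply/measurable_EFinP; apply: measurable_funTS; exact: measurable_expR.
- apply/trivIsetP => i j _ _ ij; rewrite -preimage_setI.
  by move/trivIsetP : tF => ->//; rewrite preimage_set0.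
Qed.

HB.instance Definition _ := isMeasure.Build _ _ _
  exp_image exp_image0 exp_image_ge0 exp_image_sigma_additive.

Lemma exp_image_itvoc (b : R) : (0 < b)%R -> exp_image `]0%R, b] = b%:E.
Proof.
move=> b0; have := integral_expRM_leNy (ln b) (@ltr01 R).
under eq_integral do rewrite mul1r.
rewrite divr1 mul1r lnK// => <-; rewrite /exp_image; congr (integral _ _ _).
apply/seteqP; split => x /=; rewrite !in_itv/= expR_gt0/=.
  by move=> xb; rewrite -ler_expR lnK.
by move=> xb; rewrite -[leRHS]lnK// ler_expR.
Qed.

(** Lebesgue measure on the positive half-line is the image under the exponential
    of the measure with density [expR]: by uniqueness of Lebesgue measure it
    suffices to compare on half-open intervals, split at 0. *)
Lemma lebesgue_measure_exp_image (A : set R) : measurable A ->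
  leb A = exp_image A + leb (A `&` `]-oo, 0%R]).
Proof.
have mN : measurable (`]-oo, 0%R]%classic : set R) by [].
pose m1 : {measure set (measurableTypeR R) -> \bar R} := exp_image.
pose m2 : {measure set (measurableTypeR R) -> \bar R} := mrestr leb mN.
pose m12 X := exp_image X + leb (X `&` `]-oo, 0%R]).
have m12E X : measure_add m1 m2 X = m12 X by exact: measure_addE.
move=> mA; rewrite -/(m12 A) -m12E; apply: lebesgue_measure_unique => //.
move=> _ [[a b]] _ <-; rewrite [RHS](m12E _) /m12/=.
have [ab|ba] := ltP a b; last first.
  by rewrite set_itv_ge ?bnd_simp -?leNgt// set0I !measure0 adde0.
have [a0|a0] := leP 0%R a.
  have b0 : (0 < b)%R by exact: le_lt_trans ab.
  rewrite (_ : `]a, b] `&` `]-oo, 0%R] = set0); last first.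
    apply/seteqP; split => // x /=; rewrite !in_itv/= => -[/andP[ax _] x0].
    by move: (lt_le_trans ax x0); rewrite ltNge a0.
  rewrite measure0 adde0; move: a0; rewrite le_eqVlt => /predU1P[<-|a0].
    rewrite exp_image_itvoc// lebesgue_measure_itv/= lte_fin b0.
    by rewrite -EFinB subr0.
  have : exp_image `]0%R, b] = exp_image `]0%R, a] + exp_image `]a, b].
    rewrite (_ : `]0%R, b]%classic = `]0%R, a] `|` `]a, b]); last first.
      by apply: itv_bndbnd_setU; rewrite bnd_simp ltW.
    apply: measureU => //; apply/seteqP; split => // x /=; rewrite !in_itv/=.
    by move=> [/andP[_ xa] /andP[ax _]]; move: (lt_le_trans ax xa); rewrite ltxx.
  rewrite !exp_image_itvoc// => H.
  rewrite lebesgue_measure_itv/= lte_fin ab H addeC addeA.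
  by rewrite -EFinD addNr add0e.
have [b0|b0] := leP b 0%R.
  rewrite (_ : `]a, b] `&` `]-oo, 0%R] = `]a, b]%classic); last first.
    apply/seteqP; split => x /=; rewrite !in_itv/=; first by case.
    by move=> /andP[-> xb]; split => //; exact: le_trans b0.
  rewrite (_ : exp_image `]a, b] = 0) ?add0e//.
  rewrite /exp_image (_ : _ @^-1` _ = set0) ?integral_set0//.
  apply/seteqP; split => // x /=; rewrite in_itv/= => /andP[_ xb].
  by have := le_trans xb b0; rewrite leNgt expR_gt0.
rewrite (_ : `]a, b] `&` `]-oo, 0%R] = `]a, 0%R]%classic); last first.
  apply/seteqP; split => x /=; rewrite !in_itv/=; first by move=> [/andP[->]].
  by move=> /andP[-> x0]; split => //; exact: le_trans (ltW b0).
rewrite (_ : exp_image `]a, b] = exp_image `]0%R, b]); last first.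
  rewrite /exp_image; congr (integral _ _ _).
  apply/seteqP; split => x /=; rewrite !in_itv/= expR_gt0/=; first by case/andP.
  by move=> ->; rewrite andbT (lt_trans a0)// expR_gt0.
rewrite exp_image_itvoc// !lebesgue_measure_itv/= !lte_fin ab a0.
by rewrite -!EFinB -EFinD; congr (_%:E); ring.
Qed.

Lemma ge0_integral_expR (f : R -> \bar R) :
  measurable_fun setT f -> (forall x, 0 <= f x) ->
  \int[leb]_(x in `]0%R, +oo[) f x = \int[leb]_s (f (expR s) * (expR s)%:E).
Proof.
move=> mf f0.
transitivity (\int[exp_image]_(x in `]0%R, +oo[) f x).
  apply: eq_measure_integral => A mA A0.
  transitivity (exp_image A + leb (A `&` `]-oo, 0%R])).
    exact: lebesgue_measure_exp_image.
  rewrite [X in leb X](_ : _ = set0) ?measure0 ?adde0//.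
  apply/seteqP; split => // x /= [/A0/=]; rewrite !in_itv/= andbT => x0.
  by rewrite leNgt x0.
rewrite integral_mkcond (@ge0_integral_image_density _ _ _ _ _ leb exp_image expR expR)//.
- apply: eq_integral => s _; rewrite patchE mem_set//=.
  by rewrite in_itv/= expR_gt0.
- exact: measurable_patch.
- by move=> y; apply: erestrict_ge0.
Qed.

End exp_substitution.

Section bessel_measure_substitution.
Context {R : realType}.
Notation leb := (@lebesgue_measure R).
Local Open Scope ereal_scope.
Implicit Types (f : R -> \bar R) (alpha : R).

Lemma measurable_ln_preimage (A : set R) :
  measurable A -> measurable (@ln R @^-1` A : set R).
Proof. by move=> mA; rewrite -(setTI (_ @^-1` _)); exact: measurable_ln. Qed.

Lemma mu_bessel_expR alpha (A : set R) : measurable A ->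
  mu_bessel alpha A = \int[leb]_(s in expR @^-1` A) (expR ((2 * alpha + 2) * s))%:E.
Proof.
move=> mA; rewrite /mu_bessel setIC integral_mkcondr ge0_integral_expR; last 2 first.
- apply: measurable_patch_EFin => //; exact: measurable_powR.
- by move=> x; apply: erestrict_ge0 => y _; rewrite lee_fin powR_ge0.
rewrite [RHS]integral_mkcond; apply: eq_integral => s _; rewrite !patchE.
have [sA|sA] := pselect (A (expR s)); last by rewrite !memNset// mul0e.
rewrite !mem_set// -EFinM -expRM -expRD; congr (expR _)%:E; ring.
Qed.

Lemma ge0_integral_mu_bessel alpha f : measurable_fun (`]0%R, +oo[ : set R) f ->
  (forall y, (0 < y)%R -> 0 <= f y) ->
  \int[mu_bessel alpha]_(y in `]0%R, +oo[) f y =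
  \int[leb]_s (f (expR s) * (expR ((2 * alpha + 2) * s))%:E).
Proof.
move=> mf f0; rewrite integral_mkcond.
rewrite (@ge0_integral_image_density _ _ _ _ _ leb (mu_bessel alpha) expR
  (fun s => expR ((2 * alpha + 2) * s)))//.
- by apply: eq_integral => s _; rewrite patchE mem_set//= in_itv/= expR_gt0.
- exact: measurable_expRM.
- by move=> A mA; exact: mu_bessel_expR.
- have mD : measurable (`]0%R, +oo[%classic : set R) by [].
  by apply/(measurable_restrictT _ mD).
- move=> y; apply: erestrict_ge0 => {}y /=; rewrite in_itv/= andbT; exact: f0.
Qed.

Lemma ge0_integral_eq0_pos (w : R -> R) (A : set R) : measurable A ->
  measurable_fun setT w -> (forall s, (0 < w s)%R) ->
  \int[leb]_(s in A) (w s)%:E = 0 <-> leb A = 0.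
Proof.
move=> mA mw w0.
have mwA : measurable_fun A (EFin \o w).
  by apply/measurable_EFinP; exact: measurable_funTS.
have wE : \int[leb]_(s in A) `|(w s)%:E| = \int[leb]_(s in A) (w s)%:E.
  by apply: eq_integral => s _; rewrite /= ger0_norm// ltW.
split => [A0|A0]; rewrite -?wE.
  have /(ae_eq_integral_abs leb mA mwA) := etrans wE A0.
  move=> [N [mN N0 AN]]; apply/eqP; rewrite eq_le measure_ge0 andbT -N0.
  apply: le_measure; rewrite ?inE// => s As; apply: AN => /=.
  by move=> /(_ As) [] /eqP; rewrite gt_eqF.
exact: integral_abs_eq0.
Qed.

(** The half-line ]-oo, 0] is a null set for [mu_bessel], and on its complement
    the density is positive, so null sets correspond under the logarithm. *)
Lemma ae_mu_bessel_expR alpha (P : R -> Prop) :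
  {ae mu_bessel alpha, forall x, P x} <-> {ae leb, forall s, P (expR s)}.
Proof.
have mE : measurable_fun setT (fun s : R => expR ((2 * alpha + 2) * s)).
  exact: measurable_expRM.
split => [[N [mN N0 PN]]|[M [mM M0 PM]]].
  exists (expR @^-1` N); split => //; first exact: measurable_exp_preimage.
    apply/(ge0_integral_eq0_pos _ mE (fun s => expR_gt0 _)) => //; first exact: measurable_exp_preimage.
    by rewrite -mu_bessel_expR.
  by move=> s /= Ps; exact: PN.
pose N := `]-oo, 0%R] `|` (`]0%R, +oo[ `&` @ln R @^-1` M).
have mN : measurable (N : set R).
  by apply: measurableU => //; apply: measurableI => //; exact: measurable_ln_preimage.
exists N; split => //.
- transitivity (\int[leb]_(s in expR @^-1` N) (expR ((2 * alpha + 2) * s))%:E).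
    exact: mu_bessel_expR.
  rewrite (_ : _ @^-1` _ = M); first by apply/(ge0_integral_eq0_pos _ mE (fun s => expR_gt0 _)).
  apply/seteqP; split => s; rewrite /N /= !in_itv/= expR_gt0 expRK.
    by case=> [|[]//]; rewrite leNgt expR_gt0.
  by move=> Ms; right; split.
- move=> x /= Px; rewrite /N /= !in_itv/= andbT.
  have [x0|x0] := leP x 0%R; [by left|right; split => //].
  by apply: PM => /=; rewrite lnK.
Qed.

Lemma lebesgue_measure_expR (A : set R) : measurable A ->
  leb (A `&` `]0%R, +oo[) = \int[leb]_(s in expR @^-1` A) (expR s)%:E.
Proof.
move=> mA; rewrite -[LHS]mul1e -integral_cst; last exact: measurableI.
rewrite setIC integral_mkcondr ge0_integral_expR; last 2 first.
- by apply: measurable_patch.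
- by move=> x; apply: erestrict_ge0.
rewrite [RHS]integral_mkcond; apply: eq_integral => s _; rewrite !patchE.
have [sA|sA] := pselect (A (expR s)); last by rewrite !memNset// mul0e.
by rewrite !mem_set// mul1e.
Qed.

Lemma ae_lebesgue_expR (P : R -> Prop) :
  {ae leb, forall x, (0 < x)%R -> P x} <-> {ae leb, forall s, P (expR s)}.
Proof.
have mE : measurable_fun setT (@expR R) by exact: measurable_expR.
split => [[N [mN N0 PN]]|[M [mM M0 PM]]].
  exists (expR @^-1` N); split => //; first exact: measurable_exp_preimage.
    apply/(ge0_integral_eq0_pos _ mE (fun s => expR_gt0 _)) => //; first exact: measurable_exp_preimage.
    rewrite -lebesgue_measure_expR//; apply/eqP; rewrite eq_le measure_ge0 andbT.
    by rewrite -N0 le_measure ?inE//; exact: measurableI.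
  by move=> s /= Ps; apply: PN => /= /(_ (expR_gt0 _)).
pose N := (`]0%R, +oo[ `&` @ln R @^-1` M) : set R.
have mN : measurable (N : set R) by apply: measurableI => //; exact: measurable_ln_preimage.
exists N; split => //.
- rewrite -(_ : N `&` `]0%R, +oo[ = N); last first.
    by rewrite /N setIAC setIid.
  rewrite [LHS]lebesgue_measure_expR// (_ : _ @^-1` _ = M).
    by apply/(ge0_integral_eq0_pos _ mE (fun s => expR_gt0 _)).
  apply/seteqP; split => s; rewrite /N /= !in_itv/= expR_gt0 expRK; first by case.
  by move=> Ms; split.
- move=> x /= Px; rewrite /N /= !in_itv/= andbT.
  have [x0|x0] := leP x 0%R.
    by exfalso; apply: Px; rewrite ltNge x0.
  by split => //; apply: PM => /=; rewrite lnK// => Px'; exact: Px.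
Qed.

End bessel_measure_substitution.

(** * The Gamma function *)

Section gamma.
Context {R : realType}.
Notation leb := (@lebesgue_measure R).
Local Open Scope ereal_scope.
Implicit Types (e s u v : R).

Lemma measurable_le_pair : measurable [set z : R * R | (z.1 <= z.2)%R].
Proof.
have H : measurable_fun setT (fun z : R * R => (z.1 <= z.2)%R).
  by apply: measurable_fun_ler.
by have := H measurableT [set true] I; rewrite setTI.
Qed.

Lemma lebesgue_tonelli (F : R * R -> \bar R) :
  measurable_fun setT F -> (forall z, 0 <= F z) ->
  \int[leb]_x \int[leb]_y F (x, y) = \int[leb]_y \int[leb]_x F (x, y).
Proof. by move=> mF F0; exact: (@fubini_tonelli _ _ _ _ _ leb leb F). Qed.

Lemma measurable_lebesgue_integral (F : R * R -> \bar R) :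
  measurable_fun setT F -> (forall z, 0 <= F z) ->
  measurable_fun setT (fun x => \int[leb]_y F (x, y)).
Proof.
move=> mF F0; exact: (@measurable_fun_fubini_tonelli_F _ _ _ _ _ leb F mF F0).
Qed.

(** The integrand of Gamma at s after the substitution exp u. *)
Definition gamma_integrand s u : R := expR (s * u - expR u).

Lemma measurable_gamma_integrand s : measurable_fun setT (gamma_integrand s).
Proof.
apply: measurableT_comp => //; exact: measurable_funB.
Qed.

Lemma integral_gamma_ln s :
  \int[leb]_(t in `]0%R, +oo[) (t `^ (s - 1) * expR (- t))%:E =
  \int[leb]_u (gamma_integrand s u)%:E.
Proof.
have mE : measurable_fun setT (fun t : R => expR (- t)) by exact: measurableT_comp.
rewrite ge0_integral_expR; last 2 first.
- apply/measurable_EFinP; apply: measurable_funM => //; exact: measurable_powR.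
- by move=> t; rewrite lee_fin mulr_ge0 ?powR_ge0 ?expR_ge0.
apply: eq_integral => u _; rewrite -EFinM -expRM -!expRD; congr (expR _)%:E; ring.
Qed.

Lemma measurable_expRNabs e : measurable_fun setT (fun u : R => expR (- (e * `|u|))).
Proof.
apply: measurableT_comp => //; apply: measurableT_comp => //.
by apply: measurable_funM => //; exact: measurableT_comp.
Qed.

Lemma integral_expRNabs e : (0 < e)%R ->
  \int[leb]_u (expR (- (e * `|u|)))%:E = (2 / e)%:E.
Proof.
move=> e0; have mE := @measurable_expRNabs e.
have mEE (D : set R) : measurable_fun D (fun u : R => (expR (- (e * `|u|)))%:E).
  by apply/measurable_EFinP; exact: measurable_funTS.
rewrite -(itv_setU_setT true (0%R : R)) ge0_integral_setU//; last 2 first.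
- exact: mEE.
- apply/disj_setPS => x /=; rewrite !in_itv/= andbT => -[x0].
  by rewrite leNgt x0.
rewrite integral_itv_bndo_bndc//.
transitivity (\int[leb]_(x in `]-oo, 0%R]) (expR (e * x))%:E +
              \int[leb]_(x in `[0%R, +oo[) (expR (- (e * x)))%:E).
  congr (_ + _); apply: eq_integral => x /[!inE]/= /[!in_itv]/=.
    by move=> x0; rewrite ler0_norm// mulrN opprK.
  by move=> /[!andbT] x0; rewrite ger0_norm.
rewrite integral_expRM_leNy// integral_expRM_gey// mulr0 oppr0 expR0.
by rewrite -EFinD; congr (_%:E); field; rewrite gt_eqF.
Qed.

(** The double exponential beats the factor exp (s u) on the right, which leaves a
    bound that is integrable over the whole line. *)
Lemma gamma_integrand_le s u : (0 < s)%R ->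
  (gamma_integrand s u <= expR (4 * s ^+ 2) * expR (- (s * `|u|)))%R.
Proof.
move=> s0; rewrite -expRD ler_expR; have [u0|u0] := leP u 0%R.
  have := expR_gt0 u; have := sqr_ge0 s; rewrite ler0_norm//; lra.
rewrite gtr0_norm//.
have H : (u ^+ 2 / 4 <= expR u)%R.
  have -> : u = (u / 2 + u / 2)%R by field.
  rewrite expRD; have := expR_ge1Dx (u / 2)%R => h; nra.
have := sqr_ge0 (u / 2 - 2 * s)%R; nra.
Qed.

Lemma integral_gamma_lty s : (0 < s)%R ->
  \int[leb]_u (gamma_integrand s u)%:E < +oo.
Proof.
move=> s0.
apply: (@le_lt_trans _ _ (\int[leb]_u ((expR (4 * s ^+ 2))%:E * (expR (- (s * `|u|)))%:E))).
  apply: ge0_le_integral => //.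
  - by move=> u _; rewrite lee_fin expR_ge0.
  - by apply/measurable_EFinP; exact: measurable_gamma_integrand.
  - by apply/measurable_EFinP; apply: measurable_funM => //; exact: measurable_expRNabs.
  - by move=> u _; rewrite -EFinM lee_fin gamma_integrand_le.
rewrite ge0_integralZl//.
- by rewrite integral_expRNabs// -EFinM ltry.
- by apply/measurable_EFinP; exact: measurable_expRNabs.
Qed.

Lemma EFin_Gamma_fun s : (0 < s)%R ->
  (Gamma_fun s)%:E = \int[leb]_u (gamma_integrand s u)%:E.
Proof.
move=> s0; rewrite /Gamma_fun /Rintegral integral_gamma_ln fineK//.
rewrite ge0_fin_numE ?integral_gamma_lty//.
by apply: integral_ge0 => u _; rewrite lee_fin expR_ge0.
Qed.

Lemma Gamma_fun_gt0 s : (0 < s)%R -> (0 < Gamma_fun s)%R.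
Proof.
move=> s0; rewrite lt0r -lee_fin -eqe EFin_Gamma_fun//; apply/andP; split.
  apply/eqP; rewrite (ge0_integral_eq0_pos measurableT) //; last 2 first.
  - exact: measurable_gamma_integrand.
  - by move=> u; exact: expR_gt0.
  by rewrite -set_itvNyy lebesgue_measure_itv.
by apply: integral_ge0 => u _; rewrite lee_fin expR_ge0.
Qed.

(** Instead of integrating by parts, write exp (- exp u) as the integral of
    exp (v - exp v) over v >= u and exchange the two integrals. *)
Lemma Gamma_funS s : (0 < s)%R -> Gamma_fun (s + 1) = (s * Gamma_fun s)%R.
Proof.
move=> s0; apply: EFin_inj; rewrite EFinM !EFin_Gamma_fun ?addr_gt0//.
have mE (f g : R -> R) : measurable_fun setT f -> measurable_fun setT g ->
  measurable_fun setT (fun z : R * R => (f z.1 * g z.2)%R).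
  by move=> mf mg; apply: measurable_funM; exact: measurableT_comp.
pose h (v : R) : R := expR (v - expR v).
have mh : measurable_fun setT h.
  by apply: measurableT_comp => //; exact: measurable_funB.
have tailE u : \int[leb]_(v in `[u, +oo[) (h v)%:E = (expR (- expR u))%:E.
  have := integral_expRM_gey (expR u) (@ltr01 R).
  rewrite mul1r divr1 => <-.
  transitivity (\int[leb]_(x in `]0%R, +oo[) (((fun x => (expR (- (1 * x)))%:E) \_ `[expR u, +oo[) x)).
    rewrite ge0_integral_expR; last 2 first.
    - apply: measurable_patch_EFin => //.
      by apply: measurableT_comp => //; apply: measurableT_comp.
    - by move=> x; apply: erestrict_ge0 => y _; rewrite lee_fin expR_ge0.
    rewrite integral_mkcond; apply: eq_integral => v _; rewrite !patchE.
    have -> : (expR v \in `[expR u, +oo[%classic) = (v \in `[u, +oo[%classic).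
      by apply/idP/idP; rewrite !inE/= !in_itv/= !andbT ler_expR.
    case: ifPn => _; last by rewrite mul0e.
    by rewrite -EFinM -expRD mul1r addrC.
  rewrite -integral_mkcondr; congr (integral _ _ _).
  rewrite setIidr// => x /=; rewrite !in_itv/= !andbT; apply: lt_le_trans.
  exact: expR_gt0.
pose A := [set z : R * R | (z.1 <= z.2)%R].
(* integrating in the first variable gives the left-hand side, in the second the
   right-hand side *)
pose F (z : R * R) : \bar R := (s * expR (s * z.1) * h z.2 * \1_A z)%:E.
have mF : measurable_fun setT F.
  apply/measurable_EFinP; apply: measurable_funM; last first.
    by apply: measurable_indic; exact: measurable_le_pair.
  apply: (mE (fun u => s * expR (s * u))%R) => //.
  by apply: measurable_funM => //; exact: measurable_expRM.
have F0 z : 0 <= F z.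
  by rewrite lee_fin !mulr_ge0 ?expR_ge0// ltW.
transitivity (\int[leb]_v \int[leb]_u F (u, v)).
  apply: eq_integral => v _.
  transitivity (\int[leb]_u ((s * h v)%:E * ((EFin \o (fun u => expR (s * u))) \_ `]-oo, v]) u)).
    rewrite ge0_integralZl//; last 3 first.
    - by apply: measurable_patch_EFin => //; exact: measurable_expRM.
    - by move=> u _; apply: erestrict_ge0 => ? _; rewrite lee_fin expR_ge0.
    - by rewrite lee_fin mulr_ge0 ?expR_ge0// ltW.
    rewrite -integral_mkcond integral_expRM_leNy// -EFinM; congr EFin.
    transitivity (h v * expR (s * v))%R; last by field; rewrite gt_eqF.
    by rewrite -expRD; congr expR; ring.
  apply: eq_integral => u _; rewrite /F indicE /= patchE.
  have -> : ((u, v) \in A) = (u \in `]-oo, v]%classic).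
    by apply/idP/idP => /set_mem H; apply/mem_set; move: H; rewrite /= in_itv.
  case: ifPn => _; last by rewrite mulr0 mule0.
  by rewrite mulr1 -EFinM mulrAC.
rewrite -lebesgue_tonelli// -ge0_integralZl//; last 3 first.
- by apply/measurable_EFinP; exact: measurable_gamma_integrand.
- by move=> u _; rewrite lee_fin expR_ge0.
- by rewrite lee_fin ltW.
apply: eq_integral => u _.
transitivity (\int[leb]_v ((s * expR (s * u))%:E * ((EFin \o h) \_ `[u, +oo[) v)).
  apply: eq_integral => v _; rewrite /F indicE /= patchE.
  have -> : ((u, v) \in A) = (v \in `[u, +oo[%classic).
    by apply/idP/idP => /set_mem H; apply/mem_set; move: H; rewrite /= in_itv/= andbT.
  by case: ifPn => _; rewrite ?mulr1// mulr0 mule0.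
rewrite ge0_integralZl//; last 3 first.
- by apply: measurable_patch_EFin.
- by move=> v _; apply: erestrict_ge0 => ? _; rewrite lee_fin expR_ge0.
- by rewrite lee_fin mulr_ge0 ?expR_ge0// ltW.
rewrite -integral_mkcond tailE -!EFinM -mulrA -expRD.
by [].
Qed.

End gamma.

(** * Weighted means and quotients of rising factorials *)

Section weighted_means.
Context {R : realType}.
Implicit Types (x y z a b c e : R).

(** The graph of the logarithm lies below its tangent at e. *)
Lemma powR_le_tangent e x a : 0 < e -> 0 <= x -> 0 <= a ->
  x `^ a <= e `^ a * expR (a * (x / e - 1)).
Proof.
move=> e0 x0 a0.
rewrite -{1}(divfK (lt0r_neq0 e0) x) powRM ?divr_ge0 ?(ltW e0)// mulrC.
rewrite ler_wpM2l ?powR_ge0// [a * _]mulrC expRM ge0_ler_powR ?nnegrE ?divr_ge0 ?(ltW e0) ?expR_ge0//.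
by have := expR_ge1Dx (x / e - 1); rewrite addrC subrK.
Qed.

(** The weighted inequality between arithmetic and geometric means: take the
    tangents of the logarithm at (a perturbation of) the arithmetic mean, where
    their contributions cancel.  The perturbation avoids a zero mean. *)
Lemma powR_mean3_le x y z a b c : 0 <= x -> 0 <= y -> 0 <= z ->
  0 <= a -> 0 <= b -> 0 <= c -> a + b + c = 1 ->
  x `^ a * y `^ b * z `^ c <= a * x + b * y + c * z.
Proof.
move=> x0 y0 z0 a0 b0 c0 abc; apply/ler_addgt0Pr => r r0.
set M := _ + c * z; have M0 : 0 <= M by rewrite !addr_ge0// mulr_ge0.
have e0 : 0 < M + r by rewrite ltr_wpDl.
have := powR_le_tangent e0 x0 a0; have := powR_le_tangent e0 y0 b0.
have := powR_le_tangent e0 z0 c0 => hz hy hx.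
apply: (@le_trans _ _ ((M + r) `^ a * expR (a * (x / (M + r) - 1)) *
  ((M + r) `^ b * expR (b * (y / (M + r) - 1))) *
  ((M + r) `^ c * expR (c * (z / (M + r) - 1))))).
  by rewrite !ler_pM ?mulr_ge0 ?powR_ge0.
have -> : forall p1 p2 p3 q1 q2 q3 : R,
    p1 * q1 * (p2 * q2) * (p3 * q3) = (p1 * p2 * p3) * (q1 * q2 * q3).
  by move=> *; ring.
rewrite -!powRD ?(gt_eqF e0) ?implybT// abc powRr1 ?(ltW e0)// -!expRD.
rewrite -[leRHS]mulr1 ler_wpM2l ?(ltW e0)// -[leRHS](@expR0 R) ler_expR.
have -> : a * (x / (M + r) - 1) + b * (y / (M + r) - 1) + c * (z / (M + r) - 1) =
  M / (M + r) - (a + b + c) by rewrite /M; field; rewrite gt_eqF.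
by rewrite abc subr_le0 ler_pdivrMr// mul1r lerDl ltW.
Qed.

Lemma powR_mean2_le x y a b : 0 <= x -> 0 <= y ->
  0 <= a -> 0 <= b -> a + b = 1 -> x `^ a * y `^ b <= a * x + b * y.
Proof.
move=> x0 y0 a0 b0 ab.
have := @powR_mean3_le x y 0 a b 0 x0 y0 (lexx 0) a0 b0 (lexx 0).
by rewrite powRr0 mulr1 mulr0 !addr0; exact.
Qed.

Lemma powR_onem_le z a : 0 <= z <= 1 -> 0 <= a <= 1 ->
  (1 - z) `^ a <= 1 - a * z.
Proof.
move=> /andP[z0 z1] /andP[a0 a1].
have := @powR_mean2_le (1 - z) 1 a (1 - a).
rewrite powR1 !mulr1 !subr_ge0 => /(_ z1 ler01 a0 a1) h.
by apply: le_trans (h _) _; [ring|rewrite le_eqVlt; apply/orP; left; apply/eqP; ring].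
Qed.

End weighted_means.

Section rising_ratio.
Context {R : realType}.
Implicit Types (a b : R).

Lemma ln_succ_bounds (x : R) : 0 < x ->
  (x + 1)^-1 <= ln (x + 1) - ln x <= x^-1.
Proof.
move=> x0; have x10 : 0 < x + 1 by rewrite addr_gt0.
apply/andP; split.
  have h : -1 < - (x + 1)^-1.
    by rewrite ltrN2 invf_lt1// ltrDr.
  have := le_ln1Dx h.
  have -> : 1 - (x + 1)^-1 = x / (x + 1) by field; rewrite gt_eqF.
  by rewrite ln_div ?posrE//; lra.
have h : -1 < x^-1 by rewrite (@lt_le_trans _ _ 0)// ?ltrN10// invr_ge0 ltW.
have := le_ln1Dx h.
have -> : 1 + x^-1 = (x + 1) / x by field; rewrite gt_eqF.
by rewrite ln_div ?posrE.
Qed.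

Definition shifted_harmonic b k : R := \sum_(j < k) (j%:R + b)^-1.

(** The difference telescopes, each increment being O (1 / k^2).  The induction
    carries the factor 1 - 1 / (k + 1), whose increments are 1 / ((k+1) (k+2)). *)
Lemma shifted_harmonic_ln b : 0 < b ->
  exists M, forall k, `|shifted_harmonic b k - ln (k.+1%:R)| <= M.
Proof.
(* the increments of the two differences 1/(n+b) - 1/(n+1) and
   1/(n+1) - ln ((n+2)/(n+1)) are bounded by the summands of C *)
move=> b0; pose C := 1 + `|b - 1| * (1 + 2 / b).
have C0 : 0 <= C.
  by rewrite addr_ge0// mulr_ge0// addr_ge0// divr_ge0// ltW.
exists C => k; suff : `|shifted_harmonic b k - ln (k.+1%:R)| <= C * (1 - k.+1%:R^-1).
  move=> /le_trans; apply; by rewrite -[leRHS]mulr1 ler_wpM2l// lerBlDr lerDl invr_ge0.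
elim: k => [|k ih].
  by rewrite /shifted_harmonic big_ord0 ln1 subr0 normr0 invr1 subrr mulr0.
rewrite /shifted_harmonic big_ord_recr/= -/(shifted_harmonic b k).
set S := shifted_harmonic b k in ih *.
pose n : R := k%:R.
have n0 : 0 <= n by rewrite /n.
have n1 : 0 < n + 1 by rewrite ltr_wpDl.
have n2 : 0 < n + 1 + 1 by rewrite addr_gt0.
have nb : 0 < n + b by rewrite ltr_wpDl.
have k1 : k.+1%:R = n + 1 :> R by rewrite -natr1.
have k2 : k.+2%:R = n + 1 + 1 :> R by rewrite -natr1 k1.
rewrite k2 -/n; rewrite k1 in ih.
have /andP[l1 l2] := ln_succ_bounds n1.
have -> : S + (n + b)^-1 - ln (n + 1 + 1) =
  (S - ln (n + 1)) + ((n + b)^-1 - (n + 1)^-1) +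
  ((n + 1)^-1 - (ln (n + 1 + 1) - ln (n + 1))) by ring.
apply: le_trans (ler_normD _ _) _.
apply: le_trans (lerD (ler_normD _ _) (lexx _)) _.
have h1 : `|(n + b)^-1 - (n + 1)^-1| <=
    `|b - 1| * (1 + 2 / b) * ((n + 1)^-1 - (n + 1 + 1)^-1).
  have -> : (n + b)^-1 - (n + 1)^-1 = (1 - b) * ((n + b) * (n + 1))^-1.
    by field; rewrite !gt_eqF.
  rewrite normrM distrC -mulrA ler_wpM2l// ger0_norm; last first.
    by rewrite invr_ge0 mulr_ge0// ltW.
  have -> : (n + 1)^-1 - (n + 1 + 1)^-1 = ((n + 1) * (n + 1 + 1))^-1.
    by field; rewrite !gt_eqF.
  rewrite !invfM [in leRHS]mulrCA [leLHS]mulrC ler_wpM2l ?invr_ge0 ?(ltW n1)//.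
  rewrite ler_pdivlMr// mulrC ler_pdivrMr//.
  rewrite -subr_ge0.
  have -> : (1 + 2 / b) * (n + b) - (n + 1 + 1) = b + 2 * n / b.
    by field; rewrite gt_eqF.
  by rewrite addr_ge0 ?(ltW b0)// divr_ge0 ?(ltW b0)// mulr_ge0.
have h2 : `|(n + 1)^-1 - (ln (n + 1 + 1) - ln (n + 1))| <= (n + 1)^-1 - (n + 1 + 1)^-1.
  by rewrite ger0_norm; lra.
apply: le_trans (lerD (lerD ih h1) h2) _.
by rewrite le_eqVlt; apply/orP; left; apply/eqP; rewrite /C; ring.
Qed.

(** The quotient of the rising factorials of a and b, that is
    Gamma (k + a) Gamma b / (Gamma (k + b) Gamma a). *)
Definition rising_ratio a b k : R := \prod_(j < k) ((j%:R + a) / (j%:R + b)).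

Lemma rising_ratio_gt0 a b k : 0 < a -> 0 < b -> 0 < rising_ratio a b k.
Proof.
by move=> a0 b0; apply: prodr_gt0 => j _; rewrite divr_gt0// ltr_wpDl.
Qed.

Lemma rising_ratioV a b k : (rising_ratio a b k)^-1 = rising_ratio b a k.
Proof. by rewrite /rising_ratio -prodfV; apply: eq_bigr => j _; rewrite invf_div. Qed.

(** The logarithm of each factor is at most (a - b) / (j + b), and the sum of
    these is a logarithm up to a bounded error. *)
Lemma rising_ratio_le a b : 0 < a -> 0 < b ->
  exists2 C, 0 < C & forall k, rising_ratio a b k <= C * k.+1%:R `^ (a - b).
Proof.
move=> a0 b0; have [M hM] := shifted_harmonic_ln b0.
exists (expR (`|a - b| * M)); first exact: expR_gt0.
move=> k; rewrite /powR gt_eqF// -expRD.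
apply: (@le_trans _ _ (expR ((a - b) * shifted_harmonic b k))).
  rewrite /rising_ratio /shifted_harmonic mulr_sumr expR_sum.
  apply: ler_prod => j _; have jb : 0 < j%:R + b by rewrite ltr_wpDl.
  rewrite divr_ge0 ?(ltW jb) ?addr_ge0 ?(ltW a0)//=.
  have := expR_ge1Dx ((a - b) * (j%:R + b)^-1).
  by have -> : 1 + (a - b) * (j%:R + b)^-1 = (j%:R + a) / (j%:R + b)
    by field; rewrite gt_eqF.
rewrite ler_expR -lerBlDr -mulrBr; apply: le_trans (ler_norm _) _.
by rewrite normrM ler_wpM2l.
Qed.

(** Exchanging a and b inverts the ratio. *)
Lemma rising_ratio_ge a b : 0 < a -> 0 < b ->
  exists2 c, 0 < c & forall k, c * k.+1%:R `^ (a - b) <= rising_ratio a b k.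
Proof.
move=> a0 b0; have [C C0 hC] := rising_ratio_le b0 a0.
exists C^-1; first by rewrite invr_gt0.
move=> k; rewrite -rising_ratioV -(opprB b a) powRN -invfM lef_pV2 ?posrE//.
  by rewrite mulr_gt0// powR_gt0.
exact: rising_ratio_gt0.
Qed.

End rising_ratio.

(** * Power series with coefficients of power type *)

Section power_series_bounds.
Context {R : realType}.
Implicit Types (s x d : R).

(** The increment of a concave power is at least its derivative at the right end. *)
Lemma powR_increment_ge s x : 0 <= s < 1 -> 0 <= x ->
  (1 - s) * (x + 1) `^ (- s) <= (x + 1) `^ (1 - s) - x `^ (1 - s).
Proof.
move=> /andP[s0 s1] x0; have x1 : 0 < x + 1 by rewrite ltr_wpDl.
have {3}-> : x = (x + 1) * (1 - (x + 1)^-1) by field; rewrite gt_eqF.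
have z1 : 0 <= (x + 1)^-1 <= 1 by rewrite invr_ge0 (ltW x1) invf_le1// lerDr.
have z2 : 0 <= 1 - (x + 1)^-1 by rewrite subr_ge0; case/andP : z1.
rewrite powRM ?(ltW x1)//.
have h := @powR_onem_le _ _ (1 - s) z1.
have {}h : (1 - (x + 1)^-1) `^ (1 - s) <= 1 - (1 - s) * (x + 1)^-1.
  by apply: h; rewrite subr_ge0 (ltW s1) lerBlDr lerDl.
rewrite -lerBlDr opprK; apply: le_trans (lerD (lexx _) (ler_wpM2l (powR_ge0 _ _) h)) _.
rewrite (addrC 1) powRD ?(gt_eqF x1) ?implybT// powRr1 ?(ltW x1)//.
rewrite le_eqVlt; apply/orP; left; apply/eqP; field; exact: lt0r_neq0.
Qed.

(** Compare with the telescoping sum of the increments of x^(1 - s) / (1 - s). *)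
Lemma sum_powR_trunc_le s (L : R) n : 0 <= s < 1 -> 0 <= L ->
  \sum_(k < n | k.+1%:R <= L) k.+1%:R `^ (- s) <= L `^ (1 - s) / (1 - s).
Proof.
move=> /[dup] s01 /andP[s0 s1] L0; have s10 : 0 < 1 - s by rewrite subr_gt0.
suff h : \sum_(k < n | k.+1%:R <= L) k.+1%:R `^ (- s) <=
    (Num.min n%:R L) `^ (1 - s) / (1 - s).
  apply: le_trans h _; rewrite ler_wpM2r ?invr_ge0 ?(ltW s10)//.
  by rewrite ge0_ler_powR ?nnegrE ?(ltW s10) ?le_min ?L0 ?ler0n// ge_min lexx orbT.
elim: n => [|n ih].
  by rewrite big_ord0 divr_ge0 ?powR_ge0// ltW.
rewrite big_mkcond big_ord_recr/= -big_mkcond/=; case: ifPn => nL.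
  have nL' : n%:R <= L by rewrite (le_trans _ nL)// ler_nat.
  rewrite (min_idPl nL) in ih *; rewrite (min_idPl nL') in ih.
  apply: le_trans (lerD ih (lexx _)) _.
  rewrite -lerBrDl -mulrBl ler_pdivlMr// mulrC -natr1.
  exact: powR_increment_ge.
rewrite addr0; apply: le_trans ih _; rewrite ler_wpM2r ?invr_ge0 ?(ltW s10)//.
rewrite ge0_ler_powR ?nnegrE ?(ltW s10) ?le_min ?L0 ?ler0n//=.
by rewrite !ge_min ler_nat leqnSn/= lexx orbT.
Qed.

Lemma sum_geometric_le d n : 0 < d <= 1 -> \sum_(k < n) (1 - d) ^+ k <= d^-1.
Proof.
move=> /andP[d0 d1]; rewrite -[leRHS]mul1r ler_pdivlMr//.
have -> : (\sum_(k < n) (1 - d) ^+ k) * d = 1 - (1 - d) ^+ n.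
  elim: n => [|n ih]; first by rewrite big_ord0 mul0r expr0 subrr.
  by rewrite big_ord_recr/= mulrDl ih exprS; ring.
by rewrite lerBlDr lerDl exprn_ge0// subr_ge0.
Qed.

(** The terms with k + 1 <= 1 / d contribute as if the geometric factor were 1;
    for the others the power is at most d^s and the geometric series sums to
    1 / d. *)
Lemma sum_powR_geom_le s d n : 0 <= s < 1 -> 0 < d <= 1 ->
  \sum_(k < n) k.+1%:R `^ (- s) * (1 - d) ^+ k <= ((1 - s)^-1 + 1) * d `^ (s - 1).
Proof.
move=> /[dup] s01 /andP[s0 s1] /[dup] d01 /andP[d0 d1].
have d1' : 0 <= 1 - d by rewrite subr_ge0.
have e1 : (1 - d) <= 1 by rewrite lerBlDr lerDl ltW.
apply: (@le_trans _ _ (\sum_(k < n | k.+1%:R <= d^-1) k.+1%:R `^ (- s) +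
    d `^ s * \sum_(k < n) (1 - d) ^+ k)).
  rewrite [X in _ <= X + _]big_mkcond mulr_sumr -big_split/=; apply: ler_sum => k _.
  case: ifPn => kd.
    rewrite -[leLHS]addr0 lerD ?mulr_ge0 ?powR_ge0 ?exprn_ge0//.
    by rewrite -[leRHS]mulr1 ler_wpM2l ?powR_ge0// exprn_ile1.
  rewrite add0r ler_wpM2r ?exprn_ge0// powRN.
  have E : (d `^ s)^-1 = d^-1 `^ s.
    by rewrite -powRN -powR_inv1 ?(ltW d0)// -powRrM mulN1r.
  rewrite -[leRHS]invrK lef_pV2 ?posrE ?invr_gt0 ?powR_gt0// E.
  rewrite ge0_ler_powR ?nnegrE ?invr_ge0 ?(ltW d0)//.
  by move: kd; rewrite -ltNge => /ltW.
have -> : ((1 - s)^-1 + 1) * d `^ (s - 1) =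
  d^-1 `^ (1 - s) / (1 - s) + d `^ s * d^-1.
  rewrite -(powR_inv1 (ltW d0)) -powRrM mulN1r opprB mulrDl mul1r; congr (_ + _).
    by rewrite mulrC.
  by rewrite -powRD// (gt_eqF d0) implybT.
apply: lerD; first by rewrite sum_powR_trunc_le// invr_ge0 ltW.
by rewrite ler_wpM2l ?powR_ge0// sum_geometric_le.
Qed.

Lemma bernoulli_ge d n : 0 <= d <= 1 -> 1 - n%:R * d <= (1 - d) ^+ n.
Proof.
move=> /andP[d0 d1]; elim: n => [|n ih]; first by rewrite mul0r subr0 expr0.
rewrite exprS -natr1; apply: (@le_trans _ _ ((1 - d) * (1 - n%:R * d))).
  have h : 0 <= n%:R * d * d by rewrite !mulr_ge0.
  by lra.
by rewrite ler_wpM2l// subr_ge0.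
Qed.

(** The first 1 / (4 d) terms already suffice, since by Bernoulli the geometric
    factor is still at least 1/2 there. *)
Lemma sum_powR_geom_ge s d : 0 <= s < 1 -> 0 < d <= 1 ->
  exists n, (4 * d) `^ (s - 1) / 2 <=
    \sum_(k < n) k.+1%:R `^ (- s) * (1 - d) ^+ k.
Proof.
move=> /andP[s0 s1] /andP[d0 d1]; have [d4|d4] := leP (4 * d) 1; last first.
  exists 1%N; rewrite big_ord_recr big_ord0/= powR1 expr0 add0r mulr1.
  have : (4 * d) `^ (s - 1) <= 1.
    by rewrite -[leRHS](powRr0 (4 * d)) ler_powR ?(ltW d4)// subr_le0 ltW.
  by lra.
(* (m + 1) d <= 1/4 + d <= 1/2, so Bernoulli keeps the geometric factors above 1/2 *)
pose m := Num.trunc (4 * d)^-1; exists m.+1.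
have m0 : 0 <= (4 * d)^-1 by rewrite invr_ge0 mulr_ge0// ltW.
have /andP[m1 m2] := truncn_itv m0; rewrite -/m in m1 m2.
have md : m.+1%:R * d <= 2^-1.
  rewrite -natr1 mulrDl mul1r.
  have : m%:R * d <= (4 * d)^-1 * d by rewrite ler_wpM2r// ltW.
  have -> : (4 * d)^-1 * d = 4^-1 by field; rewrite gt_eqF.
  by lra.
apply: (@le_trans _ _ (\sum_(k < m.+1) m.+1%:R `^ (- s) * 2^-1)); last first.
  apply: ler_sum => k _; rewrite ler_pM ?powR_ge0//.
    rewrite !powRN lef_pV2 ?posrE ?powR_gt0// ge0_ler_powR ?nnegrE// ler_nat.
    exact: ltn_ord.
  have : 1 - m.+1%:R * d <= (1 - d) ^+ m.+1 by rewrite bernoulli_ge// (ltW d0).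
  have : (1 - d) ^+ m.+1 <= (1 - d) ^+ k.
    by rewrite ler_wiXn2l ?subr_ge0 ?lerBlDr ?lerDl ?(ltW d0)// ltnW.
  by lra.
rewrite sumr_const card_ord -[leRHS]mulr_natl mulrA ler_wpM2r//.
have d40 : 0 <= 4 * d by rewrite mulr_ge0// ltW.
have -> : m.+1%:R * m.+1%:R `^ (- s) = m.+1%:R `^ (1 - s) :> R.
  by rewrite -[X in X * _]powRr1// -powRD ?pnatr_eq0 ?implybT.
have -> : (4 * d) `^ (s - 1) = (4 * d)^-1 `^ (1 - s).
  by rewrite -(powR_inv1 d40) -powRrM; congr powR; ring.
by rewrite ge0_ler_powR ?nnegrE ?subr_ge0 ?(ltW s1)// ltW.
Qed.

(** For s = 1 the same truncation gives a harmonic sum, which is unbounded. *)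
Lemma sum_inv_geom_ge (M : R) :
  exists2 e, 0 < e & exists n, forall d, 0 <= d <= e ->
    M <= \sum_(k < n) k.+1%:R `^ (- 1) * (1 - d) ^+ k.
Proof.
have [C hC] := shifted_harmonic_ln (@ltr01 R).
pose L := expR (2 * `|M| + C); pose n := (Num.trunc L).+1.
have nL : L <= n%:R.
  by have /andP[_ /ltW] := truncn_itv (ltW (expR_gt0 (2 * `|M| + C))).
have n0 : (0 : R) < n%:R by rewrite ltr0n.
have hn : 2 * `|M| <= shifted_harmonic 1 n.
  have h : 2 * `|M| + C <= ln n.+1%:R.
    rewrite -[leLHS]expRK ler_ln ?posrE ?expR_gt0//.
    by rewrite (le_trans nL)// ler_nat.
  by have := hC n; rewrite ler_norml => /andP[] + _; lra.
exists (Num.min 1 (n%:R * 2)^-1).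
  by rewrite lt_min ltr01 invr_gt0 mulr_gt0.
exists n => d /andP[d0]; rewrite le_min => /andP[d1 dn].
have nd : n%:R * d <= 2^-1.
  apply: le_trans (ler_wpM2l (ltW n0) dn) _.
  by rewrite invfM mulrA divff ?gt_eqF// mul1r.
apply: (@le_trans _ _ (2^-1 * shifted_harmonic 1 n)).
  by have := ler_norm M; lra.
rewrite /shifted_harmonic mulr_sumr; apply: ler_sum => k _.
rewrite mulrC powR_inv1// natr1 ler_wpM2l ?invr_ge0//.
have : 1 - n%:R * d <= (1 - d) ^+ n by rewrite bernoulli_ge// d0.
have : (1 - d) ^+ n <= (1 - d) ^+ k.
  by rewrite ler_wiXn2l ?subr_ge0 ?lerBlDr ?lerDl// ltnW.
by lra.
Qed.

(** Compare with the telescoping sum of the decrements of x^(1 - s) / (s - 1). *)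
Lemma sum_powR_gt1_le s n : 1 < s ->
  \sum_(k < n) k.+1%:R `^ (- s) <= 1 + (s - 1)^-1.
Proof.
move=> s1; have s10 : 0 < s - 1 by rewrite subr_gt0.
have si : 0 <= (s - 1)^-1 by rewrite invr_ge0 ltW.
case: n => [|n]; first by rewrite big_ord0 addr_ge0.
suff : \sum_(k < n.+1) k.+1%:R `^ (- s) <=
    1 + (1 - n.+1%:R `^ (1 - s)) / (s - 1).
  move=> /le_trans; apply; rewrite lerD2l -[leRHS]mul1r.
  by rewrite ler_wpM2r// lerBlDr lerDl powR_ge0.
elim: n => [|n ih].
  by rewrite big_ord_recr big_ord0/= !powR1 subrr mul0r addr0 add0r.
rewrite big_ord_recr/=; apply: le_trans (lerD ih (lexx _)) _.
rewrite -addrA lerD2l -lerBrDl -mulrBl ler_pdivlMr//.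
set x : R := n.+1%:R; have x0 : 0 < x by rewrite /x ltr0n.
have -> : n.+2%:R = x + 1 by rewrite -natr1.
have x1 : 0 < x + 1 by rewrite addr_gt0.
have -> : 1 - (x + 1) `^ (1 - s) - (1 - x `^ (1 - s)) =
  x `^ (1 - s) - (x + 1) `^ (1 - s) by ring.
have h : (x + 1) `^ (1 - s) * (1 + (s - 1) / (x + 1)) <= x `^ (1 - s).
  have {3}-> : x = (x + 1) * (1 - (x + 1)^-1) by field; rewrite gt_eqF.
  have z0 : 0 < 1 - (x + 1)^-1 by rewrite subr_gt0 invf_lt1// ltrDr.
  rewrite powRM ?(ltW x1) ?(ltW z0)// ler_wpM2l ?powR_ge0//.
  apply: le_trans (expR_ge1Dx _) _.
  rewrite /powR gt_eqF// ler_expR.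
  have hl : ln (1 - (x + 1)^-1) <= - (x + 1)^-1.
    by apply: le_ln1Dx; rewrite ltrN2 invf_lt1// ltrDr.
  by have := ler_wpM2l (ltW s10) hl; lra.
have E : (x + 1) `^ (- s) = (x + 1) `^ (1 - s) / (x + 1).
  by rewrite -(powR_inv1 (ltW x1)) -powRD ?(gt_eqF x1) ?implybT//; congr powR; ring.
rewrite E; move: h; set P := (x + 1) `^ (1 - s); set Q := x `^ (1 - s); lra.
Qed.

End power_series_bounds.

(** * Hyperbolic functions *)

Section sech2.
Context {R : realType}.
Implicit Types (u : R).

(** Twice the hyperbolic cosine. *)
Definition cosh2 u : R := expR u + expR (- u).

(** The square of the hyperbolic secant, the variable of the power series that
    represents the kernel; it is 1 at the origin, the singularity of the kernel. *)
Definition sech2 u : R := (2 / cosh2 u) ^+ 2.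

Lemma cosh2_gt0 u : 0 < cosh2 u.
Proof. by rewrite addr_gt0 ?expR_gt0. Qed.

Lemma cosh2_abs u : cosh2 `|u| = cosh2 u.
Proof.
have [u0|u0] := leP 0 u; first by rewrite ger0_norm.
by rewrite ltr0_norm// /cosh2 opprK addrC.
Qed.

Lemma expR_le_cosh2 u : expR `|u| <= cosh2 u.
Proof. by rewrite -cosh2_abs lerDl expR_ge0. Qed.

Lemma cosh2_le u : cosh2 u <= 2 * expR `|u|.
Proof.
rewrite -cosh2_abs mulr_natl mulr2n lerD2l ler_expR.
by rewrite (@le_trans _ _ 0)// oppr_le0.
Qed.

Lemma sech2_ge0 u : 0 <= sech2 u. Proof. exact: sqr_ge0. Qed.

(** This is the square of the hyperbolic tangent. *)
Lemma onem_sech2E u : 1 - sech2 u = ((expR `|u| - expR (- `|u|)) / cosh2 u) ^+ 2.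
Proof.
rewrite /sech2 -cosh2_abs; set v := `|u|.
have h : expR v * expR (- v) = 1 by rewrite -expRD subrr expR0.
have /lt0r_neq0 := cosh2_gt0 v; rewrite /cosh2 => c0.
rewrite !expr_div_n -[X in X - _](divff (expf_neq0 2 c0)) -mulrBl; congr (_ / _).
rewrite sqrrD sqrrB h; ring.
Qed.

Lemma onem_sech2_ge0 u : 0 <= 1 - sech2 u.
Proof. by rewrite onem_sech2E sqr_ge0. Qed.

Lemma sech2_le1 u : sech2 u <= 1.
Proof. by rewrite -subr_ge0 onem_sech2_ge0. Qed.

Lemma onem_sech2_le u : 1 - sech2 u <= 4 * u ^+ 2.
Proof.
rewrite onem_sech2E -cosh2_abs -[in leRHS]real_normK ?num_real//.
set v := `|u|; have v0 : 0 <= v by rewrite /v.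
have -> : 4 * v ^+ 2 = (2 * v) ^+ 2 by ring.
have e1 : 1 <= expR v by rewrite -[leLHS](@expR0 R) ler_expR.
have h : expR (- v) = expR v * expR (- (2 * v)) by rewrite -expRD; congr expR; ring.
have h2 := expR_ge1Dx (- (2 * v)).
have h3 : 0 <= expR v - expR (- v).
  by rewrite subr_ge0 ler_expR (@le_trans _ _ 0)// oppr_le0.
rewrite lerXn2r ?nnegrE ?mulr_ge0 ?invr_ge0 ?(ltW (cosh2_gt0 _))//.
rewrite ler_pdivrMr ?cosh2_gt0// /cosh2.
have := expR_gt0 (- v); nra.
Qed.

(** The bound u / (1 + 2 u) for the hyperbolic tangent is linear near 0 and stays
    away from 0 at infinity. *)
Lemma onem_sech2_ge u : (`|u| / (1 + 2 * `|u|)) ^+ 2 <= 1 - sech2 u.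
Proof.
rewrite onem_sech2E -cosh2_abs; set v := `|u|; have v0 : 0 <= v by rewrite /v.
have h3 : 0 <= expR v - expR (- v).
  by rewrite subr_ge0 ler_expR (@le_trans _ _ 0)// oppr_le0.
have v1 : 0 < 1 + 2 * v by rewrite ltr_wpDr// mulr_ge0.
rewrite lerXn2r ?nnegrE ?divr_ge0 ?(ltW v1) ?(ltW (cosh2_gt0 _))//.
rewrite ler_pdivrMr// mulrAC ler_pdivlMr ?cosh2_gt0// /cosh2.
have := expR_ge1Dx (2 * v).
have -> : expR (2 * v) = expR v / expR (- v).
  by rewrite -expRN opprK -expRD; congr expR; ring.
by rewrite ler_pdivlMr ?expR_gt0//; have := expR_gt0 (- v); nra.
Qed.

Lemma onem_sech2_powR_le u t : 0 < t < 1 / 2 -> u != 0 ->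
  (1 - sech2 u) `^ (t - 1 / 2) <= 3 * (1 + `|u| `^ (2 * t - 1)).
Proof.
move=> /andP[t0 t1] u0; set v := `|u|; have v0 : 0 < v by rewrite normr_gt0.
have v1 : 0 < 1 + 2 * v by rewrite ltr_wpDr// mulr_ge0// ltW.
have w0 : 0 < v / (1 + 2 * v) by rewrite divr_gt0.
pose m := 1 - 2 * t; have m0 : 0 <= m by rewrite /m; lra.
have -> : t - 1 / 2 = - (m / 2) by rewrite /m; field.
have -> : 2 * t - 1 = - m by rewrite /m; ring.
apply: (@le_trans _ _ ((v / (1 + 2 * v)) `^ (- m))).
  have -> : - m = 2%:R * - (m / 2) by field.
  rewrite powRrM powR_mulrn ?(ltW w0)// !powRN.
  rewrite lef_pV2 ?posrE ?powR_gt0 ?exprn_gt0//; last first.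
    exact: lt_le_trans (exprn_gt0 2 w0) (onem_sech2_ge u).
  rewrite ge0_ler_powR ?nnegrE ?divr_ge0 ?sqr_ge0 ?onem_sech2_ge0//.
  exact: onem_sech2_ge.
have m1 : m <= 1 by rewrite /m; lra.
have E (x : R) : 0 < x -> x `^ (- m) = x^-1 `^ m.
  by move=> x0; rewrite -(powR_inv1 (ltW x0)) -powRrM mulN1r.
rewrite !E// invf_div.
have [v2|v2] := leP 1 v.
  apply: (@le_trans _ _ (3 `^ m)).
    rewrite ge0_ler_powR ?nnegrE ?divr_ge0 ?(ltW v0) ?(ltW v1)//.
    by rewrite ler_pdivrMr//; lra.
  apply: (@le_trans _ _ 3); last by have := powR_ge0 (v^-1) m; lra.
  by rewrite -[leRHS]powRr1// ler_powR// ler1n.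
apply: (@le_trans _ _ ((3 * v^-1) `^ m)).
  rewrite ge0_ler_powR ?nnegrE ?mulr_ge0 ?invr_ge0 ?(ltW v0) ?(ltW v1)//.
  by rewrite ler_pM2r ?invr_gt0//; lra.
rewrite powRM ?invr_ge0 ?(ltW v0)//.
have : 3 `^ m <= (3 : R) by rewrite -[leRHS]powRr1// ler_powR// ler1n.
by have := powR_ge0 v^-1 m; nra.
Qed.

Lemma measurable_cosh2 : measurable_fun setT cosh2.
Proof. by apply: measurable_funD => //; exact: measurableT_comp. Qed.

Lemma measurable_cosh2_powR (a : R) : measurable_fun setT (fun u => cosh2 u `^ a).
Proof.
apply: (measurableT_comp (measurable_powR a)); exact: measurable_cosh2.
Qed.

Lemma measurable_sech2 : measurable_fun setT sech2.
Proof.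
have -> : sech2 = fun u => (2 * cosh2 u `^ (-1)) ^+ 2.
  by apply/funext => u; rewrite powR_inv1// ltW// cosh2_gt0.
by apply: measurable_funX; apply: measurable_funM => //; exact: measurable_cosh2_powR.
Qed.

End sech2.

(** * Singularity and decay of the reduced kernel *)

Lemma powRN_anti {R : realType} (x y a : R) :
  0 < x -> x <= y -> 0 <= a -> y `^ (- a) <= x `^ (- a).
Proof.
move=> x0 xy a0; have y0 := lt_le_trans x0 xy.
rewrite !powRN lef_pV2 ?posrE ?powR_gt0//.
by rewrite ge0_ler_powR ?nnegrE ?(ltW x0) ?(ltW y0).
Qed.

Section kernel_profile.
Context {R : realType}.
Implicit Types (be sg u : R).

(** All that the boundedness of the potential operator depends on: how fast the
    kernel decays and how singular it is on the diagonal.  The upper bound is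
    stated for every exponent t up to sigma and below 1/2: for t = sigma it is the
    true order of the singularity when sigma < 1/2, and the smaller exponents
    dispense with the logarithm that appears for sigma = 1/2. *)
Record kernel_profile be sg (k : R -> \bar R) : Prop := KernelProfile {
  profile_measurable : measurable_fun setT k ;
  profile_ge : exists2 c, 0 < c & forall u, ((c * expR (- (be * `|u|)))%:E <= k u)%E ;
  profile_sing_ge : sg < 1 / 2 ->
    exists2 c, 0 < c & forall u, `|u| <= 1 -> ((c * `|u| `^ (2 * sg - 1))%:E <= k u)%E ;
  profile_log_ge : sg = 1 / 2 ->
    forall M, exists2 e, 0 < e & forall u, `|u| <= e -> (M%:E <= k u)%E ;
  profile_sing_le : forall t, 0 < t <= sg -> t < 1 / 2 ->
    exists2 C, 0 < C & forall u, u != 0 ->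
      (k u <= (C * (expR (- (be * `|u|)) * (1 + `|u| `^ (2 * t - 1))))%:E)%E ;
  profile_bounded : 1 / 2 < sg ->
    exists2 C, 0 < C & forall u, (k u <= (C * expR (- (be * `|u|)))%:E)%E }.

(** The potential kernel in logarithmic coordinates, after removal of the factor
    that is not a function of the difference of the variables. *)
Definition reduced_kernel be (d : nat -> R) u : \bar R :=
  (\sum_(k <oo) (cosh2 u `^ (- be) * (d k * sech2 u ^+ k))%:E)%E.

Section profile_of_coefficients.
Variables (be sg c C : R) (d : nat -> R).
Hypothesis be0 : 0 < be.
Hypothesis sg0 : 0 < sg.
Hypothesis c0 : 0 < c.
Hypothesis C0 : 0 < C.
Hypothesis d_ge : forall k, c * k.+1%:R `^ (- (sg + 1 / 2)) <= d k.
Hypothesis d_le : forall k, d k <= C * k.+1%:R `^ (- (sg + 1 / 2)).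

Let d_ge0 k : 0 <= d k.
Proof. by apply: le_trans (d_ge k); rewrite mulr_ge0 ?powR_ge0// ltW. Qed.

Let dterm_ge0 u k : 0 <= d k * sech2 u ^+ k.
Proof. by apply: mulr_ge0; [exact: d_ge0|exact/exprn_ge0/sech2_ge0]. Qed.

Let term_ge0 u k : (0 <= (cosh2 u `^ (- be) * (d k * sech2 u ^+ k))%:E)%E.
Proof.
by rewrite lee_fin; apply: mulr_ge0; [exact: powR_ge0|exact: dterm_ge0].
Qed.

Let pref_le u : cosh2 u `^ (- be) <= expR (- (be * `|u|)).
Proof.
have -> : expR (- (be * `|u|)) = expR `|u| `^ (- be).
  by rewrite -expRM; congr expR; ring.
exact: powRN_anti (expR_gt0 _) (expR_le_cosh2 u) (ltW be0).
Qed.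

Let pref_ge u : 2 `^ (- be) * expR (- (be * `|u|)) <= cosh2 u `^ (- be).
Proof.
have e0 : 0 < 2 * expR `|u| by rewrite mulr_gt0// expR_gt0.
have -> : 2 `^ (- be) * expR (- (be * `|u|)) = (2 * expR `|u|) `^ (- be).
  by rewrite powRM ?expR_ge0// -expRM; congr (_ * expR _); ring.
exact: powRN_anti (cosh2_gt0 u) (cosh2_le u) (ltW be0).
Qed.

Let reduced_le u (M : R) :
  (forall n, \sum_(k < n) d k * sech2 u ^+ k <= M) ->
  (reduced_kernel be d u <= (expR (- (be * `|u|)) * M)%:E)%E.
Proof.
move=> h; apply: lime_le.
  by apply: is_cvg_nneseries => n _ _; exact: term_ge0.
apply: nearW => n /=; rewrite sumEFin lee_fin big_mkord -mulr_sumr.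
have h0 : 0 <= \sum_(k < n) d k * sech2 u ^+ k.
  by apply: sumr_ge0 => k _; exact: dterm_ge0.
apply: (@le_trans _ _ (expR (- (be * `|u|)) * \sum_(k < n) d k * sech2 u ^+ k)).
  by rewrite ler_wpM2r.
by rewrite ler_wpM2l ?expR_ge0.
Qed.

Let reduced_ge u n (M : R) : M <= \sum_(k < n) d k * sech2 u ^+ k ->
  ((2 `^ (- be) * expR (- (be * `|u|)) * M)%:E <= reduced_kernel be d u)%E.
Proof.
move=> h; apply: (le_trans _ (nneseries_lim_ge n _)) => [|k _ _]; last exact: term_ge0.
rewrite sumEFin lee_fin big_mkord -mulr_sumr.
apply: (@le_trans _ _ (2 `^ (- be) * expR (- (be * `|u|)) * \sum_(k < n) d k * sech2 u ^+ k)).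
  by rewrite ler_wpM2l ?mulr_ge0 ?powR_ge0 ?expR_ge0.
rewrite ler_wpM2r//.
by apply: sumr_ge0 => k _; exact: dterm_ge0.
Qed.

Let dsum_le s u n : s <= sg + 1 / 2 ->
  \sum_(k < n) d k * sech2 u ^+ k <=
  C * \sum_(k < n) k.+1%:R `^ (- s) * (1 - (1 - sech2 u)) ^+ k.
Proof.
move=> ss; rewrite mulr_sumr; apply: ler_sum => k _.
rewrite subKr mulrA ler_wpM2r//; first exact/exprn_ge0/sech2_ge0.
apply: le_trans (d_le k) _; rewrite ler_wpM2l ?(ltW C0)// ler_powR ?ler1n//.
by rewrite lerN2.
Qed.

Let dsum_ge u n :
  c * (\sum_(k < n) k.+1%:R `^ (- (sg + 1 / 2)) * (1 - (1 - sech2 u)) ^+ k) <=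
  \sum_(k < n) d k * sech2 u ^+ k.
Proof.
rewrite mulr_sumr; apply: ler_sum => k _.
rewrite subKr mulrA ler_wpM2r//; exact/exprn_ge0/sech2_ge0.
Qed.

Let onem_sech2_gt0 u : u != 0 -> 0 < 1 - sech2 u <= 1.
Proof.
move=> u0; rewrite lerBlDr lerDl sech2_ge0 andbT.
apply: lt_le_trans (onem_sech2_ge u); apply: exprn_gt0.
by rewrite divr_gt0 ?normr_gt0// ltr_wpDr// mulr_ge0.
Qed.

(** Near the origin 1 - sech^2 u is comparable to u^2, so the bounds for
    sum (k + 1)^(- s) (1 - d)^k with s = sigma + 1/2 and d = 1 - sech^2 u become
    bounds by powers |u|^(2 s - 2). *)
Lemma reduced_kernel_profile : kernel_profile be sg (reduced_kernel be d).
Proof.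
have sg0' := sg0.
split.
- apply: ge0_emeasurable_sum => [k u _ _|k _]; first exact: term_ge0.
  apply/measurable_EFinP; apply: measurable_funM; first exact: measurable_cosh2_powR.
  by apply: measurable_funM => //; apply: measurable_funX; exact: measurable_sech2.
- exists (2 `^ (- be) * d 0).
    rewrite mulr_gt0 ?powR_gt0//; apply: lt_le_trans (d_ge 0).
    by rewrite mulr_gt0// powR_gt0.
  move=> u; rewrite mulrAC; apply: (@reduced_ge _ 1).
  by rewrite big_ord_recr big_ord0/= add0r expr0 mulr1.
- move=> sg2; exists (2 `^ (- be) * expR (- be) * (c * ((16 `^ (sg - 1 / 2)) / 2))).
    by rewrite !mulr_gt0 ?powR_gt0 ?expR_gt0 ?invr_gt0.
  move=> u u1; have [->|u0] := eqVneq u 0.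
    rewrite normr0 powR0 ?mulr0; last by rewrite lt_eqF; lra.
    by apply: nneseries_ge0 => k _ _; exact: term_ge0.
  have K : 16 `^ (sg - 1 / 2) * `|u| `^ (2 * sg - 1) <=
      (4 * (1 - sech2 u)) `^ (sg + 1 / 2 - 1).
    have -> : sg + 1 / 2 - 1 = - (1 / 2 - sg) by field.
    have -> : sg - 1 / 2 = - (1 / 2 - sg) by ring.
    have -> : 2 * sg - 1 = 2%:R * (- (1 / 2 - sg)) by field.
    rewrite powRrM powR_mulrn// -powRM ?sqr_ge0//; apply: powRN_anti.
    - by rewrite mulr_gt0//; have /andP[] := onem_sech2_gt0 u0.
    - by have := onem_sech2_le u; rewrite real_normK ?num_real//; lra.
    - by rewrite subr_ge0 ltW.
  have s01 : 0 <= sg + 1 / 2 < 1 by apply/andP; split; lra.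
  have [n hn] := sum_powR_geom_ge s01 (onem_sech2_gt0 u0).
  apply: le_trans (@reduced_ge u n (c * ((4 * (1 - sech2 u)) `^ (sg + 1 / 2 - 1) / 2)) _).
    rewrite lee_fin -!mulrA ler_wpM2l ?powR_ge0//.
    rewrite ler_pM ?mulr_ge0 ?expR_ge0 ?powR_ge0 ?(ltW c0) ?invr_ge0//.
      by rewrite ler_expR lerN2 -[leRHS]mulr1 ler_wpM2l// ltW.
    by rewrite ler_wpM2l ?(ltW c0)//; move: K; lra.
  apply: le_trans (dsum_ge u n); rewrite ler_wpM2l// ltW//.
- move=> sgE M; pose p := 2 `^ (- be) * expR (- be) * c.
  have p0 : 0 < p by rewrite !mulr_gt0 ?powR_gt0 ?expR_gt0.
  have [e e0 [n hn]] := sum_inv_geom_ge (`|M| / p).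
  pose r := Num.min 1 (Num.min 1 e / 4).
  have r0 : 0 < r by rewrite lt_min ltr01 divr_gt0// lt_min ltr01.
  exists r => // u ur.
  have ur2 : 1 - sech2 u <= e.
    apply: le_trans (onem_sech2_le u) _; rewrite -real_normK ?num_real//.
    have : `|u| <= 1 by apply: le_trans ur _; rewrite ge_min lexx.
    have : `|u| <= Num.min 1 e / 4 by apply: le_trans ur _; rewrite ge_min lexx orbT.
    have : Num.min 1 e <= e by rewrite ge_min lexx orbT.
    by have := normr_ge0 u; nra.
  have u1 : `|u| <= 1 by apply: le_trans ur _; rewrite ge_min lexx.
  have {}hn := hn (1 - sech2 u); rewrite onem_sech2_ge0 ur2 in hn.
  have {}hn := hn isT.
  apply: le_trans (@reduced_ge u n (c * (`|M| / p)) _); last first.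
    apply: le_trans (dsum_ge u n).
    have -> : sg + 1 / 2 = 1 by rewrite sgE; field.
    by rewrite ler_wpM2l// ltW.
  rewrite lee_fin; apply: le_trans (ler_norm M) _.
  have {1}-> : `|M| = 2 `^ (- be) * expR (- be) * (c * (`|M| / p)).
    by rewrite /p; field; rewrite !gt_eqF ?powR_gt0 ?expR_gt0.
  rewrite ler_wpM2r ?mulr_ge0 ?invr_ge0 ?(ltW c0) ?(ltW p0)// ler_wpM2l ?powR_ge0//.
  by rewrite ler_expR lerN2 -[leRHS]mulr1 ler_wpM2l// ltW.
- move=> t /andP[t0 tsg] t2.
  have s01 : 0 <= t + 1 / 2 < 1 by apply/andP; split; lra.
  exists (C * ((1 - (t + 1 / 2))^-1 + 1) * 3).
    by rewrite !mulr_gt0// addr_gt0// invr_gt0; lra.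
  move=> u u0; rewrite mulrCA; apply: reduced_le => n.
  apply: le_trans (@dsum_le (t + 1 / 2) u n _) _; first by lra.
  rewrite -!mulrA ler_wpM2l ?(ltW C0)//.
  apply: le_trans (sum_powR_geom_le n s01 (onem_sech2_gt0 u0)) _.
  rewrite ler_wpM2l ?addr_ge0 ?invr_ge0//; first lra.
  have -> : t + 1 / 2 - 1 = t - 1 / 2 by field.
  by apply: onem_sech2_powR_le => //; rewrite t0.
- move=> sg2; exists (C * (1 + (sg + 1 / 2 - 1)^-1)).
    by rewrite mulr_gt0// addr_gt0// invr_gt0; lra.
  move=> u; rewrite mulrC; apply: reduced_le => n.
  apply: le_trans (@dsum_le (sg + 1 / 2) u n _) _ => //.
  rewrite ler_wpM2l ?(ltW C0)//.
  apply: (@le_trans _ _ (\sum_(k < n) k.+1%:R `^ (- (sg + 1 / 2)))); last first.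
    by apply: sum_powR_gt1_le; lra.
  apply: ler_sum => k _; rewrite -[leRHS]mulr1 ler_wpM2l ?powR_ge0//.
  by rewrite subKr exprn_ile1 ?sech2_ge0 ?sech2_le1.
Qed.

End profile_of_coefficients.
End kernel_profile.

(** * The Bessel series of the potential kernel *)

Section kernel_formula.
Context {R : realType}.
Notation leb := (@lebesgue_measure R).
Implicit Types (al sg x y t s u : R).

(** What remains of the k-th coefficient of the Bessel series once the
    corresponding term of the heat kernel has been integrated in time. *)
Definition bessel_coef al sg (k : nat) : R :=
  Gamma_fun (2 * k%:R + (al + 1 - sg)) /
  (4 ^+ k * (k`!%:R * Gamma_fun (k%:R + al + 1))).

Lemma bessel_coefS al sg k : -1 < al -> sg < al + 1 ->
  let a := (al + 1 - sg) / 2 in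
  bessel_coef al sg k.+1 = bessel_coef al sg k *
    ((k%:R + a) / (k%:R + 1) * ((k%:R + (a + 1 / 2)) / (k%:R + (al + 1)))).
Proof.
move=> al1 sgal a; rewrite /bessel_coef.
have k0 : 0 <= k%:R :> R by [].
have be0 : 0 < 2 * k%:R + (al + 1 - sg) by lra.
have -> : 2 * k.+1%:R + (al + 1 - sg) = 2 * k%:R + (al + 1 - sg) + 1 + 1.
  by rewrite -natr1; ring.
have -> : k.+1%:R + al + 1 = k%:R + al + 1 + 1 by rewrite -natr1; ring.
rewrite Gamma_funS; last lra.
rewrite Gamma_funS//.
rewrite Gamma_funS; last lra.
rewrite factS natrM exprS -natr1 /a.
have f0 : k`!%:R != 0 :> R by rewrite pnatr_eq0 -lt0n fact_gt0.
have g0 : Gamma_fun (k%:R + al + 1) != 0 by rewrite gt_eqF// Gamma_fun_gt0//; lra.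
have e0 : 4 ^+ k != 0 :> R by rewrite expf_neq0.
have h1 : k%:R + 1 != 0 :> R by rewrite gt_eqF//; lra.
have h2 : k%:R + (al + 1) != 0 :> R by rewrite gt_eqF//; lra.
have h3 : k%:R + al + 1 != 0 :> R by rewrite gt_eqF//; lra.
field.
by rewrite h1 h2 e0 f0 g0.
Qed.

(** Two steps of the recursion of Gamma in the numerator are one step in k, so the
    coefficients are a product of two quotients of rising factorials. *)
Lemma bessel_coefE al sg k : -1 < al -> sg < al + 1 ->
  let a := (al + 1 - sg) / 2 in
  bessel_coef al sg k = bessel_coef al sg 0 *
    (rising_ratio a 1 k * rising_ratio (a + 1 / 2) (al + 1) k).
Proof.
move=> al1 sgal a; elim: k => [|k ih].
  by rewrite /rising_ratio !big_ord0 !mulr1.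
rewrite bessel_coefS// ih /rising_ratio !big_ord_recr/= -/a.
by rewrite -!mulrA; congr (_ * (_ * _)); ring.
Qed.

Lemma bessel_coef_gt0 al sg k : -1 < al -> sg < al + 1 -> 0 < bessel_coef al sg k.
Proof.
move=> al1 sgal; have k0 : 0 <= k%:R :> R by [].
rewrite divr_gt0 ?mulr_gt0 ?exprn_gt0 ?Gamma_fun_gt0 ?ltr0n ?fact_gt0//; lra.
Qed.

Lemma bessel_coef_bounds al sg : -1 < al -> sg < al + 1 ->
  exists c C, [/\ 0 < c, 0 < C,
    forall k, c * k.+1%:R `^ (- (sg + 1 / 2)) <= bessel_coef al sg k &
    forall k, bessel_coef al sg k <= C * k.+1%:R `^ (- (sg + 1 / 2))].
Proof.
move=> al1 sgal; pose a := (al + 1 - sg) / 2.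
have a0 : 0 < a by rewrite /a; lra.
have a20 : 0 < a + 1 / 2 by lra.
have al0 : 0 < al + 1 by lra.
have b0 := bessel_coef_gt0 0 al1 sgal.
have [C1 C10 hC1] := rising_ratio_le a0 ltr01.
have [C2 C20 hC2] := rising_ratio_le a20 al0.
have [c1 c10 hc1] := rising_ratio_ge a0 ltr01.
have [c2 c20 hc2] := rising_ratio_ge a20 al0.
have E k : k.+1%:R `^ (- (sg + 1 / 2)) =
    k.+1%:R `^ (a - 1) * k.+1%:R `^ (a + 1 / 2 - (al + 1)) :> R.
  rewrite -powRD ?pnatr_eq0 ?implybT//; congr powR; by rewrite /a; field.
exists (bessel_coef al sg 0 * (c1 * c2)), (bessel_coef al sg 0 * (C1 * C2)).
split => [||k|k].
- exact: mulr_gt0 b0 (mulr_gt0 c10 c20).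
- exact: mulr_gt0 b0 (mulr_gt0 C10 C20).
- rewrite (bessel_coefE k)// E -[leLHS]mulrA ler_wpM2l ?(ltW b0)// [leLHS]mulrACA.
  by rewrite ler_pM ?mulr_ge0 ?powR_ge0 ?(ltW c10) ?(ltW c20).
- rewrite (bessel_coefE k)// E -[leRHS]mulrA ler_wpM2l ?(ltW b0)// [leRHS]mulrACA.
  by rewrite ler_pM ?hC1 ?hC2// ltW// rising_ratio_gt0.
Qed.

Lemma bessel_profile al sg : -1 < al -> 0 < sg -> sg < al + 1 ->
  kernel_profile (al + 1 - sg) sg
    (reduced_kernel (al + 1 - sg) (bessel_coef al sg)).
Proof.
move=> al1 sg0 sgal; have [c [C [c0 C0 hc hC]]] := bessel_coef_bounds al1 sgal.
by apply: (reduced_kernel_profile _ sg0 c0 C0 hc hC); lra.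
Qed.

(** From the second term on the arguments exceed 1, where the recursion makes Gamma
    grow. *)
Lemma Gamma_fun_shift_ge al : -1 < al ->
  exists2 m, 0 < m & forall k : nat, m <= Gamma_fun (k%:R + al + 1).
Proof.
move=> al1; have g1 : 0 < Gamma_fun (al + 1) by rewrite Gamma_fun_gt0//; lra.
have g2 : 0 < Gamma_fun (1 + al + 1) by rewrite Gamma_fun_gt0//; lra.
exists (Num.min (Gamma_fun (al + 1)) (Gamma_fun (1 + al + 1))).
  by rewrite lt_min g1.
case=> [|k]; first by rewrite add0r ge_min lexx.
elim: k => [|k ih]; first by rewrite ge_min lexx orbT.
apply: (le_trans ih); have k0 : 0 <= k%:R :> R by [].
have -> : k.+2%:R + al + 1 = k.+1%:R + al + 1 + 1 by rewrite -[k.+2%:R]natr1; ring.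
have h : 1 <= k.+1%:R + al + 1 by clear ih g1 g2; rewrite -[k.+1%:R]natr1; lra.
move: h; generalize (k.+1%:R + al + 1); clear ih g1 g2 k0 k => x h.
have x0 : 0 < x by lra.
rewrite (Gamma_funS x0) -[leLHS]mul1r; apply: ler_wpM2r => //.
exact/ltW/Gamma_fun_gt0.
Qed.

Definition besselI_term al z (k : nat) : R :=
  (z / 2) `^ (2 * k%:R + al) / (k`!%:R * Gamma_fun (k%:R + al + 1)).

Lemma besselI_term_ge0 al z k : -1 < al -> 0 <= besselI_term al z k.
Proof.
move=> al1; have k0 : 0 <= k%:R :> R by [].
rewrite divr_ge0 ?powR_ge0// mulr_ge0// ltW// Gamma_fun_gt0//; lra.
Qed.

(** The series is dominated by the exponential series of (z / 2)^2. *)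
Lemma is_cvg_besselI al z : -1 < al -> 0 < z -> cvgn (series (besselI_term al z)).
Proof.
move=> al1 z0; have [m m0 hm] := Gamma_fun_shift_ge al1.
pose w := (z / 2) ^+ 2; pose c := (z / 2) `^ al / m.
have z20 : 0 < z / 2 by rewrite divr_gt0.
apply: (@series_le_cvg _ _ (c *: exp_coeff w)) => [k|k|k|].
- exact: besselI_term_ge0.
- apply: mulr_ge0; first by rewrite divr_ge0 ?powR_ge0// ltW.
  exact/exp_coeff_ge0/sqr_ge0.
- rewrite /besselI_term /c /= /GRing.scale/=.
  have f0 : 0 < k`!%:R :> R by rewrite ltr0n fact_gt0.
  have -> : (z / 2) `^ (2 * k%:R + al) = w ^+ k * (z / 2) `^ al.
    rewrite powRD ?(gt_eqF z20) ?implybT// /w -exprM; congr (_ * _).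
    by rewrite -natrM powR_mulrn// ltW.
  rewrite /exp_coeff /=.
  change (w ^+ k * (z / 2) `^ al / (k`!%:R * Gamma_fun (k%:R + al + 1)) <=
    (z / 2) `^ al / m * (w ^+ k / k`!%:R)).
  have -> : (z / 2) `^ al / m * (w ^+ k / k`!%:R) =
    w ^+ k * (z / 2) `^ al / (k`!%:R * m).
    by field; rewrite !gt_eqF.
  apply: ler_wpM2l.
    by apply: mulr_ge0; [exact/exprn_ge0/sqr_ge0|exact: powR_ge0].
  have g0 := lt_le_trans m0 (hm k); have gm := hm k.
  move: g0 gm; generalize (Gamma_fun (k%:R + al + 1)) => g g0 gm.
  by rewrite lef_pV2 ?posrE ?mulr_gt0// ler_wpM2l// ltW.
- by apply: is_cvg_seriesZ; exact: is_cvg_series_exp_coeff.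
Qed.

Lemma EFin_besselI al z : -1 < al -> 0 < z ->
  (besselI al z)%:E = (\sum_(k <oo) (besselI_term al z k)%:E)%E.
Proof.
move=> al1 z0; rewrite /besselI -EFin_lim; last exact: is_cvg_besselI.
by congr (limn _); apply/funext => n; rewrite /= sumEFin.
Qed.

(** The integral over time that each term of the Bessel series contributes: the
    substitution v = exp (L - w) turns it into a Gamma integral. *)
Lemma integral_expR_inv (L b : R) : 0 < b ->
  (\int[leb]_(x in `]0%R, +oo[) (x `^ (- b - 1) * expR (- (expR L * x `^ (- 1))))%:E =
   (expR (- (b * L)) * Gamma_fun b)%:E)%E.
Proof.
move=> b0; rewrite ge0_integral_expR; last 2 first.
- apply/measurable_EFinP; apply: measurable_funM; first exact: measurable_powR.
  apply: measurableT_comp => //; apply: measurableT_comp => //.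
  by apply: measurable_funM => //; exact: measurable_powR.
- by move=> x; rewrite lee_fin mulr_ge0 ?powR_ge0 ?expR_ge0.
pose f (v : R) := (expR (- (b * v) - expR (L - v)))%:E.
have mf : measurable_fun setT f.
  apply/measurable_EFinP; apply: measurableT_comp => //.
  apply: measurable_funB.
    by apply: measurableT_comp => //; exact: mulrl_measurable.
  by apply: measurableT_comp => //; exact: measurable_funB.
transitivity (\int[leb]_v f v)%E.
  apply: eq_integral => v _; rewrite -EFinM /f -!expRM -!expRD; congr (expR _)%:E.
  by rewrite mulrN1; ring.
rewrite -(ge0_integralBl L mf); last by move=> v; rewrite lee_fin expR_ge0.
transitivity (\int[leb]_v ((expR (- (b * L)))%:E * (gamma_integrand b v)%:E))%E.
  apply: eq_integral => v _; rewrite -EFinM /f /gamma_integrand -expRD.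
  by congr (expR _)%:E; rewrite subKr; ring.
rewrite ge0_integralZl//.
- by rewrite -EFin_Gamma_fun.
- by apply/measurable_EFinP; exact: measurable_gamma_integrand.
- by move=> v _; rewrite lee_fin expR_ge0.
Qed.

Lemma expR_cosh2 t s : expR t ^+ 2 + expR s ^+ 2 = expR (t + s) * cosh2 (t - s).
Proof.
rewrite /cosh2 mulrDr -!expRD -!expRM_natl; congr (expR _ + expR _); ring.
Qed.

Lemma powR4E (x : R) : 4 `^ x = expR (x * ln 4).
Proof. by rewrite [x * _]mulrC expRM lnK// posrE. Qed.

(** The k-th term of the integrand defining the kernel at (exp t, exp s), at time
    v.  The sum of the squares exp (2 t) + exp (2 s) in the exponent has been written
    as a single exponential, which is why a logarithm of cosh appears in L. *)
Definition time_term al sg t s k v : R :=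
  let be := al + 1 - sg in
  let L := t + s + ln (cosh2 (t - s)) - ln 4 in
  expR (2 * k%:R * (t + s) - (2 * k%:R + al) * ln 4) / 2 /
    (k`!%:R * Gamma_fun (k%:R + al + 1)) *
  (v `^ (- (2 * k%:R + be) - 1) * expR (- (expR L * v `^ (- 1)))).

(** Every factor is written as one exponential, after which the equality is linear
    in the exponents. *)
Lemma W_kernel_series al sg t s v : -1 < al -> 0 < v ->
  ((W_kernel al v (expR t) (expR s) * v `^ (sg - 1))%:E =
  \sum_(k <oo) (time_term al sg t s k v)%:E)%E.
Proof.
move=> al1 v0; rewrite /W_kernel mulrAC EFinM.
have z0 : 0 < expR t * expR s / (2 * v) by rewrite divr_gt0 ?mulr_gt0 ?expR_gt0.
rewrite (EFin_besselI al1 z0) -nneseriesZl; last first.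
  by move=> k _; rewrite lee_fin besselI_term_ge0.
apply: eq_eseriesr => k _; rewrite -EFinM; congr EFin.
rewrite /besselI_term /time_term /=.
have [w wv] : exists w, v = expR w by exists (ln v); rewrite lnK.
have [c ch] : exists c, cosh2 (t - s) = expR c.
  by exists (ln (cosh2 (t - s))); rewrite lnK// posrE cosh2_gt0.
rewrite ch expRK expR_cosh2 ch wv.
have f0 : k`!%:R != 0 :> R by rewrite pnatr_eq0 -lt0n fact_gt0.
set D := k`!%:R * _.
have four : 4 = expR (ln 4) :> R by rewrite lnK// posrE.
have -> : expR t * expR s / (2 * expR w) / 2 = expR (t + s - w - ln 4).
  rewrite !expRD !expRN -four; field; exact: lt0r_neq0 (expR_gt0 w).
have -> : (2 * expR w)^-1 = expR (- w) / 2.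
  rewrite expRN; field; exact: lt0r_neq0 (expR_gt0 w).
have -> : expR (t + s) * expR c / (4 * expR w) = expR (t + s + c - w - ln 4).
  rewrite !expRD !expRN -four; field; exact: lt0r_neq0 (expR_gt0 w).
rewrite -expRD -!expRM.
have -> : expR (t + s + c - ln 4) * expR (w * -1) = expR (t + s + c - w - ln 4).
  by rewrite -expRD; congr expR; ring.
generalize (expR (- expR (t + s + c - w - ln 4))) => e.
transitivity (expR (- w + (t + s) * - al + w * (sg - 1) +
    (t + s - w - ln 4) * (2 * k%:R + al)) * e / 2 / D).
  by rewrite 3!expRD; ring.
transitivity (expR (2 * k%:R * (t + s) - (2 * k%:R + al) * ln 4 +
    w * (- (2 * k%:R + (al + 1 - sg)) - 1)) * e / 2 / D).
  by congr (expR _ * _ / _ / _); ring.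
by rewrite expRD; ring.
Qed.

Lemma time_term_ge0 al sg t s k v : -1 < al -> 0 <= time_term al sg t s k v.
Proof.
move=> al1; have k0 : 0 <= k%:R :> R by [].
apply: mulr_ge0; last by apply: mulr_ge0; [exact: powR_ge0|exact: expR_ge0].
apply: divr_ge0; first by rewrite divr_ge0// expR_ge0.
by apply: mulr_ge0 => //; apply/ltW/Gamma_fun_gt0; lra.
Qed.

Lemma integral_time_term al sg t s k : -1 < al -> sg < al + 1 ->
  let be := al + 1 - sg in
  (\int[leb]_(v in `]0%R, +oo[) (time_term al sg t s k v)%:E =
  ((4 `^ (be - al) / 2 * expR (- (be * (t + s)))) *
  (cosh2 (t - s) `^ (- be) * (bessel_coef al sg k * sech2 (t - s) ^+ k)))%:E)%E.
Proof.
move=> al1 sgal be; have k0 : 0 <= k%:R :> R by [].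
have be0 : 0 < 2 * k%:R + be by rewrite /be; lra.
rewrite /time_term -/be; set L := _ - ln 4; set A := _ / _ / _.
have A0 : 0 <= A.
  apply: divr_ge0; first by rewrite divr_ge0// expR_ge0.
  by apply: mulr_ge0 => //; apply/ltW/Gamma_fun_gt0; lra.
under eq_integral do rewrite EFinM.
rewrite ge0_integralZl_EFin//; last 2 first.
- by move=> v _; rewrite lee_fin mulr_ge0 ?powR_ge0 ?expR_ge0.
- apply/measurable_EFinP; apply: measurable_funTS.
  apply: measurable_funM; first exact: measurable_powR.
  apply: measurableT_comp => //; apply: measurableT_comp => //.
  by apply: measurable_funM => //; exact: measurable_powR.
rewrite (integral_expR_inv L be0) -EFinM; congr EFin.
rewrite /A /L /bessel_coef /sech2 -/be.
have [c ch] : exists c, cosh2 (t - s) = expR c.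
  by exists (ln (cosh2 (t - s))); rewrite lnK// posrE cosh2_gt0.
rewrite ch expRK.
have f0 : k`!%:R != 0 :> R by rewrite pnatr_eq0 -lt0n fact_gt0.
have g0 : Gamma_fun (k%:R + al + 1) != 0 by rewrite gt_eqF// Gamma_fun_gt0//; lra.
move: g0; generalize (Gamma_fun (k%:R + al + 1)) => g g0.
generalize (Gamma_fun (2 * k%:R + be)) => h.
have four : 4 = expR (ln 4) :> R by rewrite lnK// posrE.
have -> : ((2 / expR c) ^+ 2) ^+ k = expR (k%:R * ln 4 - 2 * k%:R * c).
  have -> : (2 / expR c) ^+ 2 = expR (ln 4 - 2 * c).
    rewrite expRD expRN -four expRM_natl; field; exact: lt0r_neq0 (expR_gt0 c).
  by rewrite -expRM_natl; congr expR; ring.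
have -> : 4 ^+ k = expR (k%:R * ln 4) :> R by rewrite expRM_natl -four.
rewrite powR4E -expRM.
set X := 2 * k%:R * (t + s) - (2 * k%:R + al) * ln 4.
set Y := - ((2 * k%:R + be) * (t + s + c - ln 4)).
set X1 := (be - al) * ln 4; set X2 := - (be * (t + s)); set X3 := c * - be.
set X4 := k%:R * ln 4 - 2 * k%:R * c; set X5 := k%:R * ln 4.
have E : expR X * expR Y * expR X5 = expR X1 * expR X2 * expR X3 * expR X4.
  by rewrite -!expRD /X /Y /X1 /X2 /X3 /X4 /X5; congr expR; ring.
have E5 : expR X5 != 0 by exact: lt0r_neq0 (expR_gt0 X5).
have -> : expR X / 2 / (k`!%:R * g) * (expR Y * h) =
  expR X * expR Y * expR X5 * h / (2 * (k`!%:R * g)) / expR X5.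
  by field; rewrite f0 g0 E5.
by rewrite E; field; rewrite f0 g0 E5.
Qed.

(** All terms are nonnegative, so the Bessel series may be integrated term by term. *)
Lemma K_kernel_expR al sg : -1 < al -> 0 < sg -> sg < al + 1 ->
  let be := al + 1 - sg in
  exists2 C0, 0 < C0 & forall t s,
    (K_kernel al sg (expR t) (expR s) =
     (C0 * expR (- (be * (t + s))))%:E *
       reduced_kernel be (bessel_coef al sg) (t - s))%E.
Proof.
move=> al1 sg0 sgal be; exists ((Gamma_fun sg)^-1 * (4 `^ (be - al) / 2)).
  by rewrite mulr_gt0 ?invr_gt0 ?Gamma_fun_gt0// divr_gt0 ?powR_gt0.
move=> t s; rewrite /K_kernel -mulrA EFinM -muleA; congr (_ * _)%E.
transitivity (\int[leb]_(v in `]0%R, +oo[)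
    \sum_(k <oo) (time_term al sg t s k v)%:E)%E.
  apply: eq_integral => v /set_mem/=; rewrite in_itv/= andbT => v0.
  exact: W_kernel_series.
rewrite integral_nneseries//; last 2 first.
- move=> k; apply/measurable_EFinP; apply: measurable_funTS.
  apply: measurable_funM => //.
  apply: measurable_funM; first exact: measurable_powR.
  apply: measurableT_comp => //; apply: measurableT_comp => //.
  by apply: measurable_funM => //; exact: measurable_powR.
- by move=> k v _; rewrite lee_fin time_term_ge0.
rewrite /reduced_kernel -nneseriesZl; last first.
  move=> k _; rewrite lee_fin; apply: mulr_ge0; first exact: powR_ge0.
  apply: mulr_ge0; first exact/ltW/bessel_coef_gt0.
  exact/exprn_ge0/sech2_ge0.
by apply: eq_eseriesr => k _; rewrite integral_time_term.
Qed.

End kernel_formula.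

(** * Young's inequality *)

Section convolution.
Context {R : realType}.
Notation leb := (@lebesgue_measure R).
Implicit Types (h G : R -> R).

Definition convol h G (t : R) : \bar R := (\int[leb]_s (h (t - s) * G s)%:E)%E.

Lemma measurable_convol_integrand h G : measurable_fun setT h ->
  measurable_fun setT G ->
  measurable_fun setT (fun z : R * R => (h (z.1 - z.2) * G z.2)%:E).
Proof.
move=> mh mG; apply/measurable_EFinP; apply: measurable_funM.
  by apply: measurableT_comp => //; exact: measurable_funB.
exact: measurableT_comp.
Qed.

Lemma measurable_reflect h (t : R) : measurable_fun setT h ->
  measurable_fun setT (fun s : R => h (t - s)).
Proof. by move=> mh; apply: measurableT_comp => //; exact: measurable_funB. Qed.

Section nonneg.
Variables (h G : R -> R).
Hypothesis mh : measurable_fun setT h.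
Hypothesis mG : measurable_fun setT G.
Hypothesis h0 : forall u, 0 <= h u.
Hypothesis G0 : forall u, 0 <= G u.

Lemma convol_ge0 t : (0 <= convol h G t)%E.
Proof. by apply: integral_ge0 => s _; rewrite lee_fin mulr_ge0. Qed.

Lemma measurable_convol : measurable_fun setT (convol h G).
Proof.
apply: (@measurable_lebesgue_integral R (fun z => (h (z.1 - z.2) * G z.2)%:E)).
  exact: measurable_convol_integrand.
by move=> z; rewrite lee_fin mulr_ge0.
Qed.

Lemma integral_convol :
  (\int[leb]_t convol h G t = \int[leb]_u (h u)%:E * \int[leb]_s (G s)%:E)%E.
Proof.
rewrite /convol (@lebesgue_tonelli R (fun z => (h (z.1 - z.2) * G z.2)%:E)); last 2 first.
- exact: measurable_convol_integrand.
- by move=> z; rewrite lee_fin mulr_ge0.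
have ih0 : (0 <= \int[leb]_u (h u)%:E)%E.
  by apply: integral_ge0 => u _; rewrite lee_fin.
rewrite -ge0_integralZl//; last 2 first.
- exact/measurable_EFinP.
- by move=> u _; rewrite lee_fin.
apply: eq_integral => s _ /=.
under eq_integral do rewrite EFinM.
rewrite ge0_integralZr//; last 3 first.
- apply/measurable_EFinP; apply: measurableT_comp => //; exact: measurable_funB.
- by move=> t _; rewrite lee_fin.
- by rewrite lee_fin.
congr (_ * _)%E; rewrite -[RHS](ge0_integralDr (- s))//; last first.
  exact/measurable_EFinP.
Qed.

End nonneg.

(** The integrand of a convolution written as a product of three powers and bounded
    by their weighted mean.  The free parameter N balances the first of the three
    against the others, which replaces a use of Hoelder's inequality with three
    factors. *)
Lemma young_mean_le (iq la mu r p x y N : R) : 0 <= iq -> 0 <= la -> 0 <= mu ->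
  iq + la + mu = 1 -> r * (iq + la) = 1 -> p * (iq + mu) = 1 ->
  0 <= x -> 0 <= y -> 0 < N ->
  x * y <= N `^ (- iq) * (N * iq * (x `^ r * y `^ p) + (la * x `^ r + mu * y `^ p)).
Proof.
move=> iq0 la0 mu0 e1 er ep x0 y0 N0.
have -> : x * y = N `^ (- iq) *
    ((N * (x `^ r * y `^ p)) `^ iq * (x `^ r) `^ la * (y `^ p) `^ mu).
  rewrite !powRM ?mulr_ge0 ?powR_ge0 ?(ltW N0)// -!powRrM.
  have pw (z a b c : R) : 0 <= z -> 0 <= a -> 0 <= b -> c * (a + b) = 1 ->
      z `^ (c * a) * z `^ (c * b) = z.
    move=> z0 a0 b0 abc.
    rewrite -powRD -?mulrDr ?abc ?powRr1//.
    by apply/implyP; rewrite oner_eq0.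
  rewrite -{1}(pw x iq la r)// -{1}(pw y iq mu p)//.
  have -> : forall n n' a b c d : R, n * (n' * (a * c) * b * d) =
    (n * n') * (a * b * (c * d)) by move=> *; ring.
  have -> : N `^ (- iq) * N `^ iq = 1.
    by rewrite -powRD ?(gt_eqF N0) ?implybT// addNr powRr0.
  by rewrite mul1r.
rewrite ler_wpM2l ?powR_ge0//.
have := @powR_mean3_le R (N * (x `^ r * y `^ p)) (x `^ r) (y `^ p) iq la mu.
move=> /(_ _ (powR_ge0 _ _) (powR_ge0 _ _) iq0 la0 mu0 e1) h.
have {}h := h (mulr_ge0 (ltW N0) (mulr_ge0 (powR_ge0 _ _) (powR_ge0 _ _))).
by apply: (le_trans h); rewrite le_eqVlt; apply/orP; left; apply/eqP; ring.
Qed.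

Section young.
Variables (h G : R -> R) (iq la mu r p A : R).
Hypothesis mh : measurable_fun setT h.
Hypothesis mG : measurable_fun setT G.
Hypothesis h0 : forall u, 0 <= h u.
Hypothesis G0 : forall u, 0 <= G u.
Hypothesis iq0 : 0 <= iq.
Hypothesis la0 : 0 <= la.
Hypothesis mu0 : 0 <= mu.
Hypothesis e1 : iq + la + mu = 1.
Hypothesis er : r * (iq + la) = 1.
Hypothesis ep : p * (iq + mu) = 1.
Hypothesis hr_le : (\int[leb]_u (h u `^ r)%:E <= A%:E)%E.
Hypothesis Gp_le : (\int[leb]_u (G u `^ p)%:E <= 1)%E.

Let hr u := h u `^ r.
Let Gp u := G u `^ p.
Let mhr : measurable_fun setT hr.
Proof. exact: (measurableT_comp (measurable_powR r)). Qed.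
Let mGp : measurable_fun setT Gp.
Proof. exact: (measurableT_comp (measurable_powR p)). Qed.
Let hr0 u : 0 <= hr u. Proof. exact: powR_ge0. Qed.
Let Gp0 u : 0 <= Gp u. Proof. exact: powR_ge0. Qed.

Let A0 : 0 <= A.
Proof.
rewrite -lee_fin; apply: le_trans hr_le.
by apply: integral_ge0 => u _; rewrite lee_fin powR_ge0.
Qed.

(** Integration of the weighted mean; the integrals of the last two terms are at
    most A and 1.  For iq = 0 this is already the bound of the supremum. *)
Lemma convol_young_mean t N : 0 < N ->
  (convol h G t <= (N `^ (- iq))%:E * ((N * iq)%:E * convol hr Gp t + (A + 1)%:E))%E.
Proof.
move=> N0.
have Niq : 0 <= N * iq by rewrite mulr_ge0// ltW.
have m1 : measurable_fun setT (fun s : R => (hr (t - s) * Gp s)%:E).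
  by apply/measurable_EFinP; apply: measurable_funM => //; exact: measurable_reflect.
have m2 : measurable_fun setT (fun s : R => (la * hr (t - s))%:E).
  by apply/measurable_EFinP; apply: measurable_funM => //; exact: measurable_reflect.
have m3 : measurable_fun setT (fun s : R => (mu * Gp s)%:E).
  by apply/measurable_EFinP; apply: measurable_funM.
have m4 : measurable_fun setT (fun s : R => ((N * iq)%:E * (hr (t - s) * Gp s)%:E)%E).
  by apply: emeasurable_funM.
have m5 : measurable_fun setT (fun s : R => ((la * hr (t - s))%:E + (mu * Gp s)%:E)%E).
  by apply: emeasurable_funD.
have m6 : measurable_fun setT (fun s : R =>
   ((N * iq)%:E * (hr (t - s) * Gp s)%:E + ((la * hr (t - s))%:E + (mu * Gp s)%:E))%E).
  by apply: emeasurable_funD.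
have p1 s : (0 <= (hr (t - s) * Gp s)%:E)%E by rewrite lee_fin mulr_ge0.
have p4 s : (0 <= (N * iq)%:E * (hr (t - s) * Gp s)%:E)%E by rewrite mule_ge0.
have p2 s : (0 <= (la * hr (t - s))%:E)%E by rewrite lee_fin mulr_ge0.
have p3 s : (0 <= (mu * Gp s)%:E)%E by rewrite lee_fin mulr_ge0.
have p5 s : (0 <= (la * hr (t - s))%:E + (mu * Gp s)%:E)%E by rewrite adde_ge0.
apply: (@le_trans _ _ (\int[leb]_s ((N `^ (- iq))%:E *
    ((N * iq)%:E * (hr (t - s) * Gp s)%:E + ((la * hr (t - s))%:E + (mu * Gp s)%:E))))%E).
  apply: ge0_le_integral => //.
  - by move=> s _; rewrite lee_fin mulr_ge0.
  - by apply/measurable_EFinP; apply: measurable_funM => //; exact: measurable_reflect.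
  - by apply: emeasurable_funM.
  - move=> s _; change ((h (t - s) * G s)%:E <= (N `^ (- iq) *
      (N * iq * (hr (t - s) * Gp s) + (la * hr (t - s) + mu * Gp s)))%:E)%E.
    rewrite lee_fin; exact: (young_mean_le iq0 la0 mu0 e1 er ep).
rewrite ge0_integralZl//; last 2 first.
- by move=> s _; exact: adde_ge0.
- by rewrite lee_fin powR_ge0.
apply: lee_wpmul2l; first by rewrite lee_fin powR_ge0.
rewrite ge0_integralD// ge0_integralZl//.
apply: leeD => //; rewrite ge0_integralD//.
apply: (@le_trans _ _ (la%:E * A%:E + mu%:E * 1%:E)%E).
  apply: leeD.
    under eq_integral do rewrite EFinM.
    rewrite ge0_integralZl//; last 2 first.
    - by apply/measurable_EFinP; exact: measurable_reflect.
    - by move=> s _; rewrite lee_fin.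
    apply: lee_wpmul2l; first by [].
    rewrite (@ge0_integralBl R (EFin \o hr))//; exact/measurable_EFinP.
  under eq_integral do rewrite EFinM.
  rewrite ge0_integralZl//; last 2 first.
  - exact/measurable_EFinP.
  - by move=> s _; rewrite lee_fin.
  by apply: lee_wpmul2l.
rewrite -!EFinM -EFinD lee_fin.
have := iq0; have := la0; have := mu0; have := e1; have := A0; nra.
Qed.

(** Choose N as the inverse of the convolution on the right, perturbed so as to
    be positive. *)
Lemma convol_young_pointwise q t : 0 < q -> iq = q^-1 ->
  (convol h G t `^ q <= ((A + 2) `^ q)%:E * convol hr Gp t)%E.
Proof.
move=> q0 iqE; have J0 := convol_ge0 hr0 Gp0 t.
have c0 := convol_ge0 h0 G0 t.
have A2 : 0 < A + 2 by have := A0; lra.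
have A2q : 0 < (A + 2) `^ q by rewrite powR_gt0.
have [Jy|Jfin] := eqVneq (convol hr Gp t) +oo%E.
  by rewrite Jy gt0_muley ?lte_fin// leey.
have [j jE] : exists j, convol hr Gp t = j%:E.
  by exists (fine (convol hr Gp t)); rewrite fineK// ge0_fin_numE// ltey.
rewrite jE lee_fin in J0.
have H e : 0 < e -> (convol h G t <= ((A + 2) * (j + e) `^ iq)%:E)%E.
  move=> e0; have je : 0 < j + e by rewrite ltr_wpDl.
  have N0 : 0 < (j + e)^-1 by rewrite invr_gt0.
  apply: (le_trans (convol_young_mean t N0)).
  rewrite jE; change ((((j + e)^-1 `^ (- iq)) *
    (((j + e)^-1 * iq) * j + (A + 1)))%:E <= ((A + 2) * (j + e) `^ iq)%:E)%E.
  rewrite lee_fin.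
  have -> : (j + e)^-1 `^ (- iq) = (j + e) `^ iq.
    by rewrite -(powR_inv1 (ltW je)) -powRrM mulN1r opprK.
  rewrite mulrC ler_wpM2r ?powR_ge0//.
  have : (j + e)^-1 * iq * j <= 1.
    rewrite mulrAC -mulrA; have : (j + e)^-1 * j <= 1.
      by rewrite ler_pdivrMl// mulr1 lerDl ltW.
    have : 0 <= (j + e)^-1 * j by rewrite mulr_ge0// ltW.
    have := iq0; have := la0; have := mu0; have := e1; nra.
  lra.
have cfin : convol h G t \is a fin_num.
  rewrite ge0_fin_numE//; apply: le_lt_trans (H 1 ltr01) _; exact: ltry.
have [c cE] : exists c, convol h G t = c%:E by exists (fine (convol h G t)); rewrite fineK.
rewrite jE cE poweR_EFin -EFinM lee_fin; rewrite cE lee_fin in c0.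
apply/ler_addgt0Pr => e e0.
have e0' : 0 < e / (A + 2) `^ q by rewrite divr_gt0.
have := H _ e0'; rewrite cE lee_fin => Hc.
apply: (@le_trans _ _ (((A + 2) * (j + e / (A + 2) `^ q) `^ iq) `^ q)).
  by rewrite ge0_ler_powR ?nnegrE ?(ltW q0)// mulr_ge0 ?powR_ge0 ?(ltW A2).
rewrite powRM ?powR_ge0 ?(ltW A2)// -powRrM iqE mulVf ?gt_eqF// powRr1; last first.
  by rewrite addr_ge0// ltW.
by rewrite mulrDr lerD2l mulrC divfK// gt_eqF.
Qed.

(** Young's inequality with 1/q + 1 = 1/p + 1/r, where la = 1 - 1/p and
    mu = 1 - 1/r.  The norm of G is normalised and the constant is not sharp. *)
Lemma convol_young q : 0 < q -> iq = q^-1 ->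
  (\int[leb]_t (convol h G t `^ q) <= ((A + 2) `^ q * A)%:E)%E.
Proof.
move=> q0 iqE.
apply: (@le_trans _ _ (\int[leb]_t (((A + 2) `^ q)%:E * convol hr Gp t))%E).
  apply: ge0_le_integral => //.
  - by move=> t _; exact: poweR_ge0.
  - apply: (measurableT_comp (measurable_poweR _)); exact: measurable_convol.
  - by apply: emeasurable_funM => //; exact: measurable_convol.
  - by move=> t _; exact: convol_young_pointwise.
rewrite ge0_integralZl//; last 3 first.
- exact: measurable_convol.
- by move=> t _; exact: convol_ge0.
- by rewrite lee_fin powR_ge0.
rewrite integral_convol// EFinM; apply: lee_wpmul2l; first by rewrite lee_fin powR_ge0.
rewrite -[leRHS]mule1; apply: lee_pmul => //.
- by apply: integral_ge0 => u _; rewrite lee_fin.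
- by apply: integral_ge0 => u _; rewrite lee_fin.
Qed.

End young.
End convolution.

(** * The Hardy-Littlewood maximal function *)

Section maximal_function.
Context {R : realType}.
Notation leb := (@lebesgue_measure R).
Notation HL := (@HL_maximal R).
Implicit Types (G : R -> R).

Lemma locally_integrable_powR (p : R) G : 1 <= p -> measurable_fun setT G ->
  (forall s, 0 <= G s) -> (\int[leb]_s (G s `^ p)%:E < +oo)%E ->
  locally_integrable setT G.
Proof.
move=> p1 mG G0 Gp; split => //; first exact: openT.
move=> K _ cK; have mK := compact_measurable cK.
have mGp : measurable_fun setT (fun s => (G s `^ p)%:E).
  by apply/measurable_EFinP; exact: (measurableT_comp (measurable_powR p)).
have mGpK : measurable_fun K (fun s => (G s `^ p)%:E) by exact: measurable_funTS.
apply: (@le_lt_trans _ _ (\int[leb]_(s in K) (1 + (G s `^ p)%:E))%E).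
  apply: ge0_le_integral => //.
  - by apply/measurable_EFinP; apply: measurableT_comp => //; exact: measurable_funTS.
  - by apply: emeasurable_funD.
  - move=> s _; rewrite ger0_norm// -EFinD lee_fin.
    have [s1|s1] := leP (G s) 1; first by rewrite (le_trans s1)// lerDl powR_ge0.
    by rewrite ler_wpDl// -[leLHS]powRr1// ler_powR// ltW.
rewrite ge0_integralD//; last by move=> s _; rewrite lee_fin powR_ge0.
rewrite integral_cst// mul1e; apply: lte_add_pinfty.
  exact: compact_finite_measure.
apply: le_lt_trans Gp; apply: ge0_subset_integral => //.
by move=> s _; rewrite lee_fin powR_ge0.
Qed.

Lemma iavg_le_HL G t r : 0 < r -> (iavg G (ball t r) <= HL G t)%E.
Proof.
by move=> r0; apply: ereal_sup_ubound; exists r => //=; rewrite in_itv/= r0.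
Qed.

Lemma integral_ball_le_HL G t r : 0 < r ->
  (\int[leb]_(s in ball t r) `|(G s)%:E| <= (r *+ 2)%:E * HL G t)%E.
Proof.
move=> r0; have r20 : 0 < r *+ 2 by rewrite pmulrn_lgt0.
have := iavg_le_HL G t r0; rewrite /iavg (lebesgue_measure_ball _ (ltW r0)) inver gt_eqF// => h.
apply: le_trans (lee_wpmul2l _ h); last by rewrite lee_fin ltW.
by rewrite muleA -EFinM divff ?gt_eqF// mul1e.
Qed.

Lemma measurable_superlevel G (c : R) : measurable_fun setT G ->
  measurable [set s | c < G s].
Proof.
move=> mG; rewrite -[X in measurable X]setTI.
have := mG measurableT `]c, +oo[%classic (measurable_itv _).
by congr (measurable (_ `&` _)); apply/seteqP; split => s /=; rewrite in_itv/= andbT.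
Qed.

(** The part of G below c / 2 raises the averages by at most c / 2, so it can be
    discarded before applying the maximal inequality at level c / 2. *)
Lemma HL_weak_type G (c : R) : measurable_fun setT G -> (forall s, 0 <= G s) ->
  locally_integrable setT G -> 0 < c ->
  (leb [set x | (c%:E < HL G x)%E] <=
   (6 / c)%:E * \int[leb]_(s in [set s | (c / 2 < G s)%R]) (G s)%:E)%E.
Proof.
move=> mG G0 lG c0; pose D : set R := [set s | c / 2 < G s]; rewrite -/D.
have mD : measurable D by exact: measurable_superlevel.
have c20 : 0 < c / 2 by rewrite divr_gt0.
have mGD : measurable_fun setT (G \_ D).
  by apply/(measurable_restrictT _ mD); exact: measurable_funTS.
have lGD : locally_integrable setT (G \_ D).
  split => //; first exact: openT.
  move=> K KT cK; case: lG => _ _ /(_ K KT cK); apply: le_lt_trans.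
  apply: ge0_le_integral => //.
  - exact: compact_measurable.
  - by apply/measurable_EFinP; apply: measurableT_comp => //; exact: measurable_funTS.
  - by apply/measurable_EFinP; apply: measurableT_comp => //; exact: measurable_funTS.
  - by move=> s _; rewrite lee_fin patchE; case: ifPn => // _; rewrite normr0.
apply: (@le_trans _ _ (leb [set x | ((c / 2)%:E < HL (G \_ D) x)%E])).
  apply: le_measure; rewrite ?inE.
  - rewrite -[X in measurable X]setTI; apply: emeasurable_fun_o_infty => //.
    exact: measurable_HL_maximal.
  - rewrite -[X in measurable X]setTI; apply: emeasurable_fun_o_infty => //.
    exact: measurable_HL_maximal.
  - move=> x /=; apply: contraTT; rewrite -!leNgt => HLx.
    apply: ge_ereal_sup => _ [r /= + <-]; rewrite in_itv/= andbT => r0.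
    have r20 : 0 < r *+ 2 by rewrite pmulrn_lgt0.
    have mB : measurable (ball x r : set R) by exact: measurable_ball.
    have ib : (\int[leb]_(y in ball x r) `|(G y)%:E| <=
        \int[leb]_(y in ball x r) (`|((G \_ D) y)%:E| + (c / 2)%:E))%E.
      apply: ge0_le_integral => //.
      - by apply/measurable_EFinP; apply: measurableT_comp => //; exact: measurable_funTS.
      - apply: emeasurable_funD => //.
        by apply/measurable_EFinP; apply: measurableT_comp => //; exact: measurable_funTS.
      - move=> s _; rewrite -EFinD lee_fin ger0_norm// patchE.
        case: ifPn => [_|]; first by rewrite ger0_norm// lerDl ltW.
        rewrite notin_setE/= => /negP; rewrite -leNgt => Gs.
        by rewrite normr0 add0r.
    move: ib; rewrite ge0_integralD//; last 2 first.
    - by apply/measurable_EFinP; apply: measurableT_comp => //; exact: measurable_funTS.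
    - by move=> s _; rewrite lee_fin ltW.
    have icst : (\int[leb]_(_ in ball x r) (c / 2)%:E = (c / 2 * (r *+ 2))%:E)%E.
      transitivity ((c / 2)%:E * leb (ball x r))%E; first exact: integral_cst.
      by rewrite (lebesgue_measure_ball _ (ltW r0)).
    rewrite icst => ib.
    have HLr := le_trans (integral_ball_le_HL (G \_ D) x r0)
      (lee_wpmul2l (_ : (0 <= (r *+ 2)%:E)%E) HLx).
    rewrite /iavg (lebesgue_measure_ball _ (ltW r0)) inver gt_eqF//.
    have {}HLr := HLr (ltW r20).
    apply: le_trans (lee_wpmul2l _ (le_trans ib (leeD HLr (lexx _)))) _.
      by rewrite lee_fin invr_ge0 ltW.
    change (((r *+ 2)^-1 * ((r *+ 2) * (c / 2) + c / 2 * (r *+ 2)))%:E <= c%:E)%E.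
    rewrite lee_fin -mulr_natl le_eqVlt; apply/orP; left; apply/eqP.
    by field; rewrite gt_eqF.
apply: le_trans (maximal_inequality lGD c20) _.
have -> : 3 / (c / 2) = 6 / c by field; rewrite gt_eqF.
apply: lee_wpmul2l; first by rewrite lee_fin divr_ge0// ltW.
rewrite [leRHS]integral_mkcond le_eqVlt; apply/orP; left; apply/eqP.
apply: eq_integral => s _.
rewrite !patchE; case: ifPn => _; last by rewrite abse0.
by rewrite /= ger0_norm.
Qed.

(** The power is the integral of its derivative, in the variable exp v; the levels
    are parametrised exponentially because they then range over the whole line. *)
Lemma layer_cake_ge (p : R) (M : \bar R) : 0 < p -> (0 <= M)%E ->
  (M `^ p <= \int[leb]_v ((p * expR (p * v))%:E * (((expR v)%:E < M)%E%:R)%:E))%E.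
Proof.
move=> p0.
have mint (N : \bar R) : measurable_fun setT (fun v : R =>
    ((p * expR (p * v))%:E * (((expR v)%:E < N)%E%:R)%:E)%E).
  have mS : measurable [set v : R | ((expR v)%:E < N)%E].
    rewrite -[X in measurable X]setTI; apply: measurable_lte => //.
    by apply/measurable_EFinP; exact: measurable_expR.
  apply: emeasurable_funM.
    by apply/measurable_EFinP; apply: measurable_funM => //; exact: measurable_expRM.
  apply/measurable_EFinP.
  rewrite (_ : (fun _ => _) = \1_[set v : R | ((expR v)%:E < N)%E]).
    exact: measurable_indic.
  apply/funext => v; rewrite indicE; congr ((_ : bool)%:R).
  by apply/idP/idP => [/mem_set|/set_mem].
have fin m : 0 < m -> forall N, (m%:E <= N)%E -> ((m `^ p)%:E <= \int[leb]_v ((p * expR (p * v))%:E * (((expR v)%:E < N)%E%:R)%:E))%E.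
  move=> m0 N mN.
  have -> : (m `^ p)%:E = (\int[leb]_(v in `]-oo, (ln m)[) (p * expR (p * v))%:E)%E.
    rewrite integral_itv_bndo_bndc; last first.
      apply/measurable_EFinP; apply: measurable_funTS.
      by apply: measurable_funM => //; exact: measurable_expRM.
    under eq_integral do rewrite EFinM.
    rewrite ge0_integralZl//; last 2 first.
    - by apply/measurable_EFinP; apply: measurable_funTS; exact: measurable_expRM.
    - by rewrite lee_fin ltW.
    rewrite integral_expRM_leNy// -EFinM mulrC divfK ?gt_eqF//.
    by rewrite mulrC expRM lnK.
  rewrite integral_mkcond; apply: ge0_le_integral => //.
  - by move=> v _; apply: erestrict_ge0 => ? _; rewrite lee_fin mulr_ge0 ?expR_ge0// ltW.
  - apply: measurable_patch_EFin => //.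
    by apply: measurable_funM => //; exact: measurable_expRM.
  - exact: mint.
  - move=> v _; rewrite patchE; case: ifPn => [|_].
      rewrite inE/= in_itv/= => vm.
      have -> : ((expR v)%:E < N)%E.
        by apply: lt_le_trans mN; rewrite lte_fin -[ltRHS]lnK// ltr_expR.
      by rewrite mule1.
    by rewrite mule_ge0// lee_fin mulr_ge0 ?expR_ge0// ltW.
case: M => [m| |]//.
  rewrite lee_fin le_eqVlt => /predU1P[<-|m0].
    rewrite poweR_EFin powR0 ?gt_eqF//; apply: integral_ge0 => v _.
    by rewrite mule_ge0// lee_fin mulr_ge0 ?expR_ge0// ltW.
  by rewrite poweR_EFin; exact: fin.
move=> _; rewrite poweRyr ?gt_eqF//; set I := (X in (_ <= X)%E).
suff -> : I = +oo%E by [].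
apply/eqyP => A A0; have := fin _ (powR_gt0 p^-1 A0) +oo%E (leey _).
by rewrite -powRrM mulVf ?gt_eqF// powRr1// ltW.
Qed.

End maximal_function.

Section hardy_littlewood_sobolev.
Context {R : realType}.
Notation leb := (@lebesgue_measure R).
Notation HL := (@HL_maximal R).
Implicit Types (G : R -> R).

Lemma measurable_ltr_set d (T : measurableType d) (f g : T -> R) :
  measurable_fun setT f -> measurable_fun setT g -> measurable [set x | f x < g x].
Proof.
move=> mf mg; have H := measurable_fun_ltr mf mg.
by have := H measurableT [set true] I; rewrite setTI.
Qed.

Lemma measurable_lte_set d (T : measurableType d) (f g : T -> \bar R) :
  measurable_fun setT f -> measurable_fun setT g ->
  measurable [set x | (f x < g x)%E].
Proof.
move=> mf mg; have H := measurable_fun_lte mf mg.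
by have := H measurableT [set true] I; rewrite setTI.
Qed.

Lemma measurable_lebesgue_integral2 (F : R * R -> \bar R) :
  measurable_fun setT F -> (forall z, (0 <= F z)%E) ->
  measurable_fun setT (fun y => \int[leb]_x F (x, y))%E.
Proof.
move=> mF F0; exact: (@measurable_fun_fubini_tonelli_G _ _ _ _ _ leb F mF F0).
Qed.

Lemma layer_cake_le (p m : R) : 0 < p -> 0 <= m ->
  (\int[leb]_v (p * expR (p * v) * (expR v < m)%R%:R)%:E <= (m `^ p)%:E)%E.
Proof.
move=> p0; rewrite le_eqVlt => /predU1P[<-|m0].
  rewrite powR0 ?gt_eqF// integral0_eq// => v _.
  by rewrite ltNge expR_ge0/= mulr0.
have -> : (m `^ p)%:E = (\int[leb]_(v in `]-oo, (ln m)]) (p * expR (p * v))%:E)%E.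
  under eq_integral do rewrite EFinM.
  rewrite ge0_integralZl//; last 2 first.
  - by apply/measurable_EFinP; apply: measurable_funTS; exact: measurable_expRM.
  - by rewrite lee_fin ltW.
  rewrite integral_expRM_leNy// -EFinM mulrC divfK ?gt_eqF//.
  by rewrite mulrC expRM lnK.
rewrite [leRHS]integral_mkcond; apply: ge0_le_integral => //.
- by move=> v _; rewrite lee_fin !mulr_ge0 ?expR_ge0// ltW.
- apply/measurable_EFinP; apply: measurable_funM.
    by apply: measurable_funM => //; exact: measurable_expRM.
  rewrite (_ : (fun _ => _) = \1_[set v : R | expR v < m]).
    by apply: measurable_indic; apply: measurable_ltr_set => //; exact: measurable_expR.
  apply/funext => v; rewrite indicE; congr ((_ : bool)%:R).
  by apply/idP/idP => [/mem_set|/set_mem].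
- apply: measurable_patch_EFin => //.
  by apply: measurable_funM => //; exact: measurable_expRM.
- move=> v _; rewrite patchE; case: ifPn => [_|].
    by rewrite lee_fin ler_piMr ?mulr_ge0 ?expR_ge0 ?(ltW p0)// lern1 leq_b1.
  rewrite notin_setE/= in_itv/= => /negP; rewrite -ltNge => vm.
  have -> : (expR v < m) = false.
    by apply/negbTE; rewrite -leNgt -[leLHS]lnK// ler_expR ltW.
  by rewrite mulr0.
Qed.

Definition HL_strong_const (p : R) : R := 6 * p * 2 `^ (p - 1) / (p - 1).

(** Marcinkiewicz interpolation with the trivial bound for the supremum: integrate
    the refined weak type estimate over all levels and exchange the integrals. *)
Lemma HL_strong_type (p : R) G : 1 < p -> measurable_fun setT G ->
  (forall s, 0 <= G s) -> (\int[leb]_s (G s `^ p)%:E < +oo)%E ->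
  (\int[leb]_x (HL G x `^ p) <=
   (HL_strong_const p)%:E * \int[leb]_s (G s `^ p)%:E)%E.
Proof.
move=> p1 mG G0 Gp.
have lG := locally_integrable_powR (ltW p1) mG G0 Gp.
have p0 : 0 < p by exact: lt_trans p1.
have p10 : 0 < p - 1 by rewrite subr_gt0.
have mHL := measurable_HL_maximal lG.
have mHLp : measurable_fun setT (fun x : R => (HL G x `^ p)%E).
  exact: (measurableT_comp (measurable_poweR p) mHL).
have HL0 : forall x, (0 <= HL G x)%E := HL_maximalT_ge0 lG.
have HLw : forall c, 0 < c -> (leb [set x | (c%:E < HL G x)%E] <=
    (6 / c)%:E * \int[leb]_(s in [set s | (c / 2 < G s)%R]) (G s)%:E)%E.
  by move=> c c0; exact: HL_weak_type.
move: mHL mHLp HL0 HLw; generalize (HL G) => H mHL mHLp HL0 HLw.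
pose S := [set z : R * R | ((expR z.2)%:E < H z.1)%E].
have mE2 : measurable_fun setT (fun z : R * R => (expR z.2)%:E).
  apply/measurable_EFinP; apply: (measurableT_comp (@measurable_expR R)).
  exact: measurable_snd.
have mHL1 : measurable_fun setT (fun z : R * R => H z.1).
  exact: (measurableT_comp mHL measurable_fst).
have mS : measurable S := measurable_lte_set mE2 mHL1.
pose F (z : R * R) : \bar R := ((p * expR (p * z.2)) * \1_S z)%:E.
have mF : measurable_fun setT F.
  apply/measurable_EFinP; apply: measurable_funM; last exact: measurable_indic.
  apply: measurable_funM => //; apply: (measurableT_comp (measurable_expRM p)).
  exact: measurable_snd.
have F0 z : (0 <= F z)%E by rewrite lee_fin !mulr_ge0 ?expR_ge0// ltW.
have step1 : (\int[leb]_x (H x `^ p) <= \int[leb]_x \int[leb]_v F (x, v))%E.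
  apply: ge0_le_integral => //.
  - by move=> x _; exact: poweR_ge0.
  - exact: (measurable_lebesgue_integral mF F0).
  - move=> x _; apply: le_trans (layer_cake_ge p0 (HL0 x)) _.
    rewrite le_eqVlt; apply/orP; left; apply/eqP; apply: eq_integral => v _.
    rewrite /F -EFinM indicE; congr ((_ * (_ : bool)%:R)%:E).
    by apply/idP/idP => [/mem_set|/set_mem].
apply: (le_trans step1); rewrite lebesgue_tonelli//.
pose S2 := [set z : R * R | expR z.1 < 2 * G z.2].
have mS2 : measurable S2.
  apply: measurable_ltr_set.
    apply: measurableT_comp => //; exact: measurable_expR.
  by apply: measurable_funM => //; exact: measurableT_comp.
pose F2 (z : R * R) : \bar R := (6 * p * expR ((p - 1) * z.1) * G z.2 * \1_S2 z)%:E.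
have mF2 : measurable_fun setT F2.
  apply/measurable_EFinP; apply: measurable_funM; last exact: measurable_indic.
  apply: measurable_funM; last exact: measurableT_comp.
  apply: measurable_funM => //; apply: (measurableT_comp (measurable_expRM _)).
  exact: measurable_fst.
have F20 z : (0 <= F2 z)%E.
  by rewrite lee_fin; apply: mulr_ge0 => //; apply: mulr_ge0 => //; rewrite !mulr_ge0 ?expR_ge0// ltW.
have step2 : (\int[leb]_v \int[leb]_x F (x, v) <= \int[leb]_v \int[leb]_s F2 (v, s))%E.
  apply: ge0_le_integral => //.
  - by move=> v _; apply: integral_ge0.
  - exact: (measurable_lebesgue_integral2 mF F0).
  - exact: (measurable_lebesgue_integral mF2 F20).
  - move=> v _; rewrite /F /=.
    have mv : measurable [set x | ((expR v)%:E < H x)%E].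
      exact: (measurable_lte_set (measurable_cst (expR v)%:E) mHL).
    pose B := [set x : R | ((expR v)%:E < H x)%E].
    pose iB : R -> R := \1_B.
    have mB : measurable_fun setT (fun x : R => (iB x)%:E).
      by apply/measurable_EFinP; exact: measurable_indic mv.
    have -> : (\int[leb]_x (p * expR (p * v) * \1_S (x, v))%:E =
        (p * expR (p * v))%:E * leb B)%E.
      transitivity (\int[leb]_x ((p * expR (p * v))%:E * (iB x)%:E))%E.
        have e x : \1_S (x, v) = iB x.
          by rewrite /iB !indicE; congr ((_ : bool)%:R).
        by apply: eq_integral => x _; rewrite e EFinM.
      rewrite ge0_integralZl//; last 2 first.
      - by move=> x _; rewrite lee_fin /iB indicE ler0n.
      - by rewrite lee_fin mulr_ge0 ?expR_ge0// ltW.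
      by congr (_ * _)%E; rewrite integral_indic// setIT.
    apply: le_trans (lee_wpmul2l _ (HLw _ (expR_gt0 v))) _.
      by rewrite lee_fin mulr_ge0 ?expR_ge0// ltW.
    have mv2 : measurable [set s | expR v / 2 < G s] by exact: measurable_superlevel.
    rewrite integral_mkcond muleA -EFinM -ge0_integralZl//; last 3 first.
    - by apply: measurable_patch => //; exact/measurable_EFinP.
    - by move=> s _; apply: erestrict_ge0 => ? _; rewrite lee_fin.
    - by rewrite lee_fin !mulr_ge0 ?invr_ge0 ?expR_ge0// ltW.
    rewrite le_eqVlt; apply/orP; left; apply/eqP; apply: eq_integral => s _.
    rewrite /F2 indicE patchE /=.
    have -> : ((v, s) \in S2) = (s \in [set s | expR v / 2 < G s]).
      apply/idP/idP => /set_mem h; apply/mem_set; move: h => /=;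
        by rewrite ltr_pdivrMr// mulrC.
    case: ifPn => _; last by rewrite mule0 mulr0.
    rewrite mulr1 -EFinM; congr (_ * _)%:E; rewrite mulrBl mul1r expRD expRN.
    by field; rewrite gt_eqF// expR_gt0.
apply: (le_trans step2); rewrite lebesgue_tonelli//.
rewrite -ge0_integralZl//; last 3 first.
- by apply/measurable_EFinP; exact: (measurableT_comp (measurable_powR p)).
- by move=> s _; rewrite lee_fin powR_ge0.
- by rewrite lee_fin /HL_strong_const !mulr_ge0 ?powR_ge0 ?invr_ge0 ?(ltW p10) ?(ltW p0).
apply: ge0_le_integral => //.
- by move=> s _; apply: integral_ge0.
- exact: (measurable_lebesgue_integral2 mF2 F20).
- apply: emeasurable_funM => //; apply/measurable_EFinP.
  exact: (measurableT_comp (measurable_powR p)).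
move=> s _; rewrite /F2 /=.
pose c := 6 * p / (p - 1) * G s.
have c0 : 0 <= c by rewrite /c !mulr_ge0 ?invr_ge0// ltW.
apply: (@le_trans _ _ (\int[leb]_v (c%:E * ((p - 1) * expR ((p - 1) * v) *
    (expR v < 2 * G s)%R%:R)%:E))%E).
  rewrite le_eqVlt; apply/orP; left; apply/eqP; apply: eq_integral => v _.
  rewrite indicE -EFinM.
  have -> : ((v, s) \in S2) = (expR v < 2 * G s).
    by apply/idP/idP => [/set_mem|h]; last exact/mem_set.
  by rewrite /c; congr EFin; field; rewrite gt_eqF.
rewrite ge0_integralZl//; last 2 first.
- apply/measurable_EFinP; apply: measurable_funM.
    by apply: measurable_funM => //; exact: measurable_expRM.
  rewrite (_ : (fun _ => _) = \1_[set v : R | expR v < 2 * G s]).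
    by apply: measurable_indic; apply: measurable_ltr_set => //; exact: measurable_expR.
  apply/funext => v; rewrite indicE; congr ((_ : bool)%:R).
  by apply/idP/idP => [/mem_set|/set_mem].
- by move=> v _; rewrite lee_fin !mulr_ge0 ?expR_ge0// ltW.
have G20 : 0 <= 2 * G s by rewrite mulr_ge0.
apply: le_trans (lee_wpmul2l _ (layer_cake_le p10 G20)) _; first by rewrite lee_fin.
rewrite -!EFinM lee_fin /c /HL_strong_const powRM// le_eqVlt; apply/orP; left.
apply/eqP; have [->|Gs0] := eqVneq (G s) 0.
  by rewrite mulr0 mul0r powR0 ?mulr0// gt_eqF.
have Gp' : 0 < G s by rewrite lt0r Gs0 G0.
have -> : G s `^ p = G s * G s `^ (p - 1).
  by rewrite -[X in X * _]powRr1// -powRD ?(gt_eqF Gp') ?implybT//; congr powR; ring.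
by field; rewrite gt_eqF.
Qed.

End hardy_littlewood_sobolev.

(** * The Hardy-Littlewood-Sobolev inequality *)

Section hedberg.
Context {R : realType}.
Notation leb := (@lebesgue_measure R).
Notation HL := (@HL_maximal R).
Implicit Types (G : R -> R).

Lemma measurable_ler_nat d (T : measurableType d) (f g : T -> R) :
  measurable_fun setT f -> measurable_fun setT g ->
  measurable_fun setT (fun x => (f x <= g x)%R%:R : R).
Proof.
move=> mf mg; have mS : measurable [set x | f x <= g x].
  have H := measurable_fun_ler mf mg.
  by have := H measurableT [set true] I; rewrite setTI.
rewrite (_ : (fun _ => _) = \1_[set x | f x <= g x]); first exact: measurable_indic.
apply/funext => x; rewrite indicE; congr ((_ : bool)%:R).
by apply/idP/idP => [h|/set_mem//]; exact/mem_set.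
Qed.

(** A negative power is a superposition of indicators of centred balls. *)
Lemma powRN_layer (m u : R) : 0 < m ->
  ((`|u| `^ (- m))%:E <=
   \int[leb]_v (m * expR (- (m * v)) * (`|u| <= expR v)%R%:R)%:E)%E.
Proof.
move=> m0; have [->|u0] := eqVneq u 0.
  rewrite normr0 powR0 ?oppr_eq0 ?gt_eqF//; apply: integral_ge0 => v _.
  by rewrite lee_fin !mulr_ge0 ?expR_ge0// ltW.
have v0 : 0 < `|u| by rewrite normr_gt0.
have mE : measurable_fun setT (fun v : R => expR (- (m * v))).
  by under eq_fun do rewrite -mulNr; exact: measurable_expRM.
have -> : (`|u| `^ (- m))%:E = (\int[leb]_(v in `[(ln `|u|), +oo[) (m * expR (- (m * v)))%:E)%E.
  under eq_integral do rewrite EFinM.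
  rewrite ge0_integralZl//; last 2 first.
  - by apply/measurable_EFinP; apply: measurable_funTS.
  - by rewrite lee_fin ltW.
  rewrite integral_expRM_gey// -EFinM mulrC divfK ?gt_eqF//.
  by rewrite -mulNr mulrC expRM lnK.
rewrite integral_mkcond; apply: ge0_le_integral => //.
- by move=> v _; apply: erestrict_ge0 => ? _; rewrite lee_fin mulr_ge0 ?expR_ge0// ltW.
- by apply: measurable_patch_EFin => //; exact: measurable_funM.
- apply/measurable_EFinP; apply: measurable_funM; first exact: measurable_funM.
  by apply: measurable_ler_nat => //; exact: measurable_expR.
- move=> v _; rewrite patchE; case: ifPn => [|_].
    rewrite inE/= in_itv/= andbT => vm.
    have -> : `|u| <= expR v by rewrite -[leLHS]lnK// ler_expR.
    by rewrite mulr1.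
  by rewrite lee_fin !mulr_ge0 ?expR_ge0// ltW.
Qed.

Definition window_integral G (t v : R) : \bar R :=
  (\int[leb]_s (G s * (`|t - s| <= expR v)%R%:R)%:E)%E.

Section fixed_function.
Variables (p : R) (G : R -> R).
Hypothesis p1 : 1 < p.
Hypothesis mG : measurable_fun setT G.
Hypothesis G0 : forall s, 0 <= G s.
Hypothesis Gp : (\int[leb]_s (G s `^ p)%:E <= 1)%E.

Lemma measurable_window t v : measurable_fun setT (fun s : R =>
  (`|t - s| <= expR v)%R%:R : R).
Proof.
apply: measurable_ler_nat => //; apply: measurableT_comp => //.
exact: measurable_funB.
Qed.

Lemma window_integral_le_HL t v :
  (window_integral G t v <= (4 * expR v)%:E * HL G t)%E.
Proof.
have r0 : 0 < 2 * expR v by rewrite mulr_gt0// expR_gt0.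
have -> : 4 * expR v = (2 * expR v) *+ 2 by rewrite -mulr_natl; ring.
apply: le_trans (integral_ball_le_HL G t r0).
rewrite /window_integral [leRHS]integral_mkcond.
apply: ge0_le_integral => //.
- by move=> s _; rewrite lee_fin mulr_ge0.
- by apply/measurable_EFinP; apply: measurable_funM => //; exact: measurable_window.
- apply: measurable_patch; first exact: measurable_ball.
  by apply: measurableT_comp => //; exact/measurable_EFinP.
- move=> s _; rewrite patchE; case: (leP `|t - s| (expR v)) => ts; last first.
    by rewrite mulr0; case: ifPn => // _; rewrite abse_ge0.
  rewrite mem_set; first by rewrite mulr1 lee_fin ler_norm.
  rewrite /ball/=; apply: le_lt_trans ts _; have := expR_gt0 v; lra.
Qed.

Lemma window_measure (t v : R) :
  (\int[leb]_s ((`|t - s| <= expR v)%R%:R)%:E = (2 * expR v)%:E)%E.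
Proof.
transitivity (leb `[(t - expR v), (t + expR v)]).
  rewrite -[RHS]mul1e -[RHS]integral_cst// [RHS]integral_mkcond.
  apply: eq_integral => s _; rewrite patchE.
  have -> : (s \in `[(t - expR v)%R, (t + expR v)%R]%classic) = (`|t - s| <= expR v).
    rewrite distrC ler_distl; apply/idP/idP => [/set_mem/=|h]; rewrite ?in_itv//.
    by apply/mem_set; rewrite /= in_itv.
  by case: ifPn.
rewrite lebesgue_measure_itv/= lte_fin; have e0 := expR_gt0 v.
by rewrite ifT; [rewrite -EFinB; congr EFin; ring|lra].
Qed.

(** Hoelder's inequality against an indicator, in the form of the inequality
    between weighted means. *)
Lemma window_integral_le_Lp t v :
  (window_integral G t v <= (2 * expR ((1 - p^-1) * v))%:E)%E.
Proof.
have p0 : 0 < p by exact: lt_trans p1.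
have ip0 : 0 < p^-1 by rewrite invr_gt0.
have ip1 : p^-1 < 1 by rewrite invf_lt1.
set a := 1 - p^-1; have a0 : 0 < a by rewrite subr_gt0.
have mGp : measurable_fun setT (fun s => G s `^ p).
  exact: (measurableT_comp (measurable_powR p)).
have mw := measurable_window t v.
set c := expR (a * v); have c0 : 0 < c by rewrite expR_gt0.
apply: (@le_trans _ _ (\int[leb]_s ((c * p^-1 * G s `^ p)%:E +
   (c * a * expR (- v) * (`|t - s| <= expR v)%R%:R)%:E))%E).
  apply: ge0_le_integral => //.
  - by move=> s _; rewrite lee_fin mulr_ge0.
  - by apply/measurable_EFinP; exact: measurable_funM.
  - by apply: emeasurable_funD; apply/measurable_EFinP; exact: measurable_funM.
  move=> s _; rewrite -EFinD lee_fin; case: (leP `|t - s| (expR v)) => _; last first.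
    by rewrite !mulr0 addr0 !mulr_ge0 ?powR_ge0// ltW.
  rewrite !mulr1.
  have := @powR_mean2_le R (G s `^ p) (expR (- v)) p^-1 a.
  rewrite powR_ge0 expR_ge0 (ltW ip0) (ltW a0) => /(_ isT isT isT isT).
  have -> : p^-1 + a = 1 by rewrite /a; ring.
  move=> /(_ erefl); rewrite -powRrM divff ?gt_eqF// powRr1// -expRM.
  have -> : expR (- v * a) = c^-1 by rewrite /c -expRN; congr expR; ring.
  by rewrite ler_pdivrMr//; lra.
rewrite ge0_integralD//; last 4 first.
- by move=> s _; rewrite lee_fin !mulr_ge0 ?powR_ge0// ltW.
- by apply/measurable_EFinP; exact: measurable_funM.
- by move=> s _; rewrite lee_fin !mulr_ge0 ?expR_ge0// ltW.
- by apply/measurable_EFinP; exact: measurable_funM.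
under eq_integral do rewrite EFinM.
under [X in (_ + X)%E]eq_integral do rewrite EFinM.
rewrite ge0_integralZl//; last 3 first.
- exact/measurable_EFinP.
- by move=> s _; rewrite lee_fin powR_ge0.
- by rewrite lee_fin mulr_ge0// ltW.
rewrite ge0_integralZl//; last 2 first.
- exact/measurable_EFinP.
- by rewrite lee_fin !mulr_ge0 ?expR_ge0// ltW.
rewrite window_measure.
apply: le_trans (leeD (lee_wpmul2l _ Gp) (lexx _)) _.
  by rewrite lee_fin mulr_ge0// ltW.
change ((c * p^-1 * 1 + c * a * expR (- v) * (2 * expR v))%:E <= (2 * c)%:E)%E.
rewrite lee_fin expRN.
have -> : c * a * (expR v)^-1 * (2 * expR v) = 2 * c * a.
  by field; rewrite gt_eqF// expR_gt0.
rewrite /a; nra.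
Qed.

End fixed_function.
End hedberg.

Section riesz_potential.
Context {R : realType}.
Notation leb := (@lebesgue_measure R).
Notation HL := (@HL_maximal R).
Variables (p q sg : R) (G : R -> R).
Hypothesis p1 : 1 < p.
Hypothesis q0 : 0 < q.
Hypothesis sg0 : 0 < sg.
Hypothesis sg1 : sg < 1 / 2.
Hypothesis pq : q^-1 = p^-1 - 2 * sg.
Hypothesis mG : measurable_fun setT G.
Hypothesis G0 : forall s, 0 <= G s.
Hypothesis Gp : (\int[leb]_s (G s `^ p)%:E <= 1)%E.

Let m := 1 - 2 * sg.
Let m0 : 0 < m. Proof. by rewrite /m; have := sg1; lra. Qed.

Let riesz (u : R) := `|u| `^ (2 * sg - 1).

Lemma measurable_riesz : measurable_fun setT riesz.
Proof.
exact: (measurableT_comp (measurable_powR (2 * sg - 1)) (@normr_measurable R setT)).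
Qed.

(** Layer cake for the kernel, and Tonelli. *)
Lemma riesz_le_window t : (convol riesz G t <=
  \int[leb]_v ((m * expR (- (m * v)))%:E * window_integral G t v))%E.
Proof.
have mE : measurable_fun setT (fun v : R => expR (- (m * v))).
  by under eq_fun do rewrite -mulNr; exact: measurable_expRM.
pose F (z : R * R) := (m * expR (- (m * z.2)) * (`|t - z.1| <= expR z.2)%R%:R * G z.1)%:E.
have F0 z : (0 <= F z)%E by rewrite lee_fin !mulr_ge0 ?expR_ge0// ltW.
have mF : measurable_fun setT F.
  apply/measurable_EFinP; apply: measurable_funM; last exact: measurableT_comp.
  apply: measurable_funM.
    by apply: measurable_funM => //; apply: (measurableT_comp mE).
  apply: measurable_ler_nat; last exact: measurableT_comp.
  by apply: measurableT_comp => //; exact: measurable_funB.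
have -> : (\int[leb]_v ((m * expR (- (m * v)))%:E * window_integral G t v) =
           \int[leb]_v \int[leb]_s F (s, v))%E.
  apply: eq_integral => v _; rewrite /window_integral -ge0_integralZl//; last 3 first.
  - by apply/measurable_EFinP; apply: measurable_funM => //; exact: measurable_window.
  - by move=> s _; rewrite lee_fin mulr_ge0.
  - by rewrite lee_fin mulr_ge0 ?expR_ge0// ltW.
  by apply: eq_integral => s _; rewrite -EFinM /F/=; congr EFin; ring.
rewrite -lebesgue_tonelli//; apply: ge0_le_integral => //.
- by move=> s _; rewrite lee_fin mulr_ge0// powR_ge0.
- apply/measurable_EFinP; apply: measurable_funM => //.
  exact: (measurable_reflect _ measurable_riesz).
- exact: measurable_lebesgue_integral.
- move=> s _; rewrite EFinM.
  have -> : (\int[leb]_y F (s, y) = (\int[leb]_v (m * expR (- (m * v)) *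
      (`|t - s| <= expR v)%R%:R)%:E) * (G s)%:E)%E.
    rewrite -ge0_integralZr//; last 3 first.
    - apply/measurable_EFinP; apply: measurable_funM; first exact: measurable_funM.
      by apply: measurable_ler_nat => //; exact: measurable_expR.
    - by move=> v _; rewrite lee_fin !mulr_ge0 ?expR_ge0// ltW.
    - by rewrite lee_fin.
  apply: lee_wpmul2r; first by rewrite lee_fin.
  have -> : riesz (t - s) = `|t - s| `^ (- m) by rewrite /riesz /m; congr powR; ring.
  exact: powRN_layer.
Qed.

(** Windows of radius at most exp L are controlled by the maximal function, larger
    ones by the L^p norm of G. *)
Lemma riesz_le_maximal t M L : 0 <= M -> HL G t = M%:E ->
  (convol riesz G t <=
   (2 * m / sg * M * expR (2 * sg * L) + 2 * m * q * expR (- (q^-1 * L)))%:E)%E.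
Proof.
move=> M0 HM; apply: le_trans (riesz_le_window t) _.
have iq0 : 0 < q^-1 by rewrite invr_gt0.
have mA := @measurable_expRM R (2 * sg).
have mB : measurable_fun setT (fun v : R => expR (- (q^-1 * v))).
  by under eq_fun do rewrite -mulNr; exact: measurable_expRM.
pose A : R -> \bar R := (fun v => (4 * m * M)%:E * ((EFin \o (fun v => expR (2 * sg * v))) \_ `]-oo, L]) v)%E.
pose B : R -> \bar R := (fun v => (2 * m)%:E * ((EFin \o (fun v => expR (- (q^-1 * v)))) \_ `[L, +oo[) v)%E.
have cA : 0 <= 4 * m * M by rewrite !mulr_ge0// ltW.
have cB : 0 <= 2 * m by rewrite mulr_ge0// ltW.
have pA0 v : (0 <= ((EFin \o (fun v => expR (2 * sg * v))) \_ `]-oo, L]) v)%E.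
  by apply: erestrict_ge0 => ? _; rewrite lee_fin expR_ge0.
have pB0 v : (0 <= ((EFin \o (fun v => expR (- (q^-1 * v)))) \_ `[L, +oo[) v)%E.
  by apply: erestrict_ge0 => ? _; rewrite lee_fin expR_ge0.
have mpA : measurable_fun setT ((EFin \o (fun v => expR (2 * sg * v))) \_ `]-oo, L]).
  exact: measurable_patch_EFin.
have mpB : measurable_fun setT ((EFin \o (fun v => expR (- (q^-1 * v)))) \_ `[L, +oo[).
  exact: measurable_patch_EFin.
have A0 v : (0 <= A v)%E by apply: mule_ge0; rewrite ?lee_fin.
have B0 v : (0 <= B v)%E by apply: mule_ge0; rewrite ?lee_fin.
have mAA : measurable_fun setT A by exact: emeasurable_funM.
have mBB : measurable_fun setT B by exact: emeasurable_funM.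
apply: (@le_trans _ _ (\int[leb]_v (A v + B v))%E).
  apply: ge0_le_integral => //.
  - move=> v _; apply: mule_ge0; first by rewrite lee_fin mulr_ge0 ?expR_ge0// ltW.
    by apply: integral_ge0 => s _; rewrite lee_fin mulr_ge0.
  - apply: emeasurable_funM.
      apply/measurable_EFinP; apply: measurable_funM => //.
      by under eq_fun do rewrite -mulNr; exact: measurable_expRM.
    apply: (@measurable_lebesgue_integral R (fun z => (G z.2 * (`|t - z.2| <= expR z.1)%R%:R)%:E)).
      apply/measurable_EFinP; apply: measurable_funM; first exact: measurableT_comp.
      apply: measurable_ler_nat; last exact: measurableT_comp.
      by apply: measurableT_comp => //; exact: measurable_funB.
    by move=> z; rewrite lee_fin mulr_ge0.
  - exact: emeasurable_funD.
  move=> v _; have [vL|vL] := leP v L.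
  - apply: le_trans (leeDl _ (B0 v)); rewrite /A patchE mem_set/= ?in_itv//.
    apply: le_trans (lee_wpmul2l _ (window_integral_le_HL mG G0 t v)) _.
      by rewrite lee_fin mulr_ge0 ?expR_ge0// ltW.
    rewrite HM; change ((m * expR (- (m * v)) * (4 * expR v * M))%:E <=
                        (4 * m * M * expR (2 * sg * v))%:E)%E.
    have -> : 2 * sg * v = - (m * v) + v by rewrite /m; ring.
    by rewrite lee_fin expRD le_eqVlt; apply/orP; left; apply/eqP; ring.
  - apply: le_trans (leeDr _ (A0 v)); rewrite /B patchE mem_set/= ?in_itv/= ?(ltW vL)//.
    apply: le_trans (lee_wpmul2l _ (window_integral_le_Lp p1 mG G0 Gp t v)) _.
      by rewrite lee_fin mulr_ge0 ?expR_ge0// ltW.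
    change ((m * expR (- (m * v)) * (2 * expR ((1 - p^-1) * v)))%:E <=
            (2 * m * expR (- (q^-1 * v)))%:E)%E.
    have -> : - (q^-1 * v) = - (m * v) + (1 - p^-1) * v by rewrite pq /m; ring.
    by rewrite lee_fin expRD le_eqVlt; apply/orP; left; apply/eqP; ring.
rewrite ge0_integralD// ge0_integralZl//.
rewrite ge0_integralZl//.
rewrite -!integral_mkcond integral_expRM_leNy ?mulr_gt0//.
rewrite integral_expRM_gey//.
change ((4 * m * M * (expR (2 * sg * L) / (2 * sg)) +
         2 * m * (expR (- (q^-1 * L)) / q^-1))%:E <=
  (2 * m / sg * M * expR (2 * sg * L) + 2 * m * q * expR (- (q^-1 * L)))%:E)%E.
rewrite lee_fin invrK le_eqVlt; apply/orP; left; apply/eqP.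
by field; rewrite gt_eqF.
Qed.

(** Optimise the previous bound over L. *)
Lemma hedberg t : (convol riesz G t `^ q <=
  ((2 * m / sg + 2 * m * q) `^ q)%:E * HL G t `^ p)%E.
Proof.
have riesz0 u : 0 <= riesz u by exact: powR_ge0.
have C0 := convol_ge0 riesz0 G0 t.
have a0 : 0 < 2 * m / sg by rewrite divr_gt0// mulr_gt0.
have b0 : 0 < 2 * m * q by rewrite !mulr_gt0.
have ab0 := addr_gt0 a0 b0.
have p0 : 0 < p by exact: lt_trans p1.
have HL0 : (0 <= HL G t)%E.
  by apply: le_trans (iavg_le_HL G t (@ltr01 R)); exact: iavg_ge0.
case HM : (HL G t) => [M| |]; last by rewrite HM in HL0.
  rewrite HM lee_fin in HL0.
  move: HL0; rewrite le_eqVlt => /predU1P[M0|M0].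
    suff -> : convol riesz G t = 0%E.
      by rewrite poweR0r ?gt_eqF// mule_ge0 ?poweR_ge0// lee_fin powR_ge0.
    apply/eqP; rewrite eq_le C0 andbT; apply/lee_addgt0Pr => e e0.
    (* the maximal function vanishes: L may tend to infinity *)
    have := @riesz_le_maximal t 0 (- q * ln (e / (2 * m * q))) (lexx _).
    rewrite HM -M0 => /(_ erefl); rewrite mulr0 mul0r add0r.
    have -> : - (q^-1 * (- q * ln (e / (2 * m * q)))) = ln (e / (2 * m * q)).
      by field; rewrite gt_eqF.
    by rewrite lnK ?posrE ?divr_gt0// mulrC divfK ?gt_eqF// add0e.
  (* this L balances the two terms, both being M^(p/q) *)
  have := @riesz_le_maximal t M (- p * ln M) (ltW M0) HM.
  have E1 : M * expR (2 * sg * (- p * ln M)) = M `^ (p / q).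
    rewrite -{1}[M]lnK ?posrE// -expRD /powR gt_eqF//; congr expR.
    by rewrite pq; field; rewrite gt_eqF.
  have E2 : expR (- (q^-1 * (- p * ln M))) = M `^ (p / q).
    by rewrite /powR gt_eqF//; congr expR; ring.
  rewrite -mulrA E1 E2 -mulrDl => H.
  apply: (@le_trans _ _ (((2 * m / sg + 2 * m * q) * M `^ (p / q))%:E `^ q)%E).
    apply: gt0_ler_poweR; rewrite ?(ltW q0)// in_itv/= ?leey ?andbT//.
    rewrite lee_fin mulr_ge0 ?powR_ge0// ltW//.
  rewrite !poweR_EFin powRM ?powR_ge0 ?(ltW ab0)// -powRrM divfK ?gt_eqF//.
rewrite poweRyr ?gt_eqF// gt0_muley ?leey// lte_fin powR_gt0//.
Qed.

Definition hls_const := (2 * m / sg + 2 * m * q) `^ q * HL_strong_const p.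

Lemma hardy_littlewood_sobolev :
  (\int[leb]_t (convol riesz G t `^ q) <= hls_const%:E)%E.
Proof.
have p0 : 0 < p by exact: lt_trans p1.
have riesz0 u : 0 <= riesz u by exact: powR_ge0.
have mHL : measurable_fun setT (HL G : R -> \bar R).
  apply: measurable_HL_maximal; apply: (locally_integrable_powR (ltW p1)) => //.
  exact: le_lt_trans Gp (ltry _).
have mHLp : measurable_fun setT (fun t => HL G t `^ p)%E.
  exact: (measurableT_comp (measurable_poweR _)).
apply: (@le_trans _ _ (\int[leb]_t (((2 * m / sg + 2 * m * q) `^ q)%:E * HL G t `^ p))%E).
  apply: ge0_le_integral => //.
  - by move=> t _; exact: poweR_ge0.
  - apply: (measurableT_comp (measurable_poweR _)); apply: measurable_convol => //.
    exact: measurable_riesz.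
  - exact: emeasurable_funM.
  - by move=> t _; exact: hedberg.
rewrite ge0_integralZl//; last 2 first.
- by move=> t _; exact: poweR_ge0.
- by rewrite lee_fin powR_ge0.
rewrite /hls_const EFinM; apply: lee_wpmul2l; first by rewrite lee_fin powR_ge0.
apply: le_trans (HL_strong_type p1 mG G0 (le_lt_trans Gp (ltry _))) _.
rewrite -[leRHS]mule1; apply: lee_wpmul2l => //.
rewrite lee_fin /HL_strong_const divr_ge0 ?subr_ge0 ?(ltW p1)//.
by rewrite !mulr_ge0 ?powR_ge0// ltW.
Qed.
End riesz_potential.

(** * Tilted kernels on the line *)

Section singular_kernels.
Context {R : realType}.
Notation leb := (@lebesgue_measure R).
Implicit Types (a e t r u x y : R).

(** The even extension of the integrand of Gamma at a. *)
Definition gamma_kernel a u : R := `|u| `^ (a - 1) * expR (- `|u|).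

Lemma gamma_kernel_ge0 a u : 0 <= gamma_kernel a u.
Proof. by rewrite mulr_ge0 ?powR_ge0 ?expR_ge0. Qed.

Lemma measurable_normr_powR a : measurable_fun setT (fun u : R => `|u| `^ a).
Proof. exact: (measurableT_comp (measurable_powR a) (@normr_measurable R setT)). Qed.

Lemma measurable_gamma_kernel a : measurable_fun setT (gamma_kernel a).
Proof.
apply: measurable_funM; first exact: measurable_normr_powR.
have := @measurable_expRNabs R 1; by under eq_fun do rewrite mul1r.
Qed.

Lemma integral_gamma_kernel_le a : 0 < a < 1 ->
  (\int[leb]_u (gamma_kernel a u)%:E <= (2 * Gamma_fun a)%:E)%E.
Proof.
move=> /andP[a0 a1].
pose g : R -> \bar R := (EFin \o gamma_kernel a) \_ `]0, +oo[.
have mg : measurable_fun setT g.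
  exact: measurable_patch_EFin (measurable_itv _) (measurable_gamma_kernel a).
have g0 u : (0 <= g u)%E.
  by apply: erestrict_ge0 => ? _; rewrite lee_fin gamma_kernel_ge0.
have mgN : measurable_fun setT (fun u => g (- u)).
  by apply: (measurableT_comp mg); exact: oppr_measurable.
have gE : (\int[leb]_u g u = (Gamma_fun a)%:E)%E.
  rewrite -integral_mkcond EFin_Gamma_fun// -integral_gamma_ln.
  apply: eq_integral => u /[!inE]/=; rewrite in_itv/= andbT => u0.
  by rewrite /gamma_kernel gtr0_norm.
apply: (@le_trans _ _ (\int[leb]_u (g u + g (- u)%R))%E).
  apply: ge0_le_integral => //.
  - by move=> u _; rewrite lee_fin gamma_kernel_ge0.
  - by apply/measurable_EFinP; exact: measurable_gamma_kernel.
  - exact: emeasurable_funD.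
  move=> u _; have [u0|u0|->] := ltgtP u 0.
  - apply: le_trans (leeDr _ (g0 u)).
    by rewrite /g patchE mem_set/= ?in_itv/= ?andbT ?oppr_gt0// /gamma_kernel normrN.
  - apply: le_trans (leeDl _ (g0 _)).
    by rewrite /g patchE mem_set/= ?in_itv/= ?andbT.
  - rewrite /gamma_kernel normr0 powR0 ?subr_eq0 ?lt_eqF// mul0r.
    exact: adde_ge0.
rewrite ge0_integralD// ge0_integralN// gE -EFinD lee_fin; lra.
Qed.

(** Near the origin the exponential factor is comparable to 1, away from it the
    singular factor is at most 1. *)
Lemma expRN_powR_le a e u : a <= 1 -> 0 <= e ->
  expR (- (e * `|u|)) * `|u| `^ (a - 1) <=
  expR 1 * gamma_kernel a u + expR (- (e * `|u|)).
Proof.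
move=> a1 e0; have [u1|u1] := leP `|u| 1.
  apply: ler_wpDr; first exact: expR_ge0.
  rewrite /gamma_kernel [leRHS]mulrCA mulrC ler_wpM2l ?powR_ge0//.
  rewrite -expRD ler_expR; have : 0 <= e * `|u| by rewrite mulr_ge0.
  lra.
apply: ler_wpDl; first by rewrite mulr_ge0 ?expR_ge0 ?gamma_kernel_ge0.
rewrite ler_piMr ?expR_ge0//.
have -> : a - 1 = - (1 - a) by rewrite opprB.
have := @powRN_anti R 1 `|u| (1 - a); rewrite powR1; apply; rewrite ?ltr01 ?(ltW u1) ?subr_ge0//.
Qed.

Lemma powR_add1_le x r : 0 <= x -> 0 <= r ->
  (1 + x) `^ r <= 2 `^ r * (1 + x `^ r).
Proof.
move=> x0 r0; have [x1|x1] := leP x 1.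
  apply: (@le_trans _ _ (2 `^ r)).
    by rewrite ge0_ler_powR ?nnegrE; lra.
  by rewrite ler_peMr ?powR_ge0// lerDl powR_ge0.
apply: (@le_trans _ _ ((2 * x) `^ r)).
  by rewrite ge0_ler_powR ?nnegrE; lra.
by rewrite powRM// ler_wpM2l ?powR_ge0// lerDr.
Qed.

(** The majorant of the tilted kernels. *)
Definition tempered_kernel e t u : R := expR (- (e * `|u|)) * (1 + `|u| `^ (2 * t - 1)).

Lemma tempered_kernel_ge0 e t u : 0 <= tempered_kernel e t u.
Proof. by rewrite mulr_ge0 ?expR_ge0// addr_ge0 ?powR_ge0. Qed.

Lemma measurable_tempered_kernel e t : measurable_fun setT (tempered_kernel e t).
Proof.
apply: measurable_funM; first exact: measurable_expRNabs.
by apply: measurable_funD => //; exact: measurable_normr_powR.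
Qed.

Lemma tempered_kernel_powR_lty e t r : 0 < e -> t < 1 / 2 -> 0 < r ->
  (1 - 2 * t) * r < 1 ->
  exists A : R, (\int[leb]_u (tempered_kernel e t u `^ r)%:E <= A%:E)%E.
Proof.
move=> e0 t1 r0 tr; set a := 1 - (1 - 2 * t) * r.
have a01 : 0 < a < 1 by rewrite /a; nra.
have er0 : 0 < e * r by rewrite mulr_gt0.
set B := 2 `^ r; have B0 : 0 <= B by exact: powR_ge0.
have c1 : 0 <= B * expR 1 by rewrite mulr_ge0 ?expR_ge0.
have c2 : 0 <= B * 2 by rewrite mulr_ge0.
have mE := @measurable_expRNabs R (e * r).
have mGa := measurable_gamma_kernel a.
exists (B * expR 1 * (2 * Gamma_fun a) + B * 2 * (2 / (e * r))).
apply: (@le_trans _ _ (\int[leb]_u ((B * expR 1 * gamma_kernel a u)%:E +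
    (B * 2 * expR (- (e * r * `|u|)))%:E))%E).
  apply: ge0_le_integral => //.
  - by move=> u _; rewrite lee_fin powR_ge0.
  - apply/measurable_EFinP; apply: (measurableT_comp (measurable_powR r)).
    exact: measurable_tempered_kernel.
  - by apply: emeasurable_funD; apply/measurable_EFinP; exact: measurable_funM.
  move=> u _; rewrite -EFinD lee_fin /tempered_kernel.
  rewrite powRM ?expR_ge0 ?addr_ge0 ?powR_ge0// -expRM.
  have -> : - (e * `|u|) * r = - (e * r * `|u|) by ring.
  apply: le_trans (ler_wpM2l (expR_ge0 _) (powR_add1_le (powR_ge0 _ _) (ltW r0))) _.
  rewrite -powRrM -/B; have -> : (2 * t - 1) * r = a - 1 by rewrite /a; ring.
  have := @expRN_powR_le a (e * r) u.
  have [_ /ltW a1] := andP a01; move=> /(_ a1 (ltW er0)); nra.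
rewrite ge0_integralD//; last 4 first.
- by move=> u _; rewrite lee_fin mulr_ge0// gamma_kernel_ge0.
- by apply/measurable_EFinP; exact: measurable_funM.
- by move=> u _; rewrite lee_fin mulr_ge0// expR_ge0.
- by apply/measurable_EFinP; exact: measurable_funM.
under eq_integral do rewrite EFinM.
under [X in (_ + X)%E]eq_integral do rewrite EFinM.
rewrite ge0_integralZl//; last 2 first.
- exact/measurable_EFinP.
- by move=> u _; rewrite lee_fin gamma_kernel_ge0.
rewrite ge0_integralZl//; last exact/measurable_EFinP.
rewrite integral_expRNabs//.
apply: le_trans (leeD (lee_wpmul2l _ (integral_gamma_kernel_le a01)) (lexx _)) _.
  by rewrite lee_fin.
by [].
Qed.

End singular_kernels.

Section Lebesgue_norms.
Context d (T : measurableType d) {R : realType}.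
Variable mu : {measure set T -> \bar R}.
Implicit Types (f : T -> \bar R) (c r : R).
Local Open Scope ereal_scope.

Lemma rexp_EFin r : (0 < r)%R -> rexp r%:E = r^-1%R.
Proof. by move=> r0; rewrite /rexp inver gt_eqF. Qed.

Lemma rexpy : rexp (+oo : \bar R) = 0%R.
Proof. by rewrite /rexp invey. Qed.

Lemma rexp_ge0 (p : \bar R) : (1 <= p)%E -> (0 <= rexp p)%R.
Proof.
case: p => [r r1|_|//]; last by rewrite rexpy.
rewrite lee_fin in r1; have r0 := lt_le_trans ltr01 r1.
by rewrite rexp_EFin// invr_ge0 ltW.
Qed.

Lemma rexp_le1 (p : \bar R) : (1 <= p)%E -> (rexp p <= 1)%R.
Proof.
case: p => [r r1|_|//]; last by rewrite rexpy ler01.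
rewrite lee_fin in r1; have r0 := lt_le_trans ltr01 r1.
by rewrite rexp_EFin// invf_le1.
Qed.

Lemma Lnorm_EFin_leP r c f : (0 < r)%R -> (0 <= c)%R -> (forall x, 0 <= f x) ->
  'N[mu]_r%:E[f] <= c%:E <-> \int[mu]_x f x `^ r <= (c `^ r)%:E.
Proof.
move=> r0 c0 f0.
have E : 'N[mu]_r%:E[f] `^ r = \int[mu]_x f x `^ r.
  rewrite poweR_Lnorm ?gt_eqF//; apply: eq_integral => x _; by rewrite gee0_abs.
have N0 : 0 <= 'N[mu]_r%:E[f] by exact: Lnorm_ge0.
split=> [h|]; rewrite -?E.
  by rewrite -poweR_EFin gt0_ler_poweR ?(ltW r0)// in_itv/= ?N0 ?leey// lee_fin c0.
move=> h; have rr : (r / r)%R = 1%R by rewrite divff// gt_eqF.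
rewrite -[leLHS]poweRe1// -rr poweRrM -[leRHS]poweRe1 ?lee_fin// -rr poweRrM.
rewrite gt0_ler_poweR ?invr_ge0 ?(ltW r0)// in_itv/= ?poweR_ge0 ?leey//.
by rewrite lee_fin powR_ge0.
Qed.

Lemma Lnormy_leP (c : \bar R) f : 0 < mu setT -> (forall x, 0 <= f x) ->
  'N[mu]_+oo[f] <= c <-> {ae mu, forall x, f x <= c}.
Proof.
move=> mu0 f0; rewrite unlock /Lnorm mu0.
have -> : abse \o f = f by apply/funext => x /=; rewrite gee0_abs.
by split=> /ess_sup_inf.ess_supP.
Qed.

End Lebesgue_norms.

Section tilted_potential.
Context {R : realType}.
Notation leb := (@lebesgue_measure R).
Implicit Types (k : R -> \bar R) (h G : R -> R) (t s u : R).

Definition potential k G t : \bar R := (\int[leb]_s (k (t - s)%R * (G s)%:E))%E.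

Section potential_lemmas.
Variables (k : R -> \bar R) (G : R -> R).
Hypothesis mk : measurable_fun setT k.
Hypothesis k0 : forall u, (0 <= k u)%E.
Hypothesis mG : measurable_fun setT G.
Hypothesis G0 : forall s, 0 <= G s.

Lemma potential_ge0 t : (0 <= potential k G t)%E.
Proof. by apply: integral_ge0 => s _; apply: mule_ge0; rewrite ?lee_fin. Qed.

Lemma measurable_potential_integrand t :
  measurable_fun setT (fun s => k (t - s)%R * (G s)%:E)%E.
Proof.
apply: emeasurable_funM; last exact/measurable_EFinP.
by apply: (measurableT_comp mk); exact: measurable_funB.
Qed.

Lemma measurable_potential : measurable_fun setT (potential k G).
Proof.
apply: (@measurable_lebesgue_integral R (fun z => k (z.1 - z.2)%R * (G z.2)%:E)%E).
  apply: emeasurable_funM.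
    by apply: (measurableT_comp mk); exact: measurable_funB.
  by apply/measurable_EFinP; exact: measurableT_comp.
by move=> z; apply: mule_ge0; rewrite ?lee_fin.
Qed.

(** The diagonal is a null set; there the kernel may be infinite, whereas the
    majorant h takes real values. *)
Lemma potential_le_convol h t : measurable_fun setT h -> (forall u, 0 <= h u) ->
  (forall u, u != 0 -> (k u <= (h u)%:E)%E) -> (potential k G t <= convol h G t)%E.
Proof.
move=> mh h0 kh; apply: ae_ge0_le_integral => //.
- by move=> s _; apply: mule_ge0; rewrite ?lee_fin.
- exact: measurable_potential_integrand.
- by move=> s _; rewrite lee_fin mulr_ge0.
- by apply/measurable_EFinP; apply: measurable_funM => //; exact: measurable_reflect.
exists [set t]; split; [exact: measurable_set1|exact: lebesgue_measure_set1|].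
move=> s /= /not_implyP[_ nle]; apply: contrapT => /eqP st; apply: nle.
rewrite EFinM; apply: lee_wpmul2r; first by rewrite lee_fin.
by apply: kh; rewrite subr_eq0 eq_sym.
Qed.

End potential_lemmas.

(** The exponential weights on both sides of the operator move onto the kernel as
    an exponential of the difference of the variables. *)
Definition tilted (Q : R) k u : \bar R := ((expR (- (Q * u)))%:E * k u)%E.

Section tilted_bounds.
Variables (be sg : R) (k : R -> \bar R).
Hypothesis hk : kernel_profile be sg k.

Lemma profile_ge0 u : (0 <= k u)%E.
Proof.
have [c c0 kc] := profile_ge hk; apply: le_trans (kc u).
by rewrite lee_fin mulr_ge0 ?expR_ge0// ltW.
Qed.

Lemma tilted_ge0 Q u : (0 <= tilted Q k u)%E.
Proof. by apply: mule_ge0; rewrite ?lee_fin ?expR_ge0// profile_ge0. Qed.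

Lemma measurable_tilted Q : measurable_fun setT (tilted Q k).
Proof.
apply: emeasurable_funM; last exact: (profile_measurable hk).
apply/measurable_EFinP; under eq_fun do rewrite -mulNr; exact: measurable_expRM.
Qed.

Lemma expR_tilt_le Q u :
  expR (- (Q * u)) * expR (- (be * `|u|)) <= expR (- ((be - `|Q|) * `|u|)).
Proof.
rewrite -expRD ler_expR; have : - (Q * u) <= `|Q| * `|u|.
  by rewrite -normrM; apply: le_trans (ler_norm _) _; rewrite normrN.
lra.
Qed.

Lemma tilted_bounded Q : 1 / 2 < sg -> `|Q| <= be ->
  exists2 C : R, 0 < C & forall u, (tilted Q k u <= C%:E)%E.
Proof.
move=> sg2 Qbe; have [C C0 kC] := profile_bounded hk sg2; exists C => // u.
apply: le_trans (lee_wpmul2l _ (kC u)) _; first by rewrite lee_fin expR_ge0.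
rewrite -EFinM lee_fin mulrCA -[leRHS]mulr1 ler_wpM2l ?(ltW C0)//.
apply: le_trans (expR_tilt_le _ _) _.
by rewrite -expR0 ler_expR oppr_le0 mulr_ge0 ?subr_ge0.
Qed.

Lemma tilted_tempered Q t : 0 < t <= sg -> t < 1 / 2 ->
  exists2 C : R, 0 < C & forall u, u != 0 ->
    (tilted Q k u <= (C * tempered_kernel (be - `|Q|) t u)%:E)%E.
Proof.
move=> t0 t2; have [C C0 kC] := profile_sing_le hk t0 t2; exists C => // u u0.
apply: le_trans (lee_wpmul2l _ (kC u u0)) _; first by rewrite lee_fin expR_ge0.
rewrite -EFinM lee_fin mulrCA ler_wpM2l ?(ltW C0)// mulrA.
by rewrite ler_wpM2r ?addr_ge0 ?powR_ge0// expR_tilt_le.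
Qed.

End tilted_bounds.
End tilted_potential.

(** * Boundedness of the tilted potentials *)

Section sufficiency.
Context {R : realType}.
Notation leb := (@lebesgue_measure R).
Implicit Types (h G : R -> R) (t s u r c : R).

Lemma ae_imply (P1 P2 : R -> Prop) : (forall x, P1 x -> P2 x) ->
  {ae leb, forall x, P1 x} -> {ae leb, forall x, P2 x}.
Proof.
move=> P12 [N [mN N0 PN]]; exists N; split => // x /= nP2.
by apply: PN => /= P1x; exact/nP2/P12.
Qed.

Lemma lebesgue_measureT_gt0 : (0 < leb setT)%E.
Proof.
rewrite lt0e measure_ge0 andbT; apply/eqP => T0.
have := lebesgue_measure_itv (R := R) `[0, 1]; rewrite /= lte_fin ltr01 => h.
have : (leb `[0%R, 1%R] <= leb setT)%E by apply: le_measure; rewrite ?inE.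
by rewrite T0 h -EFinB lee_fin subr0 ler10.
Qed.

Lemma Lnorm_le_root d (T : measurableType d) (mu : {measure set T -> \bar R})
    (f : T -> \bar R) r (B : R) : 0 < r -> (forall x, (0 <= f x)%E) ->
  (\int[mu]_x f x `^ r <= B%:E)%E -> ('N[mu]_r%:E[f] <= (B `^ r^-1)%:E)%E.
Proof.
move=> r0 f0 fB; apply/Lnorm_EFin_leP => //; first exact: powR_ge0.
rewrite -powRrM mulVf ?gt_eqF// powRr1// -lee_fin.
by apply: le_trans fB; apply: integral_ge0 => x _; exact: poweR_ge0.
Qed.

Lemma poweR_add_le (x y : \bar R) r : (0 <= x)%E -> (0 <= y)%E -> 0 < r ->
  ((x + y) `^ r <= (2 `^ r)%:E * (x `^ r + y `^ r))%E.
Proof.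
case: x => [x| |]//; case: y => [y| |]// x0 y0 r0; last 3 first.
- by rewrite !poweRyr ?gt_eqF// addey ?gt0_muley ?leey// lte_fin powR_gt0.
- rewrite !poweRyr ?gt_eqF// addye ?gt0_muley ?leey// ?lte_fin ?powR_gt0//.
- by rewrite !poweRyr ?gt_eqF// addye ?gt0_muley ?leey// lte_fin powR_gt0.
rewrite !lee_fin in x0 y0.
change (((x + y) `^ r)%:E <= (2 `^ r * (x `^ r + y `^ r))%:E)%E.
rewrite lee_fin; wlog xy : x y x0 y0 / x <= y.
  move=> H; have [xy|/ltW xy] := leP x y; first exact: H.
  by rewrite addrC (addrC (x `^ r)); exact: H.
apply: (@le_trans _ _ ((2 * y) `^ r)).
  by rewrite ge0_ler_powR ?nnegrE; lra.
by rewrite powRM// ler_wpM2l ?powR_ge0// lerDr powR_ge0.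
Qed.

Lemma convolDl h1 h2 G t : measurable_fun setT h1 -> measurable_fun setT h2 ->
  measurable_fun setT G -> (forall u, 0 <= h1 u) -> (forall u, 0 <= h2 u) ->
  (forall u, 0 <= G u) ->
  convol (fun u => h1 u + h2 u) G t = (convol h1 G t + convol h2 G t)%E.
Proof.
move=> m1 m2 mG h10 h20 G0; rewrite /convol -ge0_integralD//.
- by apply: eq_integral => s _; rewrite -EFinD mulrDl.
- by move=> s _; rewrite lee_fin mulr_ge0.
- by apply/measurable_EFinP; apply: measurable_funM => //; exact: measurable_reflect.
- by move=> s _; rewrite lee_fin mulr_ge0.
- by apply/measurable_EFinP; apply: measurable_funM => //; exact: measurable_reflect.
Qed.

Lemma convolZl c h G t : measurable_fun setT h ->
  measurable_fun setT G -> (forall u, 0 <= h u) ->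
  (forall u, 0 <= G u) -> 0 <= c ->
  convol (fun u => c * h u) G t = (c%:E * convol h G t)%E.
Proof.
move=> mh mG h0 G0 c0; rewrite /convol -ge0_integralZl//.
- by apply: eq_integral => s _; rewrite -EFinM mulrA.
- by apply/measurable_EFinP; apply: measurable_funM => //; exact: measurable_reflect.
- by move=> s _; rewrite lee_fin mulr_ge0.
Qed.

Variables (be sg : R) (k : R -> \bar R).
Hypothesis hk : kernel_profile be sg k.
Hypothesis sg0 : 0 < sg.

(** Here dl stands for 1/p - 1/q.  A singularity |u|^(2 t - 1) is in L^r near the
    origin with r = 1 / (1 - dl) as soon as dl < 2 t. *)
Lemma tilted_young_kernel Q dl : `|Q| < be -> 0 <= dl -> dl < 1 -> dl < 2 * sg ->
  exists h A, [/\ measurable_fun setT h, forall u, 0 <= h u,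
    forall u, u != 0 -> (tilted Q k u <= (h u)%:E)%E &
    (\int[leb]_u (h u `^ (1 - dl)^-1)%:E <= A%:E)%E].
Proof.
move=> Qbe dl0 dl1 dlsg; set r := (1 - dl)^-1.
have r0 : 0 < r by rewrite invr_gt0 subr_gt0.
(* any t with dl / 2 < t < 1/2 and t <= sigma *)
pose t := (dl / 2 + Num.min sg (1 / 2)) / 2.
have [t0 t2 tdl] : [/\ 0 < t <= sg, t < 1 / 2 & dl < 2 * t].
  rewrite /t; case: (leP sg (1 / 2)) => sg2; split; lra.
have e0 : 0 < be - `|Q| by rewrite subr_gt0.
have [C C0 kC] := tilted_tempered hk Q t0 t2.
have [|A hA] := tempered_kernel_powR_lty e0 t2 r0.
  by rewrite /r ltr_pdivrMr ?subr_gt0// mul1r; lra.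
exists (fun u => C * tempered_kernel (be - `|Q|) t u), (C `^ r * A).
have mt := measurable_tempered_kernel (be - `|Q|) t.
split=> //.
- exact: measurable_funM.
- by move=> u; rewrite mulr_ge0 ?(ltW C0)// tempered_kernel_ge0.
under eq_integral do rewrite powRM ?(ltW C0) ?tempered_kernel_ge0// EFinM.
rewrite ge0_integralZl//.
- by rewrite EFinM; apply: lee_wpmul2l => //; rewrite lee_fin powR_ge0.
- by apply/measurable_EFinP; apply: (measurableT_comp (measurable_powR r)).
- by move=> u _; rewrite lee_fin powR_ge0.
- by rewrite lee_fin powR_ge0.
Qed.

Let norm_le1_integral p G : 0 < p -> (forall s, 0 <= G s) ->
  ('N[leb]_p%:E[EFin \o G] <= 1)%E -> (\int[leb]_s (G s `^ p)%:E <= 1)%E.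
Proof.
move=> p0 G0 /(Lnorm_EFin_leP _ p0 ler01).
by rewrite powR1; apply => s; rewrite lee_fin.
Qed.

Let potential_le Q G h t : measurable_fun setT G -> (forall s, 0 <= G s) ->
  measurable_fun setT h -> (forall u, 0 <= h u) ->
  (forall u, u != 0 -> (tilted Q k u <= (h u)%:E)%E) ->
  (potential (tilted Q k) G t <= convol h G t)%E.
Proof.
move=> mG G0 mh h0 kh; apply: potential_le_convol => //.
  exact: (measurable_tilted hk).
exact: (tilted_ge0 hk).
Qed.

Let potential_tilted_ge0 Q G t : (forall s, 0 <= G s) ->
  (0 <= potential (tilted Q k) G t)%E.
Proof. by move=> G0; apply: potential_ge0 => //; exact: (tilted_ge0 hk). Qed.

Let measurable_potential_tilted Q G : measurable_fun setT G ->
  (forall s, 0 <= G s) -> measurable_fun setT (potential (tilted Q k) G).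
Proof.
move=> mG G0; apply: measurable_potential => //.
  exact: (measurable_tilted hk).
exact: (tilted_ge0 hk).
Qed.

Lemma tilted_bounded_oo_oo Q : `|Q| < be -> exists A : R,
  forall G, measurable_fun setT G -> (forall s, 0 <= G s) ->
  ('N[leb]_+oo[EFin \o G] <= 1)%E ->
  forall t, (potential (tilted Q k) G t <= A%:E)%E.
Proof.
move=> Qbe; have [|h [A [mh h0 kh]]] := @tilted_young_kernel Q 0 Qbe (lexx _) ltr01.
  by rewrite mulr_gt0.
rewrite subr0 invr1 => hA; exists A => G mG G0 GN t.
have {}GN : {ae leb, forall s, ((G s)%:E <= 1)%E}.
  by apply/(Lnormy_leP _ lebesgue_measureT_gt0) => [s|//]; rewrite lee_fin.
apply: le_trans (potential_le t mG G0 mh h0 kh) _.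
apply: (@le_trans _ _ (\int[leb]_s (h (t - s))%:E)%E); last first.
  rewrite (@ge0_integralBl R (EFin \o h) t)//; last exact/measurable_EFinP.
  by apply: le_trans hA; under [leRHS]eq_integral do rewrite powRr1//.
apply: ae_ge0_le_integral => //.
- by move=> s _; rewrite lee_fin mulr_ge0.
- by apply/measurable_EFinP; apply: measurable_funM => //; exact: measurable_reflect.
- by move=> s _; rewrite lee_fin.
- by apply/measurable_EFinP; exact: measurable_reflect.
apply: ae_imply GN => s; rewrite lee_fin => Gs _.
by rewrite lee_fin ler_piMr.
Qed.

(** This is Young's inequality with q = oo. *)
Lemma tilted_bounded_p_oo Q p : `|Q| < be -> 1 < p -> p^-1 < 2 * sg ->
  exists A : R, forall G, measurable_fun setT G -> (forall s, 0 <= G s) ->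
  ('N[leb]_p%:E[EFin \o G] <= 1)%E ->
  forall t, (potential (tilted Q k) G t <= A%:E)%E.
Proof.
move=> Qbe p1 psg; have p0 : 0 < p by exact: lt_trans p1.
have ip0 : 0 < p^-1 by rewrite invr_gt0.
have ip1 : p^-1 < 1 by rewrite invf_lt1.
have [h [A [mh h0 kh hA]]] := @tilted_young_kernel Q p^-1 Qbe (ltW ip0) ip1 psg.
exists (A + 1) => G mG G0 /(norm_le1_integral p0 G0) GN t.
apply: le_trans (potential_le t mG G0 mh h0 kh) _.
have H := @convol_young_mean R h G 0 (1 - p^-1) p^-1 (1 - p^-1)^-1 p A mh mG h0 G0
  (lexx _) _ (ltW ip0) _ _ _ hA GN t 1 ltr01.
apply: le_trans (H _ _ _ _) _.
- by rewrite subr_ge0 ltW.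
- by ring.
- by rewrite add0r mulVf// subr_eq0 gt_eqF.
- by rewrite add0r divff// gt_eqF.
by rewrite powR1 mul1r mul0e add0e mul1e.
Qed.

Lemma tilted_bounded_1_oo Q : `|Q| <= be -> 1 / 2 < sg ->
  exists A : R, forall G, measurable_fun setT G -> (forall s, 0 <= G s) ->
  ('N[leb]_1%:E[EFin \o G] <= 1)%E ->
  forall t, (potential (tilted Q k) G t <= A%:E)%E.
Proof.
move=> Qbe sg2; have [C C0 kC] := tilted_bounded hk sg2 Qbe.
exists C => G mG G0 GN t; have mGE : measurable_fun setT (EFin \o G).
  exact/measurable_EFinP.
apply: (@le_trans _ _ (\int[leb]_s (C%:E * (G s)%:E))%E).
  apply: ge0_le_integral => //.
  - by move=> s _; apply: mule_ge0; rewrite ?lee_fin// (tilted_ge0 hk).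
  - apply: measurable_potential_integrand => //; exact: (measurable_tilted hk).
  - exact: emeasurable_funM.
  - by move=> s _; apply: lee_wpmul2r; rewrite ?lee_fin.
rewrite ge0_integralZl//; last first.
- by rewrite lee_fin ltW.
- by move=> s _; rewrite lee_fin.
rewrite -[leRHS]mule1; apply: lee_wpmul2l; first by rewrite lee_fin ltW.
apply: le_trans GN; rewrite Lnorm1; apply: ge0_le_integral => //.
- by move=> s _; rewrite lee_fin.
- by apply: measurableT_comp => //.
- by move=> s _; exact: lee_abs.
Qed.

Lemma tilted_bounded_strict Q p q : `|Q| < be -> 1 <= p -> p <= q ->
  p^-1 - 2 * sg < q^-1 ->
  exists2 A : R, 0 <= A & forall G, measurable_fun setT G -> (forall s, 0 <= G s) ->
  ('N[leb]_p%:E[EFin \o G] <= 1)%E ->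
  ('N[leb]_q%:E[potential (tilted Q k) G] <= A%:E)%E.
Proof.
move=> Qbe p1 pq psg; have p0 : 0 < p by exact: lt_le_trans p1.
have q0 : 0 < q by exact: lt_le_trans pq.
have ip0 : 0 < p^-1 by rewrite invr_gt0.
have iq0 : 0 < q^-1 by rewrite invr_gt0.
have ip1 : p^-1 <= 1 by rewrite invf_le1.
have iqp : q^-1 <= p^-1 by rewrite lef_pV2 ?posrE.
have [|||h [A [mh h0 kh hA]]] := @tilted_young_kernel Q (p^-1 - q^-1) Qbe.
- by rewrite subr_ge0.
- by lra.
- by lra.
exists (((A + 2) `^ q * A) `^ q^-1); first exact: powR_ge0.
move=> G mG G0 /(norm_le1_integral p0 G0) GN.
apply: Lnorm_le_root => //; first by move=> t; exact: potential_tilted_ge0.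
have H := @convol_young R h G q^-1 (1 - p^-1) (p^-1 - q^-1) (1 - (p^-1 - q^-1))^-1 p A mh mG h0 G0
  (ltW iq0) _ _ _ _ _ hA GN q q0 erefl.
apply: le_trans (H _ _ _ _ _); last 5 first.
- by rewrite subr_ge0.
- by rewrite subr_ge0.
- by ring.
- have -> : q^-1 + (1 - p^-1) = 1 - (p^-1 - q^-1) by ring.
  by rewrite mulVf//; apply/eqP => E; lra.
- by rewrite addrC subrK divff// gt_eqF.
apply: ge0_le_integral => //.
- by move=> t _; exact: poweR_ge0.
- by apply: (measurableT_comp (measurable_poweR _)); exact: measurable_potential_tilted.
- by apply: (measurableT_comp (measurable_poweR _)); exact: measurable_convol.
move=> t _; apply: gt0_ler_poweR; rewrite ?(ltW q0)// ?in_itv/= ?leey ?andbT.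
- exact: potential_tilted_ge0.
- exact: convol_ge0.
- exact: potential_le.
Qed.

(** The kernel is at most a constant times exp (- e |u|) + |u|^(2 sigma - 1): the
    first summand is in every L^r, and the second is the Riesz kernel with exactly
    the exponents of the Hardy-Littlewood-Sobolev inequality. *)
Lemma tilted_bounded_critical Q p q : `|Q| < be -> 1 < p -> p <= q ->
  p^-1 - 2 * sg = q^-1 ->
  exists2 A : R, 0 <= A & forall G, measurable_fun setT G -> (forall s, 0 <= G s) ->
  ('N[leb]_p%:E[EFin \o G] <= 1)%E ->
  ('N[leb]_q%:E[potential (tilted Q k) G] <= A%:E)%E.
Proof.
move=> Qbe p1 pq psg; have p0 : 0 < p by exact: lt_trans p1.
have q0 : 0 < q by exact: lt_le_trans pq.
have ip0 : 0 < p^-1 by rewrite invr_gt0.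
have iq0 : 0 < q^-1 by rewrite invr_gt0.
have ip1 : p^-1 < 1 by rewrite invf_lt1.
have iqp : q^-1 <= p^-1 by rewrite lef_pV2 ?posrE.
have sg2 : sg < 1 / 2 by lra.
have [|C C0 kC] := tilted_tempered hk Q _ sg2; first by rewrite sg0 lexx.
set e := be - `|Q| in kC; have e0 : 0 < e by rewrite subr_gt0.
pose r := (1 - (p^-1 - q^-1))^-1.
have r0 : 0 < r by rewrite invr_gt0; lra.
pose E u := expR (- (e * `|u|)); pose z (u : R) := `|u| `^ (2 * sg - 1).
have mE : measurable_fun setT E by exact: measurable_expRNabs.
have mz : measurable_fun setT z by exact: measurable_normr_powR.
have E0 u : 0 <= E u by exact: expR_ge0.
have z0 u : 0 <= z u by exact: powR_ge0.
set A := 2 / (e * r).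
have EA : (\int[leb]_u (E u `^ r)%:E <= A%:E)%E.
  rewrite -integral_expRNabs ?mulr_gt0//.
  under eq_integral do rewrite /E -expRM.
  by under [leRHS]eq_integral do rewrite mulrAC -mulNr.
set B := C `^ q * (2 `^ q * ((A + 2) `^ q * A + hls_const p q sg)).
exists (B `^ q^-1); first exact: powR_ge0.
move=> G mG G0 /(norm_le1_integral p0 G0) GN.
apply: Lnorm_le_root => //; first by move=> t; exact: potential_tilted_ge0.
have H := @convol_young R E G q^-1 (1 - p^-1) (p^-1 - q^-1) r p A mE mG E0 G0
  (ltW iq0) _ _ _ _ _ EA GN q q0 erefl.
have {}H : (\int[leb]_t (convol E G t `^ q) <= ((A + 2) `^ q * A)%:E)%E.
  apply: H.
  - by rewrite subr_ge0 ltW.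
  - by rewrite subr_ge0.
  - by ring.
  - have -> : q^-1 + (1 - p^-1) = 1 - (p^-1 - q^-1) by ring.
    by rewrite mulVf//; apply/eqP => ?; lra.
  - by rewrite addrC subrK divff// gt_eqF.
have Hz : (\int[leb]_t (convol z G t `^ q) <= (hls_const p q sg)%:E)%E.
  exact: hardy_littlewood_sobolev.
have mc1 : measurable_fun setT (fun t => convol E G t `^ q)%E.
  by apply: (measurableT_comp (measurable_poweR _)); exact: measurable_convol.
have mc2 : measurable_fun setT (fun t => convol z G t `^ q)%E.
  by apply: (measurableT_comp (measurable_poweR _)); exact: measurable_convol.
apply: (@le_trans _ _ (\int[leb]_t ((C `^ q)%:E * ((2 `^ q)%:E *
    (convol E G t `^ q + convol z G t `^ q))))%E).
  apply: ge0_le_integral => //.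
  - by move=> t _; exact: poweR_ge0.
  - by apply: (measurableT_comp (measurable_poweR _)); exact: measurable_potential_tilted.
  - by do 2 apply: emeasurable_funM => //; exact: emeasurable_funD.
  move=> t _; have cE0 := convol_ge0 E0 G0 t; have cz0 := convol_ge0 z0 G0 t.
  have cs0 := adde_ge0 cE0 cz0.
  have C0' : (0 <= C%:E)%E by rewrite lee_fin ltW.
  apply: (@le_trans _ _ ((C%:E * (convol E G t + convol z G t)) `^ q)%E); last first.
    rewrite (poweRM _ C0' cs0).
    by apply: lee_wpmul2l; [rewrite lee_fin powR_ge0|exact: poweR_add_le].
  apply: gt0_ler_poweR; rewrite ?(ltW q0)// ?in_itv/= ?leey ?andbT.
  - exact: potential_tilted_ge0.
  - exact: mule_ge0 C0' cs0.
  rewrite -convolDl// -convolZl ?(ltW C0)//; last 2 first.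
  - exact: measurable_funD.
  - by move=> u; exact: addr_ge0.
  apply: potential_le => //.
  - by apply: measurable_funM => //; exact: measurable_funD.
  - by move=> u; rewrite mulr_ge0 ?addr_ge0// ltW.
  move=> u u0; apply: le_trans (kC u u0) _; rewrite lee_fin ler_wpM2l ?(ltW C0)//.
  rewrite /tempered_kernel mulrDr mulr1 lerD2l ler_piMl ?powR_ge0//.
  by rewrite -expR0 ler_expR oppr_le0 mulr_ge0// ltW.
rewrite ge0_integralZl//; last 3 first.
- by apply: emeasurable_funM => //; exact: emeasurable_funD.
- move=> t _; apply: mule_ge0; first by rewrite lee_fin powR_ge0.
  exact: adde_ge0 (poweR_ge0 _ _) (poweR_ge0 _ _).
- by rewrite lee_fin powR_ge0.
rewrite ge0_integralZl//; last 2 first.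
- exact: emeasurable_funD.
- move=> t _; exact: adde_ge0 (poweR_ge0 _ _) (poweR_ge0 _ _).
rewrite ge0_integralD//; last 2 first.
- by move=> t _; exact: poweR_ge0.
- by move=> t _; exact: poweR_ge0.
rewrite /B 2!EFinM EFinD; apply: lee_wpmul2l; first by rewrite lee_fin powR_ge0.
apply: lee_wpmul2l; first by rewrite lee_fin powR_ge0.
exact: leeD.
Qed.

End sufficiency.

Section boundedness.
Context {R : realType}.
Notation leb := (@lebesgue_measure R).
Implicit Types (G : R -> R) (Q : R) (p q : \bar R).
Variables (be sg : R) (k : R -> \bar R).
Hypothesis hk : kernel_profile be sg k.
Hypothesis sg0 : 0 < sg.

Lemma Lnormy_le_bound (F : R -> \bar R) (A : \bar R) :
  (forall t, 0 <= F t)%E -> (forall t, F t <= A)%E -> ('N[leb]_+oo[F] <= A)%E.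
Proof.
move=> F0 FA; apply/Lnormy_leP => //; first exact: lebesgue_measureT_gt0.
exact: aeW.
Qed.

Theorem tilted_potential_bounded p q Q : (1 <= p)%E -> (p <= q)%E ->
  `|Q| < be ?<= if (p == 1%E) && (q == +oo%E) ->
  rexp p - 2 * sg < rexp q ?<= if (~~ ((p == 1%E) || (q == +oo%E))) ->
  exists2 A : R, 0 <= A & forall G, measurable_fun setT G -> (forall s, 0 <= G s) ->
    ('N[leb]_p[EFin \o G] <= 1)%E ->
    ('N[leb]_q[potential (tilted Q k) G] <= A%:E)%E.
Proof.
have bound q' (A : R) : (forall G, measurable_fun setT G -> (forall s, 0 <= G s) ->
    ('N[leb]_q'[EFin \o G] <= 1)%E -> forall t, (potential (tilted Q k) G t <= A%:E)%E) ->
  exists2 A : R, 0 <= A & forall G, measurable_fun setT G -> (forall s, 0 <= G s) ->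
    ('N[leb]_q'[EFin \o G] <= 1)%E ->
    ('N[leb]_+oo[potential (tilted Q k) G] <= A%:E)%E.
  move=> H; exists (Num.max A 0); first by rewrite le_max lexx orbT.
  move=> G mG G0 GN; apply: Lnormy_le_bound => t.
    by apply: potential_ge0 => // u; exact: (tilted_ge0 hk).
  by apply: le_trans (H G mG G0 GN t) _; rewrite lee_fin le_max lexx.
case: p => [p| |]//; case: q => [q| |]//.
- rewrite !lee_fin => p1 pq; rewrite /= andbF /= orbF => Qbe.
  have p0 : 0 < p by exact: lt_le_trans p1.
  have q0 : 0 < q by exact: lt_le_trans pq.
  rewrite !rexp_EFin//; rewrite eqe; case: eqVneq => [p1'|pn1] /=.
    by move=> H; exact: (tilted_bounded_strict hk Qbe p1 pq H).
  rewrite le_eqVlt => /orP[/eqP H|H]; last exact: (tilted_bounded_strict hk Qbe p1 pq H).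
  by apply: (tilted_bounded_critical hk sg0 Qbe _ pq H); rewrite lt_neqAle eq_sym pn1.
- rewrite lee_fin => p1 _; have p0 : 0 < p by exact: lt_le_trans p1.
  rewrite /= andbT orbT /= rexp_EFin// rexpy eqe.
  case: (eqVneq p 1) => [->|pn1] /= Qbe H.
    have [|A hA] := tilted_bounded_1_oo hk Qbe; first by rewrite invr1 in H; lra.
    exact: bound hA.
  have [||A hA] := @tilted_bounded_p_oo _ _ _ _ hk Q p Qbe.
  - by rewrite lt_neqAle eq_sym pn1.
  - by rewrite subr_lt0 in H.
  exact: bound hA.
- move=> _ _ /= Qbe _.
  have [A hA] := tilted_bounded_oo_oo hk sg0 Qbe.
  exact: bound hA.
Qed.

Lemma integral_lty_ae (F : R -> \bar R) : measurable_fun setT F ->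
  (forall t, 0 <= F t)%E -> (\int[leb]_t F t < +oo)%E ->
  {ae leb, forall t, (F t < +oo)%E}.
Proof.
move=> mF F0 FI; have iF : leb.-integrable setT F.
  apply/integrableP; split => //.
  by under eq_integral do rewrite gee0_abs//.
have [N [mN N0 FN]] := integrable_ae measurableT iF.
exists N; split => // t /= nF; apply: FN => /= h; apply: nF.
by rewrite ltey_eq h.
Qed.

(** For p = 1 the tilt may compensate the decay completely: the kernel is then the
    sum of a bounded and an integrable function. *)
Lemma potential1_ae_finite G Q : `|Q| <= be ->
  measurable_fun setT G -> (forall s, 0 <= G s) ->
  ('N[leb]_1[EFin \o G] <= 1)%E ->
  {ae leb, forall t, (potential (tilted Q k) G t < +oo)%E}.
Proof.
move=> Qbe mG G0; rewrite Lnorm1 => GN.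
pose t := Num.min sg (1 / 4); have [t0 t2] : 0 < t <= sg /\ t < 1 / 2.
  by have := sg0; rewrite /t; case: (leP sg (1 / 4)) => ?; split; lra.
have [C C0 kC] := tilted_tempered hk Q t0 t2.
have mg := @measurable_gamma_kernel R (2 * t); set g := gamma_kernel _ in mg.
have g0 u : 0 <= g u by exact: gamma_kernel_ge0.
have C1 : 0 <= C * expR 1 by rewrite mulr_ge0 ?expR_ge0// ltW.
have C2 : 0 <= C * 2 by rewrite mulr_ge0// ltW.
have GI : (\int[leb]_s (G s)%:E <= 1)%E.
  apply: le_trans GN; apply: ge0_le_integral => //.
  - by move=> s _; rewrite lee_fin.
  - exact/measurable_EFinP.
  - by apply: measurableT_comp => //; exact/measurable_EFinP.
  - by move=> s _; exact: lee_abs.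
have H : {ae leb, forall t, (convol g G t < +oo)%E}.
  apply: integral_lty_ae.
  - exact: measurable_convol.
  - exact: convol_ge0.
  rewrite integral_convol//; apply: (@le_lt_trans _ _ ((2 * Gamma_fun (2 * t))%:E * 1)%E).
    apply: lee_pmul => //.
    - by apply: integral_ge0 => u _; rewrite lee_fin.
    - by apply: integral_ge0 => u _; rewrite lee_fin.
    - by apply: integral_gamma_kernel_le; lra.
  by rewrite mule1 ltry.
apply: ae_imply H => s Hs.
have mcst (c : R) : measurable_fun setT ((fun=> c) : R -> R) by exact: measurable_cst.
apply: (@le_lt_trans _ _ (convol (fun u => C * 2 * 1 + C * expR 1 * g u) G s)).
  apply: potential_le_convol => //.
  - exact: (measurable_tilted hk).
  - exact: (tilted_ge0 hk).
  - by apply: measurable_funD => //; exact: measurable_funM.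
  - by move=> u; rewrite mulr1 addr_ge0// mulr_ge0.
  move=> u u0; apply: le_trans (kC u u0) _; rewrite lee_fin -!mulrA -mulrDr.
  rewrite ler_wpM2l ?(ltW C0)// mulr1 /tempered_kernel mulrDr mulr1.
  have e0 : 0 <= be - `|Q| by rewrite subr_ge0.
  have := @expRN_powR_le R (2 * t) (be - `|Q|) u; rewrite -/g => /(_ _ e0) h.
  have : expR (- ((be - `|Q|) * `|u|)) <= 1.
    by rewrite -expR0 ler_expR oppr_le0 mulr_ge0.
  have := h ltac:(lra); lra.
rewrite convolDl//; last 3 first.
- exact: measurable_funM.
- by move=> u; rewrite mulr1.
- by move=> u; rewrite mulr_ge0.
rewrite convolZl// convolZl// lte_add_pinfty//.
  rewrite /convol; under eq_integral do rewrite mul1r.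
  by apply: (@le_lt_trans _ _ ((C * 2)%:E * 1)%E); [exact: lee_wpmul2l|rewrite mule1 ltry].
have [c cE] : exists c, convol g G s = c%:E.
  by exists (fine (convol g G s)); rewrite fineK// ge0_fin_numE// convol_ge0.
by rewrite cE ltry.
Qed.

Theorem tilted_potential_ae_finite p Q G : (1 <= p)%E ->
  `|Q| < be ?<= if (p == 1%E) -> measurable_fun setT G -> (forall s, 0 <= G s) ->
  ('N[leb]_p[EFin \o G] <= 1)%E ->
  {ae leb, forall t, (potential (tilted Q k) G t < +oo)%E}.
Proof.
move=> p1; case: eqVneq => [->|pn1] /= Qbe mG G0 GN.
  exact: potential1_ae_finite.
have [||A A0 hA] := @tilted_potential_bounded p p Q p1 (lexx _).
- by rewrite (negbTE pn1).
- have H : rexp p - 2 * sg < rexp p by rewrite gtrBl mulr_gt0.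
  by case: (~~ _) => //=; exact: ltW.
have {}GN := hA G mG G0 GN; have tk0 := tilted_ge0 hk Q.
have pot0 t : (0 <= potential (tilted Q k) G t)%E by exact: potential_ge0.
have mpot : measurable_fun setT (potential (tilted Q k) G).
  by apply: measurable_potential => //; exact: (measurable_tilted hk).
move: pot0 mpot GN; generalize (potential (tilted Q k) G) => F F0 mF.
case: p p1 pn1 hA => [r| |]// r1 _ _ FN; last first.
  have {}FN : {ae leb, forall t, (F t <= A%:E)%E}.
    by apply/Lnormy_leP => //; exact: lebesgue_measureT_gt0.
  by apply: ae_imply FN => t Ft; exact: le_lt_trans Ft (ltry _).
rewrite lee_fin in r1; have r0 : 0 < r by exact: lt_le_trans r1.
have {}FN : (\int[leb]_t F t `^ r <= (A `^ r)%:E)%E by apply/Lnorm_EFin_leP.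
have mFr : measurable_fun setT (fun t => F t `^ r)%E.
  exact: (measurableT_comp (measurable_poweR r)).
have := integral_lty_ae mFr (fun t => poweR_ge0 _ _) (le_lt_trans FN (ltry _)).
apply: ae_imply => t; rewrite !ltey; apply: contra => /eqP ->.
by rewrite poweRyr// gt_eqF.
Qed.
End boundedness.

(** * Necessity of the conditions *)

Section test_functions.
Context {R : realType}.
Notation leb := (@lebesgue_measure R).
Implicit Types (G : R -> R) (F : R -> \bar R) (A : set R) (c d m t s u v x y r : R).

(** The size of most test functions below is given by an exponential, which makes
    a comparison of exponents one of exponential rates. *)
Lemma expR_growth c d x y : 0 < c ->
  (forall v, 0 <= v -> c * expR (x * v) <= d * expR (y * v)) -> x <= y.
Proof.
move=> c0 H; rewrite leNgt; apply/negP => yx; have xy0 : 0 < x - y by rewrite subr_gt0.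
have v0 : 0 <= `|d| / (c * (x - y)) by rewrite divr_ge0// mulr_ge0 ?ltW.
have := H _ v0; set v := _ / _ in v0 *.
have -> : x * v = (x - y) * v + y * v by ring.
rewrite expRD mulrA ler_pM2r ?expR_gt0// => h.
have := expR_ge1Dx ((x - y) * v).
have -> : (x - y) * v = `|d| / c by rewrite /v; field; rewrite !gt_eqF.
move=> h2; have : c * (1 + `|d| / c) <= d.
  by apply: le_trans h; rewrite ler_wpM2l ?(ltW c0)// (le_trans h2)//;
    rewrite /v ler_expR; rewrite le_eqVlt; apply/orP; left; apply/eqP; field; rewrite !gt_eqF.
rewrite mulrDr mulr1 mulrC divfK ?gt_eqF// => h3; have := ler_norm d; lra.
Qed.

Lemma expR_growth_from w c d x y : 0 < c ->
  (forall v, w <= v -> c * expR (x * v) <= d * expR (y * v)) -> x <= y.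
Proof.
move=> c0 H; apply: (@expR_growth (c * expR (x * w)) (d * expR (y * w))) => [|v v0].
  by rewrite mulr_gt0 ?expR_gt0.
by rewrite -!mulrA -!expRD -!mulrDr; apply: H; rewrite lerDl.
Qed.

Lemma Lnorm_indic_le (p : \bar R) A m : (1 <= p)%E -> measurable A ->
  (leb A <= m%:E)%E -> 0 <= m ->
  ('N[leb]_p[EFin \o \1_A] <= (m `^ rexp p)%:E)%E.
Proof.
move=> p1 mA Am m0; case: p p1 => [r| |]// p1; last first.
  rewrite rexpy powRr0; apply: Lnormy_le_bound => t; rewrite /= lee_fin indicE//.
  by case: (_ \in _).
rewrite lee_fin in p1; have r0 : 0 < r by exact: lt_le_trans p1.
rewrite rexp_EFin//; apply: Lnorm_le_root => //; first by move=> t; rewrite lee_fin indicE ler0n.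
apply: le_trans Am; rewrite -[A in leRHS]setIT -integral_indic//.
rewrite le_eqVlt; apply/orP; left; apply/eqP; apply: eq_integral => t _.
by rewrite /= indicE; case: (_ \in _); rewrite ?powR1 ?powR0 ?gt_eqF.
Qed.

(** Chebyshev's inequality. *)
Lemma Lnorm_ge_on (q : \bar R) F A c m : (1 <= q)%E -> measurable_fun setT F ->
  (forall t, 0 <= F t)%E -> measurable A -> leb A = m%:E -> 0 < m -> 0 <= c ->
  (forall t, A t -> (c%:E <= F t)%E) -> ((c * m `^ rexp q)%:E <= 'N[leb]_q[F])%E.
Proof.
move=> q1 mF F0 mA Am m0 c0 AF; case: q q1 => [r| |]// q1; last first.
  rewrite rexpy powRr0 mulr1 leNgt; apply/negP => Fc.
  have [N [mN N0 FN]] : {ae leb, forall t, (F t <= 'N[leb]_+oo[F])%E}.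
    by apply/Lnormy_leP => //; exact: lebesgue_measureT_gt0.
  have : (leb A <= leb N)%E.
    apply: le_measure; rewrite ?inE//; move=> t At; apply: FN => /=.
    by apply/negP; rewrite -ltNge; exact: lt_le_trans Fc (AF t At).
  by rewrite Am N0 lee_fin leNgt m0.
rewrite lee_fin in q1; have r0 : 0 < r by exact: lt_le_trans q1.
rewrite rexp_EFin// leNgt; apply/negP => H.
have N0 : (0 <= 'N[leb]_r%:E[F])%E by exact: Lnorm_ge0.
have [n nE] : exists n, ('N[leb]_r%:E[F])%E = n%:E.
  by exists (fine ('N[leb]_r%:E[F])%E); rewrite fineK// ge0_fin_numE// (lt_trans H)// ltry.
rewrite nE lte_fin in H; rewrite nE lee_fin in N0.
have : ('N[leb]_r%:E[F] <= n%:E)%E by rewrite nE.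
move=> /(Lnorm_EFin_leP _ r0 N0) => /(_ F0).
have h : ((c `^ r * m)%:E <= \int[leb]_t (F t `^ r))%E.
  rewrite EFinM -Am -integral_cst//; apply: (@le_trans _ _ (\int[leb]_(t in A) (F t `^ r))%E).
    apply: ge0_le_integral => //.
    - by move=> t _; rewrite lee_fin powR_ge0.
    - apply: measurable_funTS; exact: (measurableT_comp (measurable_poweR r)).
    - move=> t At; rewrite -poweR_EFin; apply: gt0_ler_poweR; rewrite ?(ltW r0)//.
      + by rewrite in_itv/= lee_fin c0 leey.
      + by rewrite in_itv/= F0 leey.
      + exact: AF.
  apply: ge0_subset_integral => //.
  exact: (measurableT_comp (measurable_poweR r)).
  by move=> t _; exact: poweR_ge0.
move=> h2; have := le_trans h h2; rewrite lee_fin leNgt => /negP; apply.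
rewrite -(powRr1 (ltW m0)) -(mulVf (lt0r_neq0 r0)) powRrM -powRM ?powR_ge0//.
by rewrite gt0_ltr_powR// nnegrE ?mulr_ge0 ?powR_ge0.
Qed.

Lemma lebesgue_measure_itvcc x y : x <= y -> leb `[x, y] = (y - x)%:E.
Proof.
rewrite lebesgue_measure_itv/= lte_fin le_eqVlt => /predU1P[->|->].
  by rewrite ltxx subrr.
by rewrite -EFinB.
Qed.

Lemma integral_ge_itv F x y c : measurable_fun setT F ->
  (forall s, 0 <= F s)%E -> x <= y -> 0 <= c ->
  (forall s, x <= s <= y -> (c%:E <= F s)%E) ->
  ((c * (y - x))%:E <= \int[leb]_s F s)%E.
Proof.
move=> mF F0 xy c0 cF; apply: (@le_trans _ _ (\int[leb]_(s in `[x, y]) F s)%E); last first.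
  exact: ge0_subset_integral.
have -> : (c * (y - x))%:E = (\int[leb]_(s in `[x, y]) (cst c%:E s))%E.
  transitivity (c%:E * leb `[x, y])%E; first by rewrite lebesgue_measure_itvcc.
  by rewrite -integral_cst.
by apply: ge0_le_integral => //; exact: measurable_funTS.
Qed.

Lemma measurable_inv_itv x y : 0 < x ->
  measurable_fun `[x, y]%classic (fun s : R => (s^-1)%:E).
Proof.
move=> x0; apply: (eq_measurable_fun (fun s => (s `^ (-1))%:E)).
  move=> s; rewrite inE/= in_itv/= => /andP[xs _].
  by rewrite powR_inv1// (le_trans (ltW x0)).
by apply: measurable_funTS; apply/measurable_EFinP; exact: measurable_powR.
Qed.

Lemma integral_inv_itv x y : 0 < x -> x <= y ->
  (\int[leb]_(s in `[x, y]) (s^-1)%:E = (ln (y / x))%:E)%E.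
Proof.
move=> x0 xy; have y0 : 0 < y by exact: lt_le_trans xy.
transitivity (\int[leb]_(s in `]0%R, +oo[) (((EFin \o (fun s => (s `^ (-1))%R)) \_ `[x, y]) s))%E.
  rewrite integral_mkcond [RHS]integral_mkcond; apply: eq_integral => s _.
  rewrite !patchE; case: ifPn => [|_]; last by case: ifP.
  rewrite inE/= in_itv/= => /andP[xs sy]; have s0 := lt_le_trans x0 xs.
  by rewrite mem_set/= ?in_itv/= ?s0// powR_inv1 ?ltW.
rewrite ge0_integral_expR; last 2 first.
- by apply: measurable_patch_EFin => //; exact: measurable_powR.
- by move=> s; apply: erestrict_ge0 => ? _; rewrite lee_fin powR_ge0.
transitivity (leb `[ln x, ln y]); last first.
  by rewrite lebesgue_measure_itvcc ?ler_ln ?posrE// ln_div ?posrE.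
rewrite -[RHS]mul1e -[RHS]integral_cst// [RHS]integral_mkcond.
apply: eq_integral => s _; rewrite !patchE.
have -> : (expR s \in `[x, y]%classic) = (s \in `[ln x, ln y]%classic).
  have E : (x <= expR s <= y) = (ln x <= s <= ln y).
    by rewrite -{1}(lnK x0) -{1}(lnK y0) !ler_expR.
  by apply/idP/idP => /set_mem/=; rewrite in_itv/= => h; apply/mem_set; rewrite /= in_itv/= ?E// -E.
case: ifPn => _; last by rewrite mul0e.
by rewrite /= -EFinM powR_inv1 ?expR_ge0// mulVf// gt_eqF// expR_gt0.
Qed.

End test_functions.

Section infinite_potentials.
Context {R : realType}.
Notation leb := (@lebesgue_measure R).
Implicit Types (k : R -> \bar R) (G : R -> R) (p : \bar R) (Q t s u r : R).

Definition reflected k u := k (- u).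

Lemma kernel_profile_reflected (be sg : R) k :
  kernel_profile be sg k -> kernel_profile be sg (reflected k).
Proof.
case=> mk [c c0 kc] h1 h2 h3 h4; split.
- exact: (measurableT_comp mk).
- by exists c => // u; rewrite -normrN.
- by move=> /h1[d d0 kd]; exists d => // u; rewrite -normrN; exact: kd.
- by move=> /h2 H M; have [e e0 He] := H M; exists e => // u; rewrite -normrN; exact: He.
- move=> t t0 t2; have [C C0 kC] := h3 t t0 t2; exists C => // u u0.
  by rewrite -normrN; apply: kC; rewrite oppr_eq0.
- by move=> /h4[C C0 kC]; exists C => // u; rewrite -normrN; exact: kC.
Qed.

(** Reflection changes the sign of the tilt; hence it suffices to construct
    counterexamples for positive tilts. *)
Lemma potential_reflected (be sg : R) k Q G t : kernel_profile be sg k ->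
  measurable_fun setT G -> (forall s, 0 <= G s) ->
  potential (tilted (- Q) (reflected k)) G t =
  potential (tilted Q k) (fun s => G (- s)) (- t).
Proof.
move=> hk mG G0; rewrite /potential -ge0_integralN; last 2 first.
- apply: measurable_potential_integrand => //.
  exact: (measurable_tilted (kernel_profile_reflected hk)).
- move=> s; apply: mule_ge0; last by rewrite lee_fin.
  exact: (tilted_ge0 (kernel_profile_reflected hk)).
apply: eq_integral => s _; congr (_ * _)%E; rewrite /tilted /reflected.
by congr ((expR _)%:E * k _)%E; ring.
Qed.

Variables (be sg : R) (k : R -> \bar R).
Hypothesis hk : kernel_profile be sg k.

(** Where the tilt has the sign that favours it, it competes with the decay of the
    kernel alone. *)
Lemma tilted_ge : exists2 c : R, 0 < c & forall Q u,
  ((c * expR (- (Q * u) - be * `|u|))%:E <= tilted Q k u)%E.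
Proof.
have [c c0 kc] := profile_ge hk; exists c => // Q u.
apply: le_trans (lee_wpmul2l _ (kc u)); last by rewrite lee_fin expR_ge0.
by rewrite -EFinM lee_fin expRD mulrCA.
Qed.

Lemma potential_ge_setI Q G t (A : set R) (w : R -> R) : measurable_fun setT G ->
  (forall s, 0 <= G s) -> measurable A -> measurable_fun setT w ->
  (forall s, A s -> 0 <= w s) ->
  (forall s, A s -> ((w s)%:E <= tilted Q k (t - s) * (G s)%:E)%E) ->
  (\int[leb]_(s in A) (w s)%:E <= potential (tilted Q k) G t)%E.
Proof.
move=> mG G0 mA mw w0 wG; have tk0 := tilted_ge0 hk Q.
have mI : measurable_fun setT (fun s => tilted Q k (t - s)%R * (G s)%:E)%E.
  by apply: measurable_potential_integrand => //; exact: (measurable_tilted hk).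
have I0 s : (0 <= tilted Q k (t - s)%R * (G s)%:E)%E by apply: mule_ge0; rewrite ?lee_fin.
apply: (@le_trans _ _ (\int[leb]_(s in A) (tilted Q k (t - s)%R * (G s)%:E))%E).
  apply: ge0_le_integral => //.
  - by apply/measurable_EFinP; exact: measurable_funTS.
  - exact: measurable_funTS.
exact: ge0_subset_integral.
Qed.

(** The function 1 / s on s >= 1 is in L^p for every p > 1 but not integrable, while
    the tilted kernel is bounded below for s > t. *)
Lemma tail_test_function p Q : (1 < p)%E -> be <= Q -> exists G,
  [/\ measurable_fun setT G, forall s, 0 <= G s, ('N[leb]_p[EFin \o G] < +oo)%E &
      forall t, potential (tilted Q k) G t = +oo%E].
Proof.
move=> p1 Qbe; pose A : set R := `[1, +oo[%classic.
pose G s : R := \1_A s * s `^ (-1).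
have AE s : \1_A s = (1 <= s)%R%:R :> R.
  rewrite indicE; congr ((_ : bool)%:R).
  by apply/idP/idP => [/set_mem|h]; [|apply/mem_set]; rewrite /A/= in_itv/= andbT.
have m1A : measurable_fun setT (\1_A : R -> R).
  by apply: measurable_indic; exact: measurable_itv.
have mG : measurable_fun setT G.
  by apply: measurable_funM => //; exact: measurable_powR.
have G0 s : 0 <= G s by rewrite mulr_ge0 ?powR_ge0// AE.
have G1 s : G s <= 1.
  rewrite /G AE; case: (leP 1 s) => [s1|_]; last by rewrite mul0r.
  by rewrite mul1r powR_inv1 ?invf_le1// ?(le_trans ler01)// (lt_le_trans ltr01).
exists G; split => //.
- case: p p1 => [r| |]// r1; last first.
    apply: le_lt_trans (ltry 1); apply: Lnormy_le_bound => s; by rewrite lee_fin.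
  rewrite lte_fin in r1; have r0 : 0 < r by exact: lt_trans r1.
  have r10 : 0 < r - 1 by rewrite subr_gt0.
  apply: le_lt_trans (ltry ((1 / (r - 1)) `^ r^-1)).
  apply: Lnorm_le_root => //.
  have -> : (\int[leb]_s ((EFin \o G) s `^ r) =
     \int[leb]_(s in `]0%R, +oo[) (\1_A s * s `^ (- r))%:E)%E.
    rewrite [RHS]integral_mkcond; apply: eq_integral => s _; rewrite patchE /= /G AE.
    case: ifPn => [_|]; last first.
      rewrite notin_setE/= in_itv/= andbT => /negP; rewrite -leNgt => s0.
      by rewrite leNgt (le_lt_trans s0)//= mul0r powR0// gt_eqF.
    case: (leP 1 s) => _; last by rewrite !mul0r powR0// gt_eqF.
    by rewrite !mul1r -powRrM mulN1r.
  rewrite ge0_integral_expR; last 2 first.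
  - apply/measurable_EFinP; by apply: measurable_funM => //; exact: measurable_powR.
  - by move=> s; rewrite AE lee_fin mulr_ge0 ?powR_ge0.
  have -> : (1 / (r - 1))%:E = (\int[leb]_(v in `[0%R, +oo[) (expR (- ((r - 1) * v)))%:E)%E.
    by rewrite integral_expRM_gey// mulr0 oppr0 expR0.
  rewrite [leRHS]integral_mkcond; apply: ge0_le_integral => //.
  - apply: emeasurable_funM; apply/measurable_EFinP; last exact: measurable_expR.
    apply: (measurableT_comp (f := fun s : R => \1_A s * s `^ (- r))); last exact: measurable_expR.
    by apply: measurable_funM => //; exact: measurable_powR.
  - apply: measurable_patch_EFin => //; under eq_fun do rewrite -mulNr.
    exact: measurable_expRM.
  - move=> v _; rewrite AE -EFinM patchE; case: (leP 1 (expR v)) => [v1|_]; last first.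
      by rewrite !mul0r; case: ifP => // _; rewrite lee_fin expR_ge0.
    rewrite mem_set/=; last by rewrite in_itv/= andbT -ler_expR expR0.
    rewrite mul1r -expRM -expRD lee_fin ler_expR; lra.
- move=> t; apply/eqyP => L L0; pose M := Num.max 1 t.
  have M0 : 0 < M by rewrite lt_max ltr01.
  have [c c0 kc] := tilted_ge; pose n := L / c.
  have n0 : 0 <= n by rewrite divr_ge0 ?ltW.
  pose N := M * expR n.
  have MM : M <= N by rewrite ler_peMr ?(ltW M0)// -expR0 ler_expR.
  apply: (@le_trans _ _ (\int[leb]_(s in `[M, N]) (c * s^-1)%:E)%E).
    under eq_integral do rewrite EFinM.
    rewrite ge0_integralZl//; last 3 first.
    - exact: measurable_inv_itv.
    - move=> s /=; rewrite in_itv/= => /andP[Ms _].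
      by rewrite lee_fin invr_ge0 (le_trans (ltW M0)).
    - by rewrite lee_fin ltW.
    rewrite integral_inv_itv// /N mulrAC mulfV ?gt_eqF// mul1r expRK -EFinM lee_fin.
    by rewrite /n mulrC divfK// gt_eqF.
  have -> : (\int[leb]_(s in `[M, N]) (c * s^-1)%:E =
             \int[leb]_(s in `[M, N]) (c * s `^ (-1))%:E)%E.
    apply: eq_integral => s; rewrite inE/= in_itv/= => /andP[Ms _].
    by rewrite powR_inv1// (le_trans (ltW M0)).
  apply: potential_ge_setI => //.
  - by apply: measurable_funM => //; exact: measurable_powR.
  - by move=> s _; rewrite mulr_ge0 ?powR_ge0// ltW.
  - move=> s /=; rewrite in_itv/= => /andP[Ms _].
    (* to the right of t the tilt is at least as strong as the decay *)
    have [s1 st] : 1 <= s /\ t <= s by move: Ms; rewrite ge_max => /andP[].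
    rewrite EFinM; apply: lee_pmul; rewrite ?lee_fin ?powR_ge0 ?(ltW c0)//; last first.
      by rewrite /G AE s1 mul1r.
    apply: le_trans (kc Q _); rewrite lee_fin ler_peMr ?(ltW c0)// -expR0 ler_expR.
    rewrite ler0_norm ?subr_le0//; nra.
Qed.

(** For p = 1 the tilted kernel grows like exp (d u) with d > 0 in one direction,
    and an exponential decaying at the same rate makes the integrand bounded
    below. *)
Lemma exponential_test_function Q : be < Q -> exists G,
  [/\ measurable_fun setT G, forall s, 0 <= G s, ('N[leb]_1[EFin \o G] < +oo)%E &
      forall t, potential (tilted Q k) G t = +oo%E].
Proof.
move=> Qbe; pose d := Q - be; have d0 : 0 < d by rewrite subr_gt0.
exists (fun s => expR (- (d * `|s|))); split.
- exact: measurable_expRNabs.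
- by move=> s; exact: expR_ge0.
- rewrite Lnorm1; under eq_integral do rewrite /= ger0_norm ?expR_ge0//.
  by rewrite integral_expRNabs// ltry.
move=> t; apply/eqyP => L L0; pose M := Num.max 0 t.
have [c c0 kc] := tilted_ge; pose c' := c * expR (- (d * t)).
have c'0 : 0 < c' by rewrite mulr_gt0 ?expR_gt0.
have n0 : 0 <= L / c' by rewrite divr_ge0 ?ltW.
pose N := M + L / c'.
apply: (@le_trans _ _ (\int[leb]_(s in `[M, N]) (c')%:E)%E).
  have := integral_cst leb (D := `[M, N]%classic) (measurable_itv _) c'%:E.
  move=> /= ->; rewrite lebesgue_measure_itvcc ?lerDl// -EFinM lee_fin.
  by rewrite /N addrAC subrr add0r mulrC divfK// gt_eqF.
apply: (potential_ge_setI (w := fun=> c')) => //.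
- exact: measurable_expRNabs.
- by move=> s _; exact: ltW.
- move=> s /=; rewrite in_itv/= => /andP[Ms _].
  have [s0 st] : 0 <= s /\ t <= s by move: Ms; rewrite ge_max => /andP[].
  have h := kc Q (t - s); apply: le_trans (lee_wpmul2r _ h); last by rewrite lee_fin expR_ge0.
  rewrite -EFinM lee_fin /c' -mulrA ler_wpM2l ?(ltW c0)// -expRD ler_expR.
  rewrite (ler0_norm (x := t - s)) ?subr_le0// ger0_norm// /d; lra.
Qed.

End infinite_potentials.

Section necessity.
Context {R : realType}.
Notation leb := (@lebesgue_measure R).
Implicit Types (k : R -> \bar R) (G : R -> R) (p q : \bar R) (t s u v x y w : R).

Lemma Lnorm_reflected p G : (1 <= p)%E -> measurable_fun setT G ->
  (forall s, 0 <= G s) -> ('N[leb]_p[EFin \o G] < +oo)%E ->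
  ('N[leb]_p[EFin \o (fun s => G (- s)%R)] < +oo)%E.
Proof.
case: p => [r| |]// p1 mG G0 GN.
  rewrite lee_fin in p1; have r0 : 0 < r by exact: lt_le_trans p1.
  suff -> : ('N[leb]_r%:E[EFin \o (fun s => G (- s)%R)] = 'N[leb]_r%:E[EFin \o G])%E by [].
  rewrite unlock; apply: (congr1 (poweR^~ r^-1)).
  rewrite -[RHS]ge0_integralN//; last by move=> s; exact: poweR_ge0.
  apply: (measurableT_comp (measurable_poweR r)).
  by apply: measurableT_comp => //; exact/measurable_EFinP.
have [c cE] : exists c, ('N[leb]_+oo[EFin \o G])%E = c%:E.
  by exists (fine ('N[leb]_+oo[EFin \o G])%E); rewrite fineK// ge0_fin_numE// Lnorm_ge0.
have [N [mN N0 FN]] : {ae leb, forall s, ((G s)%:E <= c%:E)%E}.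
  apply/Lnormy_leP; first exact: lebesgue_measureT_gt0.
    by move=> s; rewrite lee_fin.
  by rewrite -cE; exact: lexx.
apply: le_lt_trans (ltry c); apply/Lnormy_leP; first exact: lebesgue_measureT_gt0.
  by move=> s; rewrite lee_fin.
exists (-%R @^-1` N); split; first by rewrite -[X in measurable X]setTI; exact: oppr_measurable.
  by rewrite -N0; exact: lebesgue_measureN.
by move=> s /= h; apply: FN.
Qed.

Theorem tilt_lt_of_ae_finite (be sg : R) k p (Q : R) :
  kernel_profile be sg k -> (1 <= p)%E ->
  (forall G, measurable_fun setT G -> (forall s, 0 <= G s) ->
    ('N[leb]_p[EFin \o G] < +oo)%E ->
    {ae leb, forall t, (potential (tilted Q k) G t < +oo)%E}) ->
  `|Q| < be ?<= if (p == 1%E).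
Proof.
move=> hk p1 H.
have bad k' Q' : kernel_profile be sg k' -> ~~ (Q' < be ?<= if (p == 1%E)) -> exists G,
    [/\ measurable_fun setT G, forall s, 0 <= G s, ('N[leb]_p[EFin \o G] < +oo)%E &
      forall t, potential (tilted Q' k') G t = +oo%E].
  move=> hk'; case: eqVneq => [->|pn1] /=.
    by rewrite -ltNge => h; exact: (exponential_test_function hk' h).
  by rewrite -leNgt => h; apply: (tail_test_function hk' _ h); rewrite lt_neqAle eq_sym pn1.
have absurd (F : R -> \bar R) : {ae leb, forall t, (F t < +oo)%E} ->
    (forall t, F t = +oo%E) -> False.
  move=> [N [mN N0 FN]] Fy; have := @lebesgue_measureT_gt0 R.
  rewrite ltNge => /negP; apply; rewrite -N0; apply: le_measure; rewrite ?inE//.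
  by move=> t _; apply: FN => /=; rewrite Fy.
have [Q0|Q0] := leP 0 Q.
  rewrite ger0_norm//; apply: contrapT => /negP /(bad _ _ hk)[G [mG G0 GN GT]].
  exact: absurd (H G mG G0 GN) GT.
rewrite ltr0_norm//; apply: contrapT.
move=> /negP /(bad _ _ (kernel_profile_reflected hk))[G [mG G0 GN GT]].
have mGN : measurable_fun setT (fun s => G (- s)).
  by apply: (measurableT_comp mG); exact: oppr_measurable.
have GN0 s : 0 <= G (- s) by exact: G0.
have [N [mN N0 FN]] := H _ mGN GN0 (Lnorm_reflected p1 mG G0 GN).
apply: (absurd (potential (tilted Q k) (fun s => G (- s)))) => [|t].
  by exists N.
by rewrite -[t]opprK -(potential_reflected _ _ hk mG G0).
Qed.

Section norm_bound.
Variables (be sg : R) (k : R -> \bar R) (p q : \bar R) (theta Q C : R).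
Hypothesis hk : kernel_profile be sg k.
Hypothesis p1 : (1 <= p)%E.
Hypothesis q1 : (1 <= q)%E.
Hypothesis C0 : 0 < C.
Hypothesis sg0 : 0 < sg.

Let T G t := ((expR (theta * t))%:E * potential (tilted Q k) G t)%E.

Hypothesis bound : forall G, measurable_fun setT G -> (forall s, 0 <= G s) ->
  ('N[leb]_p[EFin \o G] < +oo)%E -> ('N[leb]_q[T G] <= C%:E * 'N[leb]_p[EFin \o G])%E.

Let measurable_T G : measurable_fun setT G -> (forall s, 0 <= G s) ->
  measurable_fun setT (T G).
Proof.
move=> mG G0; apply: emeasurable_funM.
  by apply/measurable_EFinP; exact: measurable_expRM.
by apply: measurable_potential => //; [exact: (measurable_tilted hk)|exact: (tilted_ge0 hk)].
Qed.

Let T_ge0 G t : (forall s, 0 <= G s) -> (0 <= T G t)%E.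
Proof.
move=> G0; apply: mule_ge0; first by rewrite lee_fin expR_ge0.
by apply: potential_ge0 => //; exact: (tilted_ge0 hk).
Qed.

(** A lower bound of the potential on an interval against an upper bound of the
    norm of the test function; most of the necessary conditions come from this. *)
Lemma bound_on_itv G n x y c : measurable_fun setT G -> (forall s, 0 <= G s) ->
  ('N[leb]_p[EFin \o G] <= n%:E)%E -> x < y -> 0 <= c ->
  (forall t, x <= t <= y -> (c%:E <= T G t)%E) ->
  c * (y - x) `^ rexp q <= C * n.
Proof.
move=> mG G0 Gn xy c0 cT; rewrite -lee_fin [leRHS]EFinM.
apply: (@le_trans _ _ (C%:E * 'N[leb]_p[EFin \o G])%E); last first.
  by apply: lee_wpmul2l; rewrite ?lee_fin ?(ltW C0).
apply: le_trans (bound mG G0 (le_lt_trans Gn (ltry _))).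
apply: (@Lnorm_ge_on R q (T G) `[x, y]%classic c (y - x)) => //.
- exact: measurable_T.
- by move=> t; exact: T_ge0.
- by rewrite lebesgue_measure_itvcc// ltW.
- by rewrite subr_gt0.
Qed.

Let mI x y : measurable_fun setT (\1_(`[x, y]%classic) : R -> R).
Proof. by apply: measurable_indic; exact: measurable_itv. Qed.

Let I0 x y s : 0 <= \1_(`[x, y]%classic) s :> R.
Proof. by rewrite indicE ler0n. Qed.

Let IN x y : x <= y ->
  ('N[leb]_p[EFin \o (\1_(`[x, y]%classic) : R -> R)] <= ((y - x) `^ rexp p)%:E)%E.
Proof.
move=> xy; apply: Lnorm_indic_le => //; first by rewrite lebesgue_measure_itvcc.
by rewrite subr_ge0.
Qed.

Lemma potential_indic_ge x y l r w t : x <= l -> l <= r -> r <= y -> 0 <= w ->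
  (forall s, l <= s <= r -> (w%:E <= tilted Q k (t - s))%E) ->
  ((w * (r - l))%:E <= potential (tilted Q k) \1_(`[x, y]%classic) t)%E.
Proof.
move=> xl lr ry w0 wk; apply: integral_ge_itv => //.
- apply: measurable_potential_integrand => //; exact: (measurable_tilted hk).
- by move=> s; apply: mule_ge0; [exact: (tilted_ge0 hk)|rewrite lee_fin].
move=> s /andP[ls sr]; rewrite indicE mem_set/= ?mule1; first by apply: wk; rewrite ls.
by rewrite in_itv/= (le_trans xl)//= (le_trans sr).
Qed.

Lemma bound_indic x y x' y' c : x <= y -> x' < y' -> 0 <= c ->
  (forall t, x' <= t <= y' ->
    ((c * expR (- (theta * t)))%:E <= potential (tilted Q k) \1_(`[x, y]%classic) t)%E) ->
  c * (y' - x') `^ rexp q <= C * (y - x) `^ rexp p.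
Proof.
move=> xy xy' c0 H; apply: (bound_on_itv (mI x y) (I0 x y) (IN xy) xy' c0) => t /H h.
apply: le_trans (lee_wpmul2l _ h); last by rewrite lee_fin expR_ge0.
by rewrite -EFinM lee_fin mulrCA -expRD subrr expR0 mulr1.
Qed.

Lemma tilted_ge_near : exists2 c, 0 < c & forall u, `|u| <= 1 -> (c%:E <= tilted Q k u)%E.
Proof.
have [c c0 kc] := tilted_ge hk; exists (c * expR (- `|Q| - `|be|)).
  by rewrite mulr_gt0 ?expR_gt0.
move=> u u1; apply: le_trans (kc Q u); rewrite lee_fin ler_wpM2l ?(ltW c0)//.
rewrite ler_expR lerB ?lerN2//.
  apply: le_trans (ler_norm _) _; rewrite normrM ler_piMr//.
apply: le_trans (ler_norm _) _; rewrite normrM normr_id ler_piMr//.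
Qed.

(** Translate the indicator of [0, 1] by h: its norm is constant, whereas its
    image is at least a multiple of exp (theta h) on the translated interval. *)
Lemma theta_eq0 : theta = 0.
Proof.
have [c c0 kc] := tilted_ge_near; pose d := c * expR (- `|theta|).
have d0 : 0 < d by rewrite mulr_gt0 ?expR_gt0.
have H h : d * expR (theta * h) <= C.
  have := @bound_indic h (h + 1) h (h + 1) (d * expR (theta * h)).
  rewrite addrAC subrr add0r !powR1 !mulr1; apply; rewrite ?lerDl ?ltrDl//.
    by rewrite mulr_ge0 ?expR_ge0 ?ltW.
  move=> t /andP[ht th].
  apply: le_trans (@potential_indic_ge h (h + 1) h (h + 1) c t _ _ _ _ _) => //.
  - rewrite addrAC subrr add0r mulr1 lee_fin /d -!mulrA ler_piMr ?(ltW c0)//.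
    rewrite -!expRD -[leRHS]expR0 ler_expR.
    have : theta * (h - t) <= `|theta|.
      apply: le_trans (ler_norm _) _; rewrite normrM ler_piMr// ler_norml; lra.
    lra.
  - by rewrite lerDl.
  - exact: ltW.
  - by move=> s /andP[hs sh]; apply: kc; rewrite ler_norml; lra.
apply/eqP; rewrite eq_le; apply/andP; split.
  by apply: (expR_growth d0) => v _; rewrite mul0r expR0 mulr1; exact: H.
rewrite -oppr_le0; apply: (expR_growth d0 (d := C)) => v _; rewrite mul0r expR0 mulr1.
by have := H (- v); rewrite mulrN -mulNr.
Qed.

(** The image of the indicator of a long interval is bounded below on half of the
    interval. *)
Lemma rexp_le : rexp q <= rexp p.
Proof.
have [c c0 kc] := tilted_ge_near.
apply: (@expR_growth R c (C * 2 `^ rexp p)) => // v v0.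
have e1 : 1 <= expR v by rewrite -expR0 ler_expR.
have e0 : 0 <= expR v by exact: expR_ge0.
have := @bound_indic 0 (2 * expR v) 0 (expR v) c.
rewrite !subr0 powRM// -mulrA => H.
have ee r : expR (r * v) = expR v `^ r by rewrite mulrC expRM.
rewrite !ee; apply: (H (mulr_ge0 (ler0n _ 2) e0) (expR_gt0 v) (ltW c0)).
move=> t /andP[t0 tv]; rewrite theta_eq0 mul0r oppr0 expR0 mulr1.
have -> : c = c * ((t + 1) - t) by rewrite addrAC subrr add0r mulr1.
apply: potential_indic_ge; rewrite ?(ltW c0)//; first by rewrite lerDl.
- by apply: (le_trans (lerD tv e1)); lra.
- by move=> s /andP[ts st]; apply: kc; rewrite ler_norml; lra.
Qed.

(** If |Q| >= be the image of the indicator of [0, 1] is bounded below on a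
    half-line, so its norm is infinite unless q = oo. *)
Lemma tilt_lt : 0 < rexp q -> `|Q| < be.
Proof.
move=> rq0; rewrite ltNge; apply/negP => beQ.
have [c c0 kc] := tilted_ge hk.
have kc1 u : 0 <= - (Q * u) - be * `|u| -> (c%:E <= tilted Q k u)%E.
  move=> u0; apply: le_trans (kc Q u); rewrite lee_fin ler_peMr ?(ltW c0)//.
  by rewrite -expR0 ler_expR.
suff : rexp q <= 0 by rewrite leNgt rq0.
apply: (@expR_growth R c C) => // v v0; rewrite mul0r expR0 mulr1.
have ev := expR_gt0 v; rewrite (mulrC (rexp q)) expRM.
have CE : C * (1 - 0) `^ rexp p = C by rewrite subr0 powR1 mulr1.
have [Q0|Q0] := leP Q 0; have Qn : `|Q| = (if Q <= 0 then - Q else Q).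
- by rewrite Q0 ler0_norm.
- have := @bound_indic 0 1 1 (1 + expR v) c.
  have -> : 1 + expR v - 1 = expR v by ring.
  rewrite CE; apply; rewrite ?ltrDl ?(ltW c0)//.
  move=> t /andP[t1 _]; rewrite theta_eq0 mul0r oppr0 expR0 mulr1.
  have -> : c%:E = (c * (1 - 0))%:E by rewrite subr0 mulr1.
  apply: potential_indic_ge; rewrite ?(ltW c0)// => s /andP[s0 s1]; apply: kc1.
  rewrite Q0 in Qn; rewrite ger0_norm; last by lra.
  nra.
- by rewrite leNgt Q0/= gtr0_norm.
- have := @bound_indic 0 1 (- expR v) 0 c.
  rewrite CE opprK add0r; apply; rewrite ?oppr_lt0 ?(ltW c0)//.
  move=> t /andP[_ t0]; rewrite theta_eq0 mul0r oppr0 expR0 mulr1.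
  have -> : c%:E = (c * (1 - 0))%:E by rewrite subr0 mulr1.
  apply: potential_indic_ge; rewrite ?(ltW c0)// => s /andP[s0 s1]; apply: kc1.
  rewrite leNgt Q0/= in Qn; rewrite ler0_norm; last by lra.
  nra.
Qed.

Lemma tilted_sing_ge : sg < 1 / 2 -> exists2 c, 0 < c & forall u, `|u| <= 1 ->
  ((c * `|u| `^ (2 * sg - 1))%:E <= tilted Q k u)%E.
Proof.
move=> sg2; have [c c0 kc] := profile_sing_ge hk sg2.
exists (expR (- `|Q|) * c); first by rewrite mulr_gt0 ?expR_gt0.
move=> u u1; apply: le_trans (lee_wpmul2l _ (kc u u1)); last by rewrite lee_fin expR_ge0.
rewrite -EFinM lee_fin -mulrA ler_wpM2r ?mulr_ge0 ?powR_ge0 ?(ltW c0)//.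
rewrite ler_expR lerN2; apply: le_trans (ler_norm _) _.
by rewrite normrM ler_piMr.
Qed.

(** The image of the indicator of [0, e] is at least a multiple of e^(2 sigma) on
    [2 e, 3 e], at a distance from the support that avoids the diagonal. *)
Lemma rexp_sub_le : rexp p - 2 * sg <= rexp q.
Proof.
have rp1 := rexp_le1 p1; have rq0 := rexp_ge0 q1.
have [sg2|sg2] := leP (1 / 2) sg; first by lra.
have [c c0 kc] := tilted_sing_ge sg2.
suff : - (2 * sg + rexp q) <= - rexp p by lra.
pose c' := c * 3 `^ (2 * sg - 1).
have c'0 : 0 < c' by rewrite mulr_gt0// powR_gt0.
apply: (@expR_growth_from R 2 c' C) => // v v0.
pose e := expR (- v); have e0 : 0 < e by exact: expR_gt0.
have e1 : 3 * e <= 1.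
  rewrite /e expRN ler_pdivrMr ?expR_gt0// mul1r.
  by apply: le_trans (expR_ge1Dx v); lra.
have ee r : expR (- r * v) = e `^ r by rewrite /e -expRM mulNr mulrC mulNr.
rewrite !ee.
have := @bound_indic 0 e (2 * e) (3 * e) (c' * e `^ (2 * sg)).
have -> : 3 * e - 2 * e = e by ring.
rewrite subr0 -mulrA -powRD; last by rewrite (gt_eqF e0) implybT.
have ce0 r : 0 <= c' * e `^ r by rewrite (mulr_ge0 (ltW c'0))// powR_ge0.
have e23 : 2 * e < 3 * e by lra.
apply => //; first exact: ltW.
move=> t /andP[te et]; rewrite theta_eq0 mul0r oppr0 expR0 mulr1.
have -> : e `^ (2 * sg) = e `^ (2 * sg - 1) * (e - 0).
  by rewrite subr0 -{3}(powRr1 (ltW e0)) -powRD ?subrK// (gt_eqF e0) implybT.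
rewrite mulrA; apply: potential_indic_ge => //; first exact: ltW.
move=> s /andP[s0 se].
have u0 : 0 < t - s by lra.
have u1 : `|t - s| <= 1 by rewrite gtr0_norm//; lra.
apply: le_trans (kc _ u1); rewrite lee_fin /c' -mulrA -powRM ?(ltW e0)//.
rewrite ler_wpM2l ?(ltW c0)// gtr0_norm// -(opprB 1).
by apply: powRN_anti; lra.
Qed.

(** In case of equality and q < oo the image of the indicator of [0, e] is at least a
    multiple of e t^(- 1/q) on [e, 1], which costs a logarithm of e.  If also
    q = oo then sigma = 1/2 and the kernel is unbounded at the origin. *)
Lemma rexp_sub_lt_p1 : p = 1%E -> rexp p - 2 * sg < rexp q.
Proof.
move=> p1'; rewrite lt_neqAle rexp_sub_le andbT; apply/negP => /eqP.
rewrite p1' rexp_EFin// invr1 => E.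
have [rq0|rqn0] := eqVneq (rexp q) 0.
  have sg2 : sg = 1 / 2 by rewrite rq0 in E; lra.
  pose M := (C + 1) * expR `|Q|.
  have [e e0 ke] := profile_log_ge hk sg2 M.
  pose d : R := Num.min e 1; have d0 : 0 < d by rewrite lt_min e0 ltr01.
  have := @bound_indic 0 d 0 d ((C + 1) * d).
  rewrite !subr0 rq0 p1' rexp_EFin// invr1 powRr0 powRr1 ?(ltW d0)// mulr1.
  have Cd0 : 0 <= (C + 1) * d by rewrite mulr_ge0 ?(ltW d0)// addr_ge0// ltW.
  move=> B; suff H : (forall t, 0 <= t <= d -> (((C + 1) * d * expR (- (theta * t)))%:E <=
      potential (tilted Q k) \1_(`[0%R, d]%classic) t)%E).
    by have := B isT d0 Cd0 H; rewrite ler_pM2r// gerDl ler10.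
  move=> t /andP[t0 td]; rewrite theta_eq0 mul0r oppr0 expR0 mulr1 -{1}(subr0 d).
  apply: potential_indic_ge => //; rewrite ?(ltW d0) ?addr_ge0 ?(ltW C0)//.
  move=> s /andP[s0 sd]; have ts : `|t - s| <= d by rewrite ler_norml; lra.
  have [tse ts1] : `|t - s| <= e /\ `|t - s| <= 1 by move: ts; rewrite le_min => /andP.
  apply: le_trans (lee_wpmul2l _ (ke _ tse)); last by rewrite lee_fin expR_ge0.
  rewrite -EFinM lee_fin /M mulrCA -{1}[C + 1]mulr1 ler_wpM2l ?addr_ge0 ?(ltW C0)//.
  rewrite -expRD -expR0 ler_expR.
  suff : Q * (t - s) <= `|Q| by lra.
  by apply: le_trans (ler_norm _) _; rewrite normrM ler_piMr.
have rq0 : 0 < rexp q by rewrite lt_neqAle eq_sym rqn0 rexp_ge0.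
have sg2 : sg < 1 / 2 by lra.
have [c c0 kc] := tilted_sing_ge sg2.
have [r r0 qr] : exists2 r : R, 0 < r & q = r%:E.
  case: q q1 rq0 => [r r1 _|_|//]; last by rewrite rexpy ltxx.
  by exists r; rewrite // (lt_le_trans ltr01).
have rE : (1 - 2 * sg) * r = 1.
  by rewrite E qr rexp_EFin// mulVf// gt_eqF.
have sg3 : 0 <= 1 - 2 * sg by lra.
pose c2 := c / 2; have c20 : 0 < c2 by rewrite divr_gt0.
have H L : 0 <= L -> c2 `^ r * L <= C `^ r.
  move=> L0; pose e := expR (- L); have e0 : 0 < e by exact: expR_gt0.
  have e1 : e <= 1 by rewrite -expR0 ler_expR oppr_le0.
  have GN := IN (ltW e0); rewrite subr0 in GN.
  have := bound (mI 0 e) (I0 0 e) (le_lt_trans GN (ltry _)).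
  move=> /le_trans/(_ (lee_wpmul2l (ltW C0 : (0 <= C%:E)%E) GN)).
  rewrite p1' rexp_EFin// invr1 powRr1 ?(ltW e0)// -EFinM qr => B.
  have Ce0 : 0 <= C * e by rewrite mulr_ge0 ?ltW.
  have T0 t := T_ge0 t (I0 0 e).
  have {}B : (\int[leb]_t T \1_(`[0%R, e]%classic) t `^ r <= ((C * e) `^ r)%:E)%E.
    by apply/Lnorm_EFin_leP.
  have mTr : measurable_fun setT (fun t => T \1_(`[0%R, e]%classic) t `^ r)%E.
    by apply: (measurableT_comp (measurable_poweR r)); apply: measurable_T.
  suff : ((c2 * e) `^ r * L <= (C * e) `^ r).
    rewrite (powRM _ (ltW c20) (ltW e0)) (powRM _ (ltW C0) (ltW e0)) mulrAC.
    by rewrite ler_pM2r ?powR_gt0.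
  rewrite -lee_fin; apply: le_trans B.
  apply: (@le_trans _ _ (\int[leb]_(t in `[e, 1%R]) (T \1_(`[0%R, e]%classic) t `^ r))%E); last first.
    by apply: ge0_subset_integral => // t _; exact: poweR_ge0.
  have LE : L = ln (1 / e) by rewrite /e expRN div1r invrK expRK.
  rewrite EFinM {1}LE -integral_inv_itv// -ge0_integralZl//; last 3 first.
  - exact: measurable_inv_itv.
  - move=> s /=; rewrite in_itv/= => /andP[es _].
    by rewrite lee_fin invr_ge0 (le_trans (ltW e0)).
  - by rewrite lee_fin powR_ge0.
  apply: ge0_le_integral => //.
  - move=> s /=; rewrite in_itv/= => /andP[es _]; rewrite -EFinM lee_fin.
    by rewrite mulr_ge0 ?powR_ge0// invr_ge0 (le_trans (ltW e0)).
  - by apply: emeasurable_funM => //; exact: measurable_inv_itv.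
  - exact: measurable_funTS.
  move=> t /=; rewrite in_itv/= => /andP[et t1]; have t0 := lt_le_trans e0 et.
  have w0 : 0 <= c * t `^ (2 * sg - 1) * (e / 2).
    by rewrite !mulr_ge0 ?powR_ge0// ltW.
  apply: (@le_trans _ _ ((c * t `^ (2 * sg - 1) * (e / 2))%:E `^ r)%E).
    rewrite -EFinM poweR_EFin lee_fin.
    have -> : c * t `^ (2 * sg - 1) * (e / 2) = (c2 * e) * t `^ (2 * sg - 1).
      by rewrite /c2; field.
    rewrite (powRM _ (mulr_ge0 (ltW c20) (ltW e0)) (powR_ge0 _ _)) -powRrM.
    have -> : (2 * sg - 1) * r = - 1 by rewrite -(opprB 1) mulNr rE.
    by rewrite powR_inv1// ltW.
  apply: gt0_ler_poweR; rewrite ?(ltW r0)// ?in_itv/= ?leey ?andbT ?lee_fin//.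
  rewrite /T theta_eq0 mul0r expR0 mul1e -[X in (_ * X)%:E]subr0.
  apply: potential_indic_ge => //; rewrite ?mulr_ge0 ?powR_ge0 ?(ltW c0)//; [lra|lra|].
  move=> s /andP[s0 se]; have u0 : 0 < t - s by lra.
  have u1 : `|t - s| <= 1 by rewrite gtr0_norm//; lra.
  apply: le_trans (kc _ u1); rewrite lee_fin ler_wpM2l ?(ltW c0)// gtr0_norm//.
  by rewrite -(opprB 1); apply: powRN_anti; rewrite // gerBl.
have /H : 0 <= C `^ r / c2 `^ r + 1 by rewrite addr_ge0// divr_ge0 ?powR_ge0.
have c2r : 0 < c2 `^ r by rewrite powR_gt0.
rewrite mulrDr mulr1 mulrC divfK ?gt_eqF//; lra.
Qed.

(** For q = oo and 2 sigma = 1/p the function s^(- 1/p) on [e, 1/2] has norm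
    L^(1/p) with L the logarithm of 1 / (2 e), but its image on [- e, 0] is at
    least a multiple of L. *)
Lemma rexp_sub_lt_qy : q = +oo%E -> rexp p - 2 * sg < rexp q.
Proof.
move=> qy; have [|pn1] := eqVneq p 1%E; first exact: rexp_sub_lt_p1.
rewrite lt_neqAle rexp_sub_le andbT; apply/negP => /eqP.
rewrite qy rexpy => /eqP; rewrite subr_eq0 => /eqP E.
have [r r1 pr] : exists2 r : R, 1 < r & p = r%:E.
  case: p p1 pn1 E => [r r1 rn1 _|_ _|//].
    by exists r => //; rewrite lt_neqAle eq_sym rn1.
  by rewrite rexpy => E; have := sg0; lra.
have r0 : 0 < r by exact: lt_trans r1.
rewrite pr rexp_EFin// in E.
have ir1 : r^-1 < 1 by rewrite invf_lt1.
have ir0 : 0 < r^-1 by rewrite invr_gt0.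
have sg2 : sg < 1 / 2 by lra.
have [c c0 kc] := tilted_sing_ge sg2.
pose c' := c * 2 `^ (2 * sg - 1).
have c'0 : 0 < c' by rewrite mulr_gt0// powR_gt0.
suff : 1 <= r^-1 by rewrite leNgt ir1.
apply: (@expR_growth R c' C) => // v v0; set L := expR v.
have -> : expR (1 * v) = L by rewrite mul1r.
have -> : expR (r^-1 * v) = L `^ r^-1 by rewrite /L -expRM mulrC.
have L0 : 0 < L by exact: expR_gt0.
pose e := expR (- L) / 2; have e0 : 0 < e by rewrite divr_gt0 ?expR_gt0.
have e2 : e <= 1 / 2.
  by rewrite /e ler_pM2r ?invr_gt0// -expR0 ler_expR oppr_le0 ltW.
pose A : set R := `[e, 1 / 2]%classic.
have mA : measurable A by exact: measurable_itv.
pose G s : R := \1_A s * s `^ (- (2 * sg)).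
have AE s : \1_A s = (e <= s <= 1 / 2)%R%:R :> R.
  rewrite indicE; congr ((_ : bool)%:R).
  by apply/idP/idP => [/set_mem|h]; [|apply/mem_set]; rewrite /A/= in_itv/=.
have mG : measurable_fun setT G.
  by apply: measurable_funM; [exact: measurable_indic|exact: measurable_powR].
have G0 s : 0 <= G s by rewrite mulr_ge0 ?powR_ge0// AE.
have LE : ln (1 / 2 / e) = L.
  have -> : 1 / 2 / e = expR L by rewrite /e expRN; field; rewrite gt_eqF// expR_gt0.
  by rewrite expRK.
have GN : ('N[leb]_p[EFin \o G] <= (L `^ r^-1)%:E)%E.
  rewrite pr; apply: Lnorm_le_root => //.
  rewrite -LE -integral_inv_itv// [leRHS]integral_mkcond.
  rewrite le_eqVlt; apply/orP; left; apply/eqP; apply: eq_integral => s _.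
  rewrite patchE /= /G AE; case: ifPn => [|].
    rewrite inE/= in_itv/= => /[dup] /andP[es _] ->.
    rewrite mul1r -powRrM -E mulNr mulVf ?gt_eqF// powR_inv1//.
    exact: le_trans (ltW e0) es.
  rewrite notin_setE/= in_itv/= => /negP/negbTE ->.
  by rewrite mul0r powR0// gt_eqF.
have := @bound_on_itv G (L `^ r^-1) (- e) 0 (c' * L) mG G0 GN.
have cL0 : 0 <= c' * L := mulr_ge0 (ltW c'0) (ltW L0).
rewrite qy rexpy powRr0 mulr1; apply; rewrite ?oppr_lt0//.
move=> t /andP[te t0]; rewrite /T theta_eq0 mul0r expR0 mul1e.
apply: (@le_trans _ _ (\int[leb]_(s in A) (c' * s `^ (-1))%:E)%E).
  rewrite EFinM -[X in (_ * X%:E)%E]LE -integral_inv_itv// -ge0_integralZl//; last 3 first.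
  - exact: measurable_inv_itv.
  - move=> s /=; rewrite in_itv/= => /andP[es _].
    by rewrite lee_fin invr_ge0 (le_trans (ltW e0)).
  - by rewrite lee_fin ltW.
  rewrite le_eqVlt; apply/orP; left; apply/eqP; apply: eq_integral => s.
  rewrite inE/= in_itv/= => /andP[es _].
  by rewrite powR_inv1 ?EFinM// (le_trans (ltW e0)).
apply: (potential_ge_setI hk) => //.
- by apply: measurable_funM => //; exact: measurable_powR.
- by move=> s _; rewrite mulr_ge0 ?powR_ge0// ltW.
move=> s; rewrite /A /= in_itv/= => /andP[es s2]; have s0 := lt_le_trans e0 es.
have u0 : t - s < 0 by lra.
have u1 : `|t - s| <= 1 by rewrite ltr0_norm//; lra.
apply: (@le_trans _ _ ((c * (2 * s) `^ (2 * sg - 1))%:E * (G s)%:E)%E).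
  rewrite -EFinM lee_fin /G AE es s2 mul1r powRM ?(ltW s0)// /c' -!mulrA -powRD.
    by have -> : 2 * sg - 1 + - (2 * sg) = - 1 by ring.
  by rewrite (gt_eqF s0) implybT.
apply: lee_wpmul2r; first by rewrite lee_fin.
apply: le_trans (kc _ u1); rewrite lee_fin ler_wpM2l ?(ltW c0)// ltr0_norm//.
rewrite -(opprB 1); apply: powRN_anti; lra.
Qed.

End norm_bound.
End necessity.

(** * Return to the half-line *)

Section weighted_norms.
Context {R : realType}.
Notation leb := (@lebesgue_measure R).
Implicit Types (p q : \bar R) (G : R -> R) (c d n r : R).

Lemma Lnorm_scale_le p (F : R -> \bar R) d n : (1 <= p)%E -> 0 < d -> 0 <= n ->
  measurable_fun setT F -> (forall t, 0 <= F t)%E ->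
  ('N[leb]_p[F] <= n%:E)%E -> (Lnorm leb p (fun t => (d%:E * F t)%E) <= (d * n)%:E)%E.
Proof.
move=> p1 d0 n0 mF F0; have d0' : (0 <= d%:E)%E by rewrite lee_fin ltW.
have dF0 t : (0 <= d%:E * F t)%E by exact: mule_ge0.
have dn0 : 0 <= d * n by rewrite mulr_ge0// ltW.
case: p p1 => [r| |]// p1; last first.
  move=> /Lnormy_leP => /(_ lebesgue_measureT_gt0 F0) FN.
  apply/Lnormy_leP => //; first exact: lebesgue_measureT_gt0.
  by apply: ae_imply FN => t Ft; rewrite EFinM; apply: lee_wpmul2l.
rewrite lee_fin in p1; have r0 := lt_le_trans ltr01 p1.
move=> /(Lnorm_EFin_leP _ r0 n0) => /(_ F0) FN; apply/Lnorm_EFin_leP => //.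
have mFr : measurable_fun setT (fun t => F t `^ r)%E.
  exact: (measurableT_comp (measurable_poweR r)).
have -> : (\int[leb]_t (d%:E * F t) `^ r = \int[leb]_t ((d `^ r)%:E * F t `^ r))%E.
  by apply: eq_integral => t _; rewrite poweRM.
rewrite ge0_integralZl//; last 2 first.
- by move=> t _; exact: poweR_ge0.
- by rewrite lee_fin powR_ge0.
rewrite powRM ?(ltW d0)// EFinM; apply: lee_wpmul2l => //.
by rewrite lee_fin powR_ge0.
Qed.

Lemma mu_bessel_setT_gt0 (alpha : R) : (0 < mu_bessel alpha setT)%E.
Proof.
rewrite lt0e measure_ge0 andbT mu_bessel_expR//; apply/eqP.
have mE : measurable_fun setT (fun s : R => expR ((2 * alpha + 2) * s)).
  exact: measurable_expRM.
move=> /(ge0_integral_eq0_pos measurableT mE (fun s => expR_gt0 _)) H.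
by have := @lebesgue_measureT_gt0 R; rewrite [X in leb X](_ : _ = expR @^-1` setT)// H ltxx.
Qed.

(** The logarithmic change of variable turns the measure into Lebesgue measure
    with an exponential density, which is absorbed in the function. *)
Lemma Lnorm_half_expR (alpha : R) p (g : R -> \bar R) : (1 <= p)%E ->
  measurable_fun (`]0, +oo[ : set R) g ->
  Lnorm_half alpha p g =
  Lnorm leb p (fun s => ((expR ((2 * alpha + 2) * rexp p * s))%:E * g (expR s))%E).
Proof.
move=> p1 mg; rewrite /Lnorm_half.
pose gD : R -> \bar R := g \_ `]0%R, +oo[%classic; rewrite -/gD; case: p p1 => [r| |]// p1; last first.
  rewrite rexpy unlock /Lnorm mu_bessel_setT_gt0 lebesgue_measureT_gt0.
  rewrite !ess_sup_inf.ess_supEae; congr ereal_inf; apply/seteqP.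
  have E s : `|(expR ((2 * alpha + 2) * 0 * s))%:E * g (expR s)|%E =
             `|gD (expR s)|%E.
    by rewrite mulr0 mul0r expR0 mul1e /gD patchE mem_set//= in_itv/= expR_gt0.
  split=> y /=.
    move=> /(ae_mu_bessel_expR alpha (fun x => `|gD x| <= y)%E).
    by apply: ae_imply => s; rewrite E.
  move=> H; apply/(ae_mu_bessel_expR alpha (fun x => `|gD x| <= y)%E).
  by apply: ae_imply H => s; rewrite E.
rewrite lee_fin in p1; have r0 := lt_le_trans ltr01 p1.
rewrite rexp_EFin// unlock; apply: (congr1 (poweR^~ r^-1)).
transitivity (\int[mu_bessel alpha]_(x in `]0%R, +oo[) (`|g x| `^ r))%E.
  rewrite [RHS]integral_mkcond; apply: eq_integral => x _; rewrite /gD !patchE.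
  by case: ifP => // _; rewrite abse0 poweR0r// gt_eqF.
rewrite ge0_integral_mu_bessel; last 2 first.
- apply: (measurableT_comp (measurable_poweR r)).
  by apply: measurableT_comp.
- by move=> y _; exact: poweR_ge0.
apply: eq_integral => s _; rewrite abseM poweRM// muleC; congr (_ * _)%E.
rewrite gee0_abs ?lee_fin ?expR_ge0// poweR_EFin -expRM; congr (expR _)%:E.
by field; rewrite gt_eqF.
Qed.

End weighted_norms.

Section logarithmic_coordinates.
Context {R : realType}.
Notation leb := (@lebesgue_measure R).
Implicit Types (f : R -> R) (e t s y : R).
Notation pos := (`]0%R, +oo[%classic : set R).

(** The function on the line whose L^p norm is the weighted norm of f, for the
    appropriate e. *)
Definition log_weight e f s : R := expR (e * s) * `|f (expR s)|.

Lemma log_weight_ge0 e f s : 0 <= log_weight e f s.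
Proof. by rewrite mulr_ge0 ?expR_ge0. Qed.

Lemma measurable_comp_expR (g : R -> \bar R) : measurable_fun pos g ->
  measurable_fun setT (g \o expR).
Proof.
move=> mg; apply: (measurable_comp _ _ mg) => //.
by move=> _ [s _ <-]; rewrite /= in_itv/= expR_gt0.
Qed.

Lemma measurable_log_weight e f : measurable_fun pos f ->
  measurable_fun setT (log_weight e f).
Proof.
move=> mf; apply: measurable_funM; first exact: measurable_expRM.
apply: measurableT_comp => //; apply/measurable_EFinP.
by apply: (@measurable_comp_expR (EFin \o f)); exact/measurable_EFinP.
Qed.

Lemma measurable_of_expR (g : R -> \bar R) (g' : R -> \bar R) :
  measurable_fun setT g' -> (forall s, g (expR s) = g' s) -> measurable_fun pos g.
Proof.
move=> mg' gg'; apply: (eq_measurable_fun (g' \o (@ln R))).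
  by move=> y; rewrite inE/= in_itv/= andbT => y0; rewrite -gg' lnK.
apply: measurable_funTS; apply: (measurableT_comp mg'); exact: measurable_ln.
Qed.

Variables (al sg C0 : R).
Let be := al + 1 - sg.
Let D := 2 * al + 2.
Variable k : R -> \bar R.
Hypothesis hk : kernel_profile be sg k.
Hypothesis C00 : 0 < C0.
Hypothesis HK : forall t s,
  K_kernel al sg (expR t) (expR s) = ((C0 * expR (- (be * (t + s))))%:E * k (t - s)%R)%E.

Let K_ge0 t s : (0 <= K_kernel al sg (expR t) (expR s))%E.
Proof.
rewrite HK mule_ge0//; last exact: (profile_ge0 hk).
by rewrite lee_fin mulr_ge0 ?expR_ge0// ltW.
Qed.

Let measurable_K t : measurable_fun pos (K_kernel al sg (expR t)).
Proof.
apply: (measurable_of_expR _ (HK t)); apply: emeasurable_funM.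
  apply/measurable_EFinP; apply: measurable_funM => //.
  apply: measurableT_comp => //; apply: measurableT_comp => //.
  by apply: measurable_funM => //; exact: measurable_funD.
apply: (measurableT_comp (profile_measurable hk)); exact: measurable_funB.
Qed.

(** The weight of G, the density of the measure and the exponential factor of the
    kernel combine into a tilt of the kernel and an exponential in t. *)
Lemma integral_K_expR e f t : measurable_fun pos f ->
  (\int[mu_bessel al]_(y in pos) (K_kernel al sg (expR t) y * `|f y|%:E) =
   (C0 * expR ((D - 2 * be - e) * t))%:E *
   potential (tilted (D - be - e) k) (log_weight e f) t)%E.
Proof.
move=> mf; rewrite ge0_integral_mu_bessel; last 2 first.
- apply: emeasurable_funM; first exact: measurable_K.
  by apply/measurable_EFinP; exact: measurableT_comp.
- move=> y y0; apply: mule_ge0; last by rewrite lee_fin.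
  by rewrite -(lnK y0).
rewrite /potential -ge0_integralZl//; last 3 first.
- apply: measurable_potential_integrand; first exact: (measurable_tilted hk).
  exact: measurable_log_weight.
- move=> s _; apply: mule_ge0; first exact: (tilted_ge0 hk).
  by rewrite lee_fin log_weight_ge0.
- by rewrite lee_fin mulr_ge0 ?expR_ge0// ltW.
apply: eq_integral => s _; rewrite HK /tilted /log_weight.
rewrite -/D; set ks := k _; set F := `|f _|.
have E : expR (- (be * (t + s))) * expR (D * s) = expR ((D - 2 * be - e) * t) *
    (expR (- ((D - be - e) * (t - s))) * expR (e * s)).
  by rewrite -!expRD; congr expR; ring.
have mulK (x : R) (y : \bar R) : (x%:E * (ks * y) = ks * (x%:E * y))%E by exact: muleCA.
rewrite -!muleA !mulK -!EFinM; congr (_ * EFin _)%E.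
transitivity (C0 * F * (expR (- (be * (t + s))) * expR (D * s))); first by ring.
by rewrite E; ring.
Qed.

Lemma integral_K_abs f t : measurable_fun pos f ->
  (\int[mu_bessel al]_(y in pos) `|K_kernel al sg (expR t) y * (f y)%:E| =
   \int[mu_bessel al]_(y in pos) (K_kernel al sg (expR t) y * `|f y|%:E))%E.
Proof.
move=> mf; apply: eq_integral => y; rewrite inE/= in_itv/= andbT => y0.
by rewrite abseM gee0_abs// -(lnK y0).
Qed.

(** An element of the domain is one whose absolute value has an almost everywhere
    finite potential. *)
Lemma Dom_potential_log e f : measurable_fun pos f ->
  Dom_potential al sg f <->
  {ae leb, forall t, (potential (tilted (D - be - e) k) (log_weight e f) t < +oo)%E}.
Proof.
move=> mf; rewrite /Dom_potential /=.
pose P x := (mu_bessel al).-integrable pos (fun y => (K_kernel al sg x y * (f y)%:E)%E).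
have PE t : P (expR t) <-> (potential (tilted (D - be - e) k) (log_weight e f) t < +oo)%E.
  have c0 : 0 < C0 * expR ((D - 2 * be - e) * t) by rewrite mulr_gt0 ?expR_gt0.
  have p0 : (0 <= potential (tilted (D - be - e) k) (log_weight e f) t)%E.
    by apply: potential_ge0 => [u|s]; [exact: (tilted_ge0 hk)|exact: log_weight_ge0].
  have mF : measurable_fun pos (fun y => (K_kernel al sg (expR t) y * (f y)%:E)%E).
    by apply: emeasurable_funM; [exact: measurable_K|exact/measurable_EFinP].
  split=> [/integrableP[_]|h].
    rewrite integral_K_abs// (integral_K_expR e)// => h.
    rewrite ltNge leye_eq; apply/negP => /eqP py.
    by move: h; rewrite py gt0_muley ?lte_fin// ltxx.
  apply/integrableP; split => //; rewrite integral_K_abs// (integral_K_expR e)//.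
  by rewrite lte_mul_pinfty// lee_fin ltW.
rewrite (ae_lebesgue_expR P); split; apply: ae_imply => t; first by move/PE.
by move=> ?; apply/PE.
Qed.

Let maxeM (K : \bar R) (r : R) : (0 <= K)%E ->
  (maxe (K * r%:E) 0 = K * `|Num.max r 0|%:E)%E.
Proof.
move=> K0; have [r0|/ltW r0] := leP 0 r.
  by rewrite ger0_norm// max_l// mule_ge0.
by rewrite normr0 mule0 max_r// mule_ge0_le0.
Qed.

(** The integral is by definition the difference of those of the positive and
    negative parts; as differences of explicit measurable functions, potentials
    are thereby measurable. *)
Lemma I_potential_expR e f t : measurable_fun pos f ->
  (I_potential al sg f (expR t) = (C0 * expR ((D - 2 * be - e) * t))%:E *
    potential (tilted (D - be - e) k) (log_weight e (fun x => Num.max (f x) 0%R)) t -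
   (C0 * expR ((D - 2 * be - e) * t))%:E *
    potential (tilted (D - be - e) k) (log_weight e (fun x => Num.max (- f x)%R 0%R)) t)%E.
Proof.
move=> mf; rewrite /I_potential integralE -!integral_K_expR; last 2 first.
- by apply: measurable_funrneg.
- by apply: measurable_funrpos.
congr (_ - _)%E; apply: eq_integral => y; rewrite inE/= in_itv/= andbT => y0.
  by rewrite funeposE maxeM// -(lnK y0).
by rewrite funenegE -muleN -EFinN maxeM// -(lnK y0).
Qed.

Lemma measurable_I_potential f : measurable_fun pos f ->
  measurable_fun pos (I_potential al sg f).
Proof.
move=> mf.
have mP g : measurable_fun pos g -> measurable_fun setT (fun t =>
    (C0 * expR ((D - 2 * be - 0) * t))%:E *
    potential (tilted (D - be - 0) k) (log_weight 0 g) t)%E.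
  move=> mg; apply: emeasurable_funM.
    by apply/measurable_EFinP; apply: measurable_funM => //; exact: measurable_expRM.
  apply: measurable_potential; [exact: (measurable_tilted hk)|exact: (tilted_ge0 hk)|
    exact: measurable_log_weight|exact: log_weight_ge0].
apply: (measurable_of_expR _ (fun t => I_potential_expR 0 t mf)).
by apply: emeasurable_funB; apply: mP; [exact: measurable_funrpos|exact: measurable_funrneg].
Qed.

Lemma I_potential_ge0_expR e f t : measurable_fun pos f -> (forall x, 0 <= f x) ->
  (I_potential al sg f (expR t) = (C0 * expR ((D - 2 * be - e) * t))%:E *
    potential (tilted (D - be - e) k) (log_weight e f) t)%E.
Proof.
move=> mf f0; rewrite /I_potential -integral_K_expR//.
by apply: eq_integral => y _; rewrite ger0_norm.
Qed.

Lemma abs_I_potential_le e f t : measurable_fun pos f ->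
  (`|I_potential al sg f (expR t)| <= (C0 * expR ((D - 2 * be - e) * t))%:E *
    potential (tilted (D - be - e) k) (log_weight e f) t)%E.
Proof.
move=> mf; rewrite /I_potential -integral_K_expR// -integral_K_abs//.
apply: le_abse_integral => //.
by apply: emeasurable_funM; [exact: measurable_K|exact/measurable_EFinP].
Qed.

Lemma Lnorm_half_I_potential (q : \bar R) b e f : (1 <= q)%E -> measurable_fun pos f ->
  Lnorm_half al q (fun x => (x `^ (- b))%:E * I_potential al sg f x)%E =
  Lnorm leb q (fun t => (expR ((D * rexp q - b) * t))%:E * I_potential al sg f (expR t))%E.
Proof.
move=> q1 mf; rewrite Lnorm_half_expR//; last first.
  apply: emeasurable_funM; last exact: measurable_I_potential.
  by apply: measurable_funTS; apply/measurable_EFinP; exact: measurable_powR.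
apply: eq_Lnorm => t; rewrite muleA -EFinM -expRM -expRD; congr ((expR _)%:E * _)%E.
by rewrite /D; ring.
Qed.

Lemma Lnorm_half_log_weight (p : \bar R) a f : (1 <= p)%E -> measurable_fun pos f ->
  Lnorm_half al p (fun x => (x `^ a * f x)%:E) =
  Lnorm leb p (EFin \o log_weight (a + D * rexp p) f).
Proof.
move=> p1 mf; rewrite Lnorm_half_expR//; last first.
  apply/measurable_EFinP; apply: measurable_funM => //.
  by apply: measurable_funTS; exact: measurable_powR.
rewrite -Lnorm_abse; apply: eq_Lnorm => s /=.
rewrite normrM ger0_norm ?expR_ge0// normrM ger0_norm ?powR_ge0//.
rewrite /log_weight -expRM mulrA -expRD; congr (_ * _)%:E; congr expR.
by rewrite /D; ring.
Qed.

(** Every nonnegative function on the line comes from one on the half-line; this is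
    a section of [log_weight]. *)
Definition half_line e (G : R -> R) x : R := x `^ (- e) * G (ln x).

Lemma log_weightK e (G : R -> R) : (forall s, 0 <= G s) ->
  log_weight e (half_line e G) = G.
Proof.
move=> G0; apply/funext => s; rewrite /log_weight /half_line expRK.
rewrite ger0_norm ?mulr_ge0 ?powR_ge0// -expRM mulrA -expRD.
by rewrite mulrC [X in expR X](_ : _ = 0) ?expR0 ?mulr1//; ring.
Qed.

Lemma measurable_half_line e (G : R -> R) : measurable_fun setT G ->
  measurable_fun pos (half_line e G).
Proof.
move=> mG; apply: measurable_funTS; apply: measurable_funM; first exact: measurable_powR.
by apply: (measurableT_comp mG); exact: measurable_ln.
Qed.

Lemma half_line_ge0 e (G : R -> R) x : (forall s, 0 <= G s) -> 0 <= half_line e G x.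
Proof. by move=> G0; rewrite mulr_ge0 ?powR_ge0. Qed.

End logarithmic_coordinates.

Section homogeneity.
Context {R : realType}.
Notation leb := (@lebesgue_measure R).
Implicit Types (G : R -> R) (p q : \bar R) (c t s Q : R).

Lemma le_Lnorm q (F1 F2 : R -> \bar R) : (1 <= q)%E -> measurable_fun setT F1 ->
  measurable_fun setT F2 -> (forall t, `|F1 t| <= F2 t)%E ->
  ('N[leb]_q[F1] <= 'N[leb]_q[F2])%E.
Proof.
move=> q1 m1 m2 F12; have F20 t : (0 <= F2 t)%E by exact: le_trans (F12 t).
have [->|] := eqVneq ('N[leb]_q[F2])%E +oo%E; first by rewrite leey.
rewrite -ltey => N2; have N20 : (0 <= 'N[leb]_q[F2])%E by exact: Lnorm_ge0.
have [n nE] : exists n, ('N[leb]_q[F2])%E = n%:E.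
  by exists (fine ('N[leb]_q[F2])%E); rewrite fineK// ge0_fin_numE.
have n0 : 0 <= n by rewrite -lee_fin -nE.
have F2n : ('N[leb]_q[F2] <= n%:E)%E by rewrite nE.
have F10 t : (0 <= (abse \o F1) t)%E by exact: abse_ge0.
have mF1 : measurable_fun setT (abse \o F1) by exact: measurableT_comp.
rewrite nE -Lnorm_abse; case: q q1 F2n {nE N2 N20} => [r| |]// q1; last first.
  move=> /Lnormy_leP => /(_ lebesgue_measureT_gt0 F20) FN.
  apply/Lnormy_leP => //; first exact: lebesgue_measureT_gt0.
  by apply: ae_imply FN => t; exact: le_trans (F12 t).
rewrite lee_fin in q1; have r0 := lt_le_trans ltr01 q1.
move=> /(Lnorm_EFin_leP _ r0 n0) => /(_ F20) FN; apply/Lnorm_EFin_leP => //.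
apply: le_trans FN; apply: ge0_le_integral => //.
- by move=> t _; exact: poweR_ge0.
- exact: (measurableT_comp (measurable_poweR r)).
- exact: (measurableT_comp (measurable_poweR r)).
by move=> t _; apply: gt0_ler_poweR; rewrite ?(ltW r0)// ?in_itv/= ?leey ?andbT//.
Qed.

Variables (be sg : R) (k : R -> \bar R).
Hypothesis hk : kernel_profile be sg k.
Hypothesis sg0 : 0 < sg.

Lemma potentialZ Q G c t : measurable_fun setT G -> (forall s, 0 <= G s) -> 0 <= c ->
  potential (tilted Q k) (fun s => c * G s) t = (c%:E * potential (tilted Q k) G t)%E.
Proof.
move=> mG G0 c0; rewrite /potential -ge0_integralZl//.
- by apply: eq_integral => s _; rewrite EFinM muleCA.
- by apply: measurable_potential_integrand => //; exact: (measurable_tilted hk).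
- by move=> s _; apply: mule_ge0; [exact: (tilted_ge0 hk)|rewrite lee_fin].
Qed.

Lemma Lnorm_normalize p G (n : R) : (1 <= p)%E -> measurable_fun setT G -> (forall s, 0 <= G s) ->
  0 < n -> ('N[leb]_p[EFin \o G] <= n%:E)%E ->
  ('N[leb]_p[EFin \o (fun s => (n^-1 * G s)%R)] <= 1)%E.
Proof.
move=> p1 mG G0 n0 Gn.
have := @Lnorm_scale_le R p (EFin \o G) n^-1 n p1.
rewrite invr_gt0 mulVf ?gt_eqF//; apply=> //; first exact: ltW.
exact/measurable_EFinP.
Qed.

Lemma potential_ae_finite_of_norm p Q G : (1 <= p)%E ->
  `|Q| < be ?<= if (p == 1%E) -> measurable_fun setT G -> (forall s, 0 <= G s) ->
  ('N[leb]_p[EFin \o G] < +oo)%E ->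
  {ae leb, forall t, (potential (tilted Q k) G t < +oo)%E}.
Proof.
move=> p1 Qbe mG G0 GN.
(* a positive bound of the norm *)
pose n := fine ('N[leb]_p[EFin \o G])%E + 1.
have n0 : 0 < n by rewrite ltr_wpDl// fine_ge0// Lnorm_ge0.
have Gn : ('N[leb]_p[EFin \o G] <= n%:E)%E.
  rewrite EFinD fineK; first by rewrite leeDl// lee_fin.
  by rewrite ge0_fin_numE// Lnorm_ge0.
have mG' : measurable_fun setT (fun s => n^-1 * G s) by exact: measurable_funM.
have G'0 s : 0 <= n^-1 * G s by rewrite mulr_ge0// invr_ge0 ltW.
have := tilted_potential_ae_finite hk sg0 p1 Qbe mG' G'0 (Lnorm_normalize p1 mG G0 n0 Gn).
apply: ae_imply => t; rewrite potentialZ// ?invr_ge0 ?(ltW n0)// => h.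
rewrite ltNge leye_eq; apply/negP => /eqP py.
by move: h; rewrite py gt0_muley ?lte_fin ?invr_gt0// ltxx.
Qed.

(** Rescale G to norm at most 1.  The norm may vanish, so one divides by slightly
    larger numbers and passes to the limit. *)
Lemma potential_norm_bound p q Q : (1 <= p)%E -> (p <= q)%E ->
  `|Q| < be ?<= if (p == 1%E) && (q == +oo%E) ->
  rexp p - 2 * sg < rexp q ?<= if (~~ ((p == 1%E) || (q == +oo%E))) ->
  exists2 A : R, 0 < A & forall G, measurable_fun setT G -> (forall s, 0 <= G s) ->
    ('N[leb]_p[EFin \o G] < +oo)%E ->
    ('N[leb]_q[potential (tilted Q k) G] <= A%:E * 'N[leb]_p[EFin \o G])%E.
Proof.
move=> p1 pq Qbe He; have [A A0 hA] := tilted_potential_bounded hk sg0 p1 pq Qbe He.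
have q1 : (1 <= q)%E by exact: le_trans pq.
exists (A + 1); first by rewrite ltr_wpDl.
move=> G mG G0 GN; have N0 : (0 <= 'N[leb]_p[EFin \o G])%E by exact: Lnorm_ge0.
have [n nE] : exists n, ('N[leb]_p[EFin \o G])%E = n%:E.
  by exists (fine ('N[leb]_p[EFin \o G])%E); rewrite fineK// ge0_fin_numE.
have n0 : 0 <= n by rewrite -lee_fin -nE.
rewrite nE -EFinM; apply/lee_addgt0Pr => e e0.
pose m := n + e / (A + 1).
have A10 : 0 < A + 1 by rewrite ltr_wpDl.
have m0 : 0 < m by rewrite ltr_wpDl// divr_gt0.
have Gm : ('N[leb]_p[EFin \o G] <= m%:E)%E by rewrite nE lee_fin lerDl divr_ge0 ?ltW.
have mG' : measurable_fun setT (fun s => m^-1 * G s) by exact: measurable_funM.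
have G'0 s : 0 <= m^-1 * G s by rewrite mulr_ge0// invr_ge0 ltW.
have H := hA _ mG' G'0 (Lnorm_normalize p1 mG G0 m0 Gm).
have tk0 := tilted_ge0 hk Q.
have mpot : measurable_fun setT (potential (tilted Q k) (fun s => m^-1 * G s)).
  by apply: measurable_potential => //; exact: (measurable_tilted hk).
have := @Lnorm_scale_le R q (potential (tilted Q k) (fun s => m^-1 * G s)) m A q1 m0 A0.
have -> : (fun t => m%:E * potential (tilted Q k) (fun s => (m^-1 * G s)%R) t)%E =
    potential (tilted Q k) G.
  apply/funext => t; rewrite potentialZ ?invr_ge0 ?(ltW m0)// muleA -EFinM.
  by rewrite divff ?mul1e// gt_eqF.
move=> /(_ mpot (potential_ge0 tk0 G'0) H) /le_trans; apply.
rewrite -EFinD lee_fin /m; set d := e / (A + 1).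
have eE : e = d * (A + 1) by rewrite divfK// gt_eqF.
rewrite [X in _ <= _ + X]eE -subr_ge0.
have -> : (A + 1) * n + d * (A + 1) - (n + d) * A = n + d by ring.
exact: ltW.
Qed.

End homogeneity.

Section exponents.
Context {R : realType}.
Implicit Types (p q : \bar R) (x y : R) (b : bool).

Lemma lee_rexp p q : (1 <= p)%E -> (1 <= q)%E -> (p <= q)%E = (rexp q <= rexp p).
Proof.
case: p => [p| |]//; case: q => [q| |]// p1 q1.
- rewrite !lee_fin in p1 q1 *; have p0 := lt_le_trans ltr01 p1.
  have q0 := lt_le_trans ltr01 q1.
  by rewrite !rexp_EFin// lef_pV2 ?posrE.
- by rewrite leey rexpy rexp_ge0.
- rewrite lee_fin in q1; have q0 := lt_le_trans ltr01 q1.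
  by rewrite rexpy rexp_EFin// leye_eq/= leNgt invr_gt0 q0.
- by rewrite !lexx.
Qed.

Lemma rexp_hoelder_conjugate p : (1 <= p)%E -> rexp (hoelder_conjugate p) = 1 - rexp p.
Proof.
move=> p1; have q1 := hoelder_conj_ge1 p1.
have := hoelder_conjugate_eq1 (lt_le_trans (ltNyr 1) p1).
have fin (x : \bar R) : (1 <= x)%E -> x^-1%E = (rexp x)%:E :> \bar R.
  case: x => [x x1|_|//]; last by rewrite rexpy invey.
  rewrite lee_fin in x1; have x0 := lt_le_trans ltr01 x1.
  by rewrite rexp_EFin// inver gt_eqF.
rewrite gt_eqF ?(lt_le_trans _ p1)// => /(_ isT).
by rewrite !fin// -EFinD => -[]; lra.
Qed.

Lemma hoelder_conjugate_eq1E q : (1 <= q)%E -> (hoelder_conjugate q == 1%E) = (q == +oo%E).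
Proof.
move=> q1; apply/eqP/eqP => [|->]; last exact: hoelder_conjugatey.
by move=> E; rewrite -[q]hoelder_conjugateK E hoelder_conjugate1.
Qed.

Lemma rexp_gt0 q : (1 <= q)%E -> q != +oo%E -> 0 < rexp q.
Proof.
case: q => [q| |]// q1 _; rewrite lee_fin in q1; have q0 := lt_le_trans ltr01 q1.
by rewrite rexp_EFin// invr_gt0.
Qed.

Lemma lteif_norm x y b : `|x| < y ?<= if b <-> (- y < x ?<= if b) /\ (x < y ?<= if b).
Proof. by case: b; rewrite /= ?ler_norml ?ltr_norml; split=> /andP. Qed.

End exponents.

Theorem theorem2p5 (R : realType) (alpha sigma a b : R) (p q : \bar R)
    (alpha_gtN1 : -1 < alpha)
    (sigma_gt0 : 0 < sigma) (sigma_lt : sigma < alpha + 1)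
    (p_ge1 : (1 <= p)%E) (q_ge1 : (1 <= q)%E) :
  (wLp alpha p a `<=` Dom_potential alpha sigma <->
     (2 * sigma - (2 * alpha + 2) * rexp p < a ?<= if (p == 1%E)) /\
     (a < (2 * alpha + 2) * rexp (hoelder_conjugate p) ?<= if (p == 1%E)))
  /\
  ((exists2 C : R, 0 < C &
      forall f : R -> R, wLp alpha p a f ->
        Dom_potential alpha sigma f /\
        (Lnorm_half alpha q
           (fun x => (x `^ (- b))%:E * I_potential alpha sigma f x) <=
         C%:E * Lnorm_half alpha p (fun x => (x `^ a * f x)%:E))%E) <->
     [/\ (p <= q)%E,
         rexp q = rexp p + (a + b - 2 * sigma) / (2 * alpha + 2),
         a < (2 * alpha + 2) * rexp (hoelder_conjugate p)
           ?<= if ((p == 1%E) && (hoelder_conjugate q == 1%E)),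
         b < (2 * alpha + 2) * rexp q
           ?<= if ((p == 1%E) && (hoelder_conjugate q == 1%E)) &
         rexp p - 2 * sigma < rexp q ?<= if (~~ ((p == 1%E) || (q == +oo%E)))]).
Proof.
pose be := alpha + 1 - sigma; pose D := 2 * alpha + 2.
have D0 : 0 < D by rewrite /D; lra.
have hk := bessel_profile alpha_gtN1 sigma_gt0 sigma_lt.
have [C0 C00 HK] := K_kernel_expR alpha_gtN1 sigma_gt0 sigma_lt.
move: hk HK; rewrite -/be; set k := reduced_kernel _ _ => hk HK.
pose e := a + D * rexp p; pose Q := D - be - e.
pose theta := D * rexp q - b + (D - 2 * be - e).
rewrite (rexp_hoelder_conjugate p_ge1) (hoelder_conjugate_eq1E q_ge1) -/D.
have QE (c : bool) : `|Q| < be ?<= if c <->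
    (2 * sigma - D * rexp p < a ?<= if c) /\ (a < D * (1 - rexp p) ?<= if c).
  rewrite lteif_norm /Q /e /be /D; case: c => /=; split=> -[h1 h2]; split; lra.
have NE f : measurable_fun (`]0, +oo[%classic : set R) f ->
    Lnorm_half alpha p (fun x => (x `^ a * f x)%:E) =
    ('N[lebesgue_measure]_p[EFin \o log_weight e f])%E.
  exact: Lnorm_half_log_weight.
have DE f : measurable_fun (`]0, +oo[%classic : set R) f -> Dom_potential alpha sigma f <->
    {ae lebesgue_measure, forall t, (potential (tilted Q k) (log_weight e f) t < +oo)%E}.
  exact: (Dom_potential_log hk C00 HK e).
(* Functions on the half-line and nonnegative functions on the line determine
   each other up to absolute values. *)
have wE (G : R -> R) : measurable_fun setT G -> (forall s, 0 <= G s) ->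
    ('N[lebesgue_measure]_p[EFin \o G] < +oo)%E -> wLp alpha p a (half_line e G).
  move=> mG G0 GN; have mh := measurable_half_line e mG.
  by split => //; rewrite NE// log_weightK.
have Ldom : wLp alpha p a `<=` Dom_potential alpha sigma <->
    `|Q| < be ?<= if (p == 1%E).
  split=> [dom|Qbe f [mf fN]].
    apply: (tilt_lt_of_ae_finite hk p_ge1) => G mG G0 GN.
    have := dom _ (wE G mG G0 GN).
    by move=> /(DE _ (measurable_half_line e mG)); rewrite log_weightK.
  apply/DE => //; apply: (potential_ae_finite_of_norm hk sigma_gt0 p_ge1 Qbe).
  - exact: measurable_log_weight.
  - exact: log_weight_ge0.
  - by rewrite -NE.
split; first by rewrite Ldom QE.
have thetaE : theta = 0 <-> rexp q = rexp p + (a + b - 2 * sigma) / D.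
  have -> : theta = D * (rexp q - (rexp p + (a + b - 2 * sigma) / D)).
    by rewrite /theta /e /be /D; field; rewrite gt_eqF.
  split=> [/eqP|->]; last by rewrite subrr mulr0.
  by rewrite mulf_eq0 gt_eqF//= subr_eq0 => /eqP.
have bE (c : bool) : theta = 0 ->
    (b < D * rexp q ?<= if c) = (2 * sigma - D * rexp p < a ?<= if c).
  rewrite /theta /e /be /D => th0; case: c => /=; apply/idP/idP; lra.
have IE (f : R -> R) : measurable_fun (`]0, +oo[%classic : set R) f ->
    Lnorm_half alpha q (fun x => (x `^ (- b))%:E * I_potential alpha sigma f x)%E =
    Lnorm lebesgue_measure q (fun t => (expR ((D * rexp q - b) * t))%:E *
      I_potential alpha sigma f (expR t))%E.
  by move=> mf; exact: (Lnorm_half_I_potential hk C00 HK).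
split=> [[C CC0 H]|[pq bb ca cb ce]]; last first.
  have th0 : theta = 0 by apply/thetaE.
  have Qpq : `|Q| < be ?<= if (p == 1%E) && (q == +oo%E).
    by apply/QE; rewrite -bE.
  have [A A0 hA] := potential_norm_bound hk sigma_gt0 p_ge1 pq Qpq ce.
  exists (C0 * A); first exact: mulr_gt0.
  move=> f [mf fN]; split.
    apply: Ldom.2 => //; move: Qpq; case: (p == 1%E) => //=.
    by case: (q == +oo%E) => //=; exact: ltW.
  rewrite NE// IE//; rewrite NE// in fN.
  have mG := measurable_log_weight e mf; have G0 := log_weight_ge0 e f.
  have [n nE] : exists n, ('N[lebesgue_measure]_p[EFin \o log_weight e f])%E = n%:E.
    exists (fine ('N[lebesgue_measure]_p[EFin \o log_weight e f])%E).
    by rewrite fineK// ge0_fin_numE// Lnorm_ge0.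
  have n0 : 0 <= n by rewrite -lee_fin -nE Lnorm_ge0.
  have mpot : measurable_fun setT (potential (tilted Q k) (log_weight e f)).
    by apply: measurable_potential => //; [exact: (measurable_tilted hk)|exact: (tilted_ge0 hk)].
  have pot0 t : (0 <= potential (tilted Q k) (log_weight e f) t)%E.
    by apply: potential_ge0 => //; exact: (tilted_ge0 hk).
  apply: (@le_trans _ _ (Lnorm lebesgue_measure q
      (fun t => C0%:E * potential (tilted Q k) (log_weight e f) t)%E)).
    apply: le_Lnorm => //.
    - apply: emeasurable_funM; first by apply/measurable_EFinP; exact: measurable_expRM.
      by apply: measurable_comp_expR; exact: (measurable_I_potential hk C00 HK mf).
    - exact: emeasurable_funM.
    move=> t; rewrite abseM gee0_abs ?lee_fin ?expR_ge0//.
    apply: le_trans (lee_wpmul2l _ (abs_I_potential_le hk C00 HK e t mf)) _.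
      by rewrite lee_fin expR_ge0.
    rewrite -/be -/D -/Q muleA -EFinM mulrCA -expRD -mulrDl -/theta th0 mul0r expR0 mulr1.
    exact: lexx.
  rewrite nE -EFinM -mulrA; apply: Lnorm_scale_le => //.
    by rewrite mulr_ge0// ltW.
  by rewrite EFinM -nE; apply: hA; rewrite // nE ltry.
have bound (G : R -> R) : measurable_fun setT G -> (forall s, 0 <= G s) ->
    ('N[lebesgue_measure]_p[EFin \o G] < +oo)%E ->
    (Lnorm lebesgue_measure q (fun t => (expR (theta * t))%:E * potential (tilted Q k) G t) <=
     (C0^-1 * C)%:E * 'N[lebesgue_measure]_p[EFin \o G])%E.
  move=> mG G0 GN; have mh := measurable_half_line e mG.
  have [_] := H _ (wE G mG G0 GN).
  rewrite IE// NE// log_weightK//.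
  have [n nE] : exists n, ('N[lebesgue_measure]_p[EFin \o G])%E = n%:E.
    exists (fine ('N[lebesgue_measure]_p[EFin \o G])%E).
    by rewrite fineK// ge0_fin_numE// Lnorm_ge0.
  have n0 : 0 <= n by rewrite -lee_fin -nE Lnorm_ge0.
  rewrite nE -!EFinM -mulrA => h.
  pose F t := ((expR ((D * rexp q - b) * t))%:E *
      I_potential alpha sigma (half_line e G) (expR t))%E.
  have FE t : F t = (C0%:E * ((expR (theta * t))%:E * potential (tilted Q k) G t))%E.
    rewrite /F (I_potential_ge0_expR hk C00 HK e t mh); last first.
      by move=> x; exact: half_line_ge0.
    rewrite log_weightK// -/be -/D -/Q !muleA -!EFinM mulrCA -expRD -mulrDl.
    by congr ((_ * expR (_ * _))%:E * _)%E.
  have tk0 := tilted_ge0 hk Q.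
  have F0 t : (0 <= F t)%E.
    rewrite FE; apply: mule_ge0; first by rewrite lee_fin ltW.
    by apply: mule_ge0; [rewrite lee_fin expR_ge0|exact: potential_ge0].
  have mF : measurable_fun setT F.
    apply: emeasurable_funM; first by apply/measurable_EFinP; exact: measurable_expRM.
    by apply: measurable_comp_expR; exact: (measurable_I_potential hk C00 HK mh).
  rewrite -[X in (Lnorm _ _ X <= _)%E](_ : (fun t => C0^-1%:E * F t)%E = _).
    by apply: Lnorm_scale_le; rewrite ?invr_gt0// mulr_ge0// ltW.
  apply/funext => t; rewrite FE muleA -EFinM mulVf ?mul1e// gt_eqF//.
have CC : 0 < C0^-1 * C by rewrite mulr_gt0// invr_gt0.
have th0 := theta_eq0 hk p_ge1 q_ge1 CC bound.
have Qp : `|Q| < be ?<= if (p == 1%E) by apply/Ldom => f /H[].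
have Qpq : `|Q| < be ?<= if (p == 1%E) && (q == +oo%E).
  have [qy|qy] := eqVneq q +oo%E; first by rewrite andbT.
  rewrite andbF; apply: (tilt_lt hk p_ge1 q_ge1 CC bound).
  exact: rexp_gt0.
have [ca cb] := (QE _).1 Qpq.
split => //.
- by rewrite lee_rexp//; exact: (rexp_le hk p_ge1 q_ge1 CC bound).
- exact/thetaE.
- by rewrite bE.
case: eqVneq => [p1'|pn1] /=; first exact: (rexp_sub_lt_p1 hk p_ge1 q_ge1 CC bound).
case: eqVneq => [qy|qny] /=; first exact: (rexp_sub_lt_qy hk p_ge1 q_ge1 CC sigma_gt0 bound).
exact: (rexp_sub_le hk p_ge1 q_ge1 CC bound).
Qed.
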